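(* There is an algorithm which, given a set $X$ of $n$ points in the plane, no three of which are collinear, and an integer $t$ with $0\le t<n/2$, finds a rectangle (of arbitrary orientation) of minimum area among all rectangles that cover at least $n-t$ points of $X$, in time $O(kt^3+ktn+n^2\log n)$, where $k=k(X,t)$ is the number of points of $X$ on the first $t+1$ convex layers of $X$.
   Context: The problem ''minimum enclosing rectangle with outliers'' $\mathrm{MER}(X,t)$: given a set $X$ of $n$ planar points and an integer $t$, find a rectangle with minimum area that covers at least $n-t$ points of $X$. Rectangles are closed regions (points on the sides and vertices count as covered) and may have any orientation. Convex layers: the first convex layer of a finite planar set $X$ is the convex hull of $X$; the $i$-th convex layer is the convex hull of what remains of $X$ after the points on the first $i-1$ convex layers are removed (empty if nothing remains). A point of $X$ is on a layer if it lies on the boundary of that convex hull (and was not removed earlier). $k(X,t)$ is the number of points of $X$ lying on the first $t+1$ convex layers. Running time is measured as usual in computational geometry (unit-cost arithmetic and comparisons on real coordinates). The constant in $O(\cdot)$ is absolute. *)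

(* Defs.v *)
From HB Require Import structures.
From mathcomp Require Import all_boot all_order all_algebra.
From mathcomp Require Import all_classical reals topology normedtype exp.

Set Implicit Arguments.
Unset Strict Implicit.
Unset Printing Implicit Defensive.

Import Order.TTheory GRing.Theory Num.Theory.
Import numFieldNormedType.Exports.

Local Open Scope classical_set_scope.
Local Open Scope ring_scope.

Section Plane.
Variable R : realType.
Implicit Types p q u v : 'rV[R]_2.

Definition dot u v : R := \sum_(i < 2) u 0 i * v 0 i.

(* The norm `|u| of the library on row vectors is the sup norm. *)
Definition enorm u : R := Num.sqrt (dot u u).

Definition collinear p q r : Prop :=
  exists a d : 'rV[R]_2, d != 0 /\
    forall x, [\/ x = p, x = q | x = r] -> exists s : R, x = a + s *: d.

Definition no_three_collinear (n : nat) (X : 'I_n -> 'rV[R]_2) : Prop :=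
  forall i j k : 'I_n, i != j -> j != k -> i != k -> ~ collinear (X i) (X j) (X k).

(* A rectangle is given by one vertex and the two side vectors leaving it.
   A side may be null: minimum enclosing rectangles of one or two points are
   degenerate. *)
Record rectangle := Rectangle
  { vertex : 'rV[R]_2; side1 : 'rV[R]_2; side2 : 'rV[R]_2 }.

Definition is_rectangle (r : rectangle) : Prop := dot (side1 r) (side2 r) = 0.

Definition region (r : rectangle) : set 'rV[R]_2 :=
  [set p | exists a b : R, [/\ 0 <= a <= 1, 0 <= b <= 1 &
             p = vertex r + a *: side1 r + b *: side2 r]].

Definition area (r : rectangle) : R := enorm (side1 r) * enorm (side2 r).

Definition covered (n : nat) (X : 'I_n -> 'rV[R]_2) (r : rectangle) : {set 'I_n} :=
  [set i | `[< region r (X i) >]]%SET.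

Definition is_MER (n : nat) (X : 'I_n -> 'rV[R]_2) (t : nat) (r : rectangle) : Prop :=
  [/\ is_rectangle r, (n - t <= #|covered X r|)%N &
      forall r' : rectangle, is_rectangle r' -> (n - t <= #|covered X r'|)%N ->
        area r <= area r'].

(* Finite subsets of the plane are handled as sets of indices of points. *)
Definition hull (n : nat) (X : 'I_n -> 'rV[R]_2) (S : {set 'I_n}) : set 'rV[R]_2 :=
  [set p | exists w : 'I_n -> R,
     [/\ forall i, 0 <= w i, \sum_(i in S) w i = 1 &
         p = \sum_(i in S) w i *: X i]].

Definition boundary (A : set 'rV[R]_2) : set 'rV[R]_2 := closure A `\` interior A.

Definition on_layer (n : nat) (X : 'I_n -> 'rV[R]_2) (S : {set 'I_n}) : {set 'I_n} :=
  [set i in S | `[< boundary (hull X S) (X i) >]]%SET.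

Fixpoint remaining (n : nat) (X : 'I_n -> 'rV[R]_2) (m : nat) : {set 'I_n} :=
  if m is m'.+1 then remaining X m' :\: on_layer X (remaining X m') else [set: 'I_n]%SET.

(* Layers are numbered from 0 here. *)
Definition layer (n : nat) (X : 'I_n -> 'rV[R]_2) (m : nat) : {set 'I_n} :=
  on_layer X (remaining X m).

Definition num_layer_points (n : nat) (X : 'I_n -> 'rV[R]_2) (t : nat) : nat :=
  #|\bigcup_(m < t.+1) layer X m|%SET.

End Plane.

(* Real RAM.  The memory consists of arrays of naturals and arrays of reals,
   addressed by (array name, index); array names are literals of the program,
   so that a program uses finitely many arrays.  Reals support + - * / and
   comparisons (no root, no rounding, no conversion to naturals).  Naturals
   serve as indices and counters and support + - and comparisons; they have no
   multiplication, so that unit cost on them is not abusive. *)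

Inductive nexp :=
| NConst of nat
| NLoad of nat & nexp
| NAdd of nexp & nexp
| NSub of nexp & nexp.

Inductive rexp :=
| RConst of nat
| RLoad of nat & nexp
| RAdd of rexp & rexp
| RSub of rexp & rexp
| RMul of rexp & rexp
| RDiv of rexp & rexp.

Inductive bexp :=
| BNLe of nexp & nexp
| BRLe of rexp & rexp
| BNot of bexp
| BAnd of bexp & bexp.

Inductive cmd :=
| CSkip
| CNStore of nat & nexp & nexp
| CRStore of nat & nexp & rexp
| CSeq of cmd & cmd
| CIf of bexp & cmd & cmd
| CWhile of bexp & cmd.

Fixpoint ncost (e : nexp) : nat :=
  match e with
  | NConst _ => 1
  | NLoad _ e1 => (ncost e1).+1
  | NAdd e1 e2 | NSub e1 e2 => (ncost e1 + ncost e2).+1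
  end.

Fixpoint rcost (e : rexp) : nat :=
  match e with
  | RConst _ => 1
  | RLoad _ e1 => (ncost e1).+1
  | RAdd e1 e2 | RSub e1 e2 | RMul e1 e2 | RDiv e1 e2 => (rcost e1 + rcost e2).+1
  end.

Fixpoint bcost (b : bexp) : nat :=
  match b with
  | BNLe e1 e2 => (ncost e1 + ncost e2).+1
  | BRLe e1 e2 => (rcost e1 + rcost e2).+1
  | BNot b1 => (bcost b1).+1
  | BAnd b1 b2 => (bcost b1 + bcost b2).+1
  end.

Section RealRAM.
Variable R : realType.

Record state := State { nmem : nat -> nat -> nat; rmem : nat -> nat -> R }.

Fixpoint neval (s : state) (e : nexp) : nat :=
  match e with
  | NConst c => c
  | NLoad a e1 => nmem s a (neval s e1)
  | NAdd e1 e2 => neval s e1 + neval s e2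
  | NSub e1 e2 => neval s e1 - neval s e2
  end%N.

(* Division by zero yields 0. *)
Fixpoint reval (s : state) (e : rexp) : R :=
  match e with
  | RConst c => c%:R
  | RLoad a e1 => rmem s a (neval s e1)
  | RAdd e1 e2 => reval s e1 + reval s e2
  | RSub e1 e2 => reval s e1 - reval s e2
  | RMul e1 e2 => reval s e1 * reval s e2
  | RDiv e1 e2 => if reval s e2 == 0 then 0 else reval s e1 / reval s e2
  end.

Fixpoint beval (s : state) (b : bexp) : bool :=
  match b with
  | BNLe e1 e2 => (neval s e1 <= neval s e2)%N
  | BRLe e1 e2 => reval s e1 <= reval s e2
  | BNot b1 => ~~ beval s b1
  | BAnd b1 b2 => beval s b1 && beval s b2
  end.

Definition update (T : Type) (m : nat -> nat -> T) (a i : nat) (x : T) : nat -> nat -> T :=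
  fun b j => if (b == a) && (j == i) then x else m b j.

(* exec c s T s' : started in s, the program c halts in s' after T operations. *)
Inductive exec : cmd -> state -> nat -> state -> Prop :=
| ExecSkip s : exec CSkip s 1 s
| ExecNStore s a e1 e2 :
    exec (CNStore a e1 e2) s (ncost e1 + ncost e2).+1
      (State (update (nmem s) a (neval s e1) (neval s e2)) (rmem s))
| ExecRStore s a e1 e2 :
    exec (CRStore a e1 e2) s (ncost e1 + rcost e2).+1
      (State (nmem s) (update (rmem s) a (neval s e1) (reval s e2)))
| ExecSeq s s1 s2 c1 c2 T1 T2 :
    exec c1 s T1 s1 -> exec c2 s1 T2 s2 -> exec (CSeq c1 c2) s (T1 + T2) s2
| ExecIfTrue s s1 b c1 c2 T :
    beval s b -> exec c1 s T s1 -> exec (CIf b c1 c2) s (bcost b + T) s1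
| ExecIfFalse s s1 b c1 c2 T :
    ~~ beval s b -> exec c2 s T s1 -> exec (CIf b c1 c2) s (bcost b + T) s1
| ExecWhileFalse s b c :
    ~~ beval s b -> exec (CWhile b c) s (bcost b) s
| ExecWhileTrue s s1 s2 b c T1 T2 :
    beval s b -> exec c s T1 s1 -> exec (CWhile b c) s1 T2 s2 ->
    exec (CWhile b c) s (bcost b + T1 + T2) s2.

(* Input: n and t in cells 0 and 1 of array 0 of naturals; the coordinates of
   the i-th point in cell i of arrays 0 and 1 of reals; 0 elsewhere. *)
Definition input (n t : nat) (X : 'I_n -> 'rV[R]_2) : state :=
  State
    (fun a i => match a, i with 0, 0 => n | 0, 1 => t | _, _ => 0 end%N)
    (fun a i => match a, (insub i : option 'I_n) with
                | 0%N, Some j => X j 0 0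
                | 1%N, Some j => X j 0 1
                | _, _ => 0
                end).

(* Output: coordinates of a vertex and of two side vectors, in cells 0 to 5 of
   array 2 of reals. *)
Definition output (s : state) : rectangle R :=
  let vec i := \row_(j < 2) rmem s 2%N (i + j)%N in
  Rectangle (vec 0%N) (vec 2%N) (vec 4%N).

End RealRAM.

(* Main.v *)
(* A minimum-area rectangle containing a set S of points may be taken with a
   side through two points i, j of S.  Indeed, as long as the four supporting
   points of S do not change, the area for the direction u is
   W(u) H(u) / |u|^2 with W and H linear in u; and if W H - lam |u|^2 is
   positive at two vectors, it is positive on the cone they span, by AM-GM and
   Cauchy-Schwarz.  If S misses at most t points, then at most t points lie to
   the right of the line i -> j.  Each peeled layer contains one of them as
   long as there are any, so i is on one of the first t+1 layers; and a given i
   has at most 2t+2 such partners j.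

   The pairs are found by sorting, for every i, the directions to the other
   points modulo pi, and updating a count along the sorted list: O(n log n) for
   each i.  For each pair, all the points to the right of i -> j are discarded;
   then, for every number a of points discarded on the left, the feasible pairs
   (b discarded on the right, p discarded at the top) form a staircase, which is
   followed in O(t) steps.  This takes O(t^2) once the t+1 extreme points in
   three directions have been extracted by a tournament tree, which takes
   O(n + t log n), and t log n = O(t^2 + n). *)

Require Import Defs.
From mathcomp Require Import all_boot all_order all_algebra.
From mathcomp Require Import all_classical reals topology normedtype exp.
From mathcomp Require Import zify ring lra.

Set Implicit Arguments.
Unset Strict Implicit.
Unset Printing Implicit Defensive.

Import Order.TTheory GRing.Theory Num.Theory.
Import numFieldNormedType.Exports.

Local Open Scope ring_scope.

(* Arrays of naturals are numbered 0, 1, 2, and so on, separately from arrays of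
   reals; a scalar variable is cell 0 of its own array.
   Naturals: vI, vJ the current pair; iA, iB, iP the numbers of points discarded
   on the left, on the right and at the top; LL, RL, TL the points in the
   order of discarding; CNT k the number of discard lists containing k, and vE
   the number of k with CNT k > 0; HAVE = 1 once a rectangle has been stored;
   ORD the angular order around vI, SGN the flips of directions into the
   upper half-plane, vC the number of points to the right of the normalized line.
   Reals: KEY the input of select; PX, PY the coordinates along the
   direction (rUX, rUY) and its normal; rDEN its squared length; BEST the
   least area so far. *)
Local Notation "c1 ;; c2" := (CSeq c1 c2) (at level 61, right associativity).
Local Notation nvar a := (NLoad a (NConst 0)).
Local Notation "a ::= e" := (CNStore a (NConst 0) e) (at level 60).
Local Notation vQ := 7%N (only parsing).
Local Notation DEAD := 11%N (only parsing).
Local Notation TREE := 12%N (only parsing).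
Local Notation PAR := 13%N (only parsing).
Local Notation vV := 14%N (only parsing).
Local Notation vM := 15%N (only parsing).
Local Notation vA := 16%N (only parsing).
Local Notation vB := 17%N (only parsing).
Local Notation KEY := 3%N (only parsing).
Local Notation nN := (NLoad 0 (NConst 0)) (only parsing).
Local Notation nT := (NLoad 0 (NConst 1)) (only parsing).
Local Notation vI := 1%N (only parsing).
Local Notation vJ := 2%N (only parsing).
Local Notation iA := 3%N (only parsing).
Local Notation iB := 4%N (only parsing).
Local Notation iP := 5%N (only parsing).
Local Notation vIT := 6%N (only parsing).
Local Notation HAVE := 8%N (only parsing).
Local Notation vE := 9%N (only parsing).
Local Notation CNT := 10%N (only parsing).
Local Notation LL := 18%N (only parsing).
Local Notation RL := 19%N (only parsing).
Local Notation TL := 20%N (only parsing).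
Local Notation vIDX := 25%N (only parsing).
Local Notation OUT := 2%N (only parsing).
Local Notation PX := 4%N (only parsing).
Local Notation PY := 5%N (only parsing).
Local Notation BEST := 6%N (only parsing).
Local Notation rUX := 7%N (only parsing).
Local Notation rUY := 8%N (only parsing).
Local Notation rDEN := 9%N (only parsing).
Local Notation rW := 10%N (only parsing).
Local Notation rH := 11%N (only parsing).
Local Notation rAR := 12%N (only parsing).
Local Notation rvar a := (RLoad a (NConst 0)).
Local Notation "a :=r: e" := (CRStore a (NConst 0) e) (at level 60).
Local Notation ORD := 21%N (only parsing).
Local Notation SGN := 22%N (only parsing).
Local Notation vC := 23%N (only parsing).
Local Notation vPP := 24%N (only parsing).
Local Notation vRR := 26%N (only parsing).
Local Notation rDX := 13%N (only parsing).
Local Notation rDY := 14%N (only parsing).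

(** * A program logic with time bounds *)

(** The machine has neither roots nor trigonometry, so directions are never normalized: for u = X j
    - X i all lengths along u and its normal are scaled by |u|, areas are W H / |u|^2, angles are
    compared through the l1 unit circle, and turning u means passing to u + c J u, J being a quarter
    turn. The time budget shapes the program. Sorting is affordable once per point i but not once
    per pair, so shallow pairs are recognized from the angular order, and each of the at most k (2t
    + 2) of them gets O(n + t log n + t^2). For t > 0 this sums to O(k t n + k t^3); for t = 0 these
    terms vanish, and the O(k n) spent on pairs is absorbed by n^2 log n. Correctness rests on two
    facts: a stored rectangle is admissible and has the recorded area, and every admissible
    rectangle has at least the area of some flush box on a shallow pair, which [process] has
    matched. Orienting i -> j with the covered points on its left makes the flush side the bottom
    one, so one search serves all four sides. *)

Fixpoint nwrites (c : cmd) : seq nat :=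
  match c with
  | CNStore a _ _ => [:: a]
  | CSeq c1 c2 | CIf _ c1 c2 => nwrites c1 ++ nwrites c2
  | CWhile _ c1 => nwrites c1
  | _ => [::]
  end.

Fixpoint rwrites (c : cmd) : seq nat :=
  match c with
  | CRStore a _ _ => [:: a]
  | CSeq c1 c2 | CIf _ c1 c2 => rwrites c1 ++ rwrites c2
  | CWhile _ c1 => rwrites c1
  | _ => [::]
  end.

Fixpoint loopfree (c : cmd) : bool :=
  match c with
  | CSeq c1 c2 | CIf _ c1 c2 => loopfree c1 && loopfree c2
  | CWhile _ _ => false
  | _ => true
  end.

(** An upper bound for loop-free commands: a conditional is charged for both branches. The value on
    a loop is a dummy. *)
Fixpoint cost (c : cmd) : nat :=
  match c with
  | CNStore _ e1 e2 => (ncost e1 + ncost e2).+1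
  | CRStore _ e1 e2 => (ncost e1 + rcost e2).+1
  | CSeq c1 c2 => cost c1 + cost c2
  | CIf b c1 c2 => bcost b + (cost c1 + cost c2)
  | _ => 1
  end.

Definition For (v : nat) (e : nexp) (c : cmd) : cmd :=
  CSeq (CNStore v (NConst 0) (NConst 0))
    (CWhile (BNLe (NAdd (NLoad v (NConst 0)) (NConst 1)) e)
      (CSeq c (CNStore v (NConst 0) (NAdd (NLoad v (NConst 0)) (NConst 1))))).

Section Logic.
Variable R : realType.
Implicit Types (s : state R) (Q : state R -> Prop).

Definition setn s (a i x : nat) : state R := State (update (nmem s) a i x) (rmem s).

(** The frame condition: every array outside [nW] and [rW] is unchanged. With [nwrites] and
    [rwrites] it is obtained syntactically, so postconditions need only mention what a command
    writes. *)
Definition agree (nW rW : seq nat) s s' : Prop :=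
  (forall a, a \notin nW -> nmem s' a = nmem s a) /\
  (forall a, a \notin rW -> rmem s' a = rmem s a).

Lemma agree_refl nW rW s : agree nW rW s s.
Proof. by []. Qed.

Lemma agree_sub nW rW nW' rW' s s' :
  {subset nW <= nW'} -> {subset rW <= rW'} -> agree nW rW s s' -> agree nW' rW' s s'.
Proof.
move=> sn sr [hn hr]; split=> a aW.
  by apply: hn; apply: contra aW; apply: sn.
by apply: hr; apply: contra aW; apply: sr.
Qed.

Lemma agree_trans nW rW s1 s2 s3 :
  agree nW rW s1 s2 -> agree nW rW s2 s3 -> agree nW rW s1 s3.
Proof.
by move=> [n1 r1] [n2 r2]; split=> a aW; rewrite ?n2 ?n1 ?r2 ?r1.
Qed.

Lemma update_neq (T : Type) (m : nat -> nat -> T) a i x b :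
  b != a -> update m a i x b = m b.
Proof. by rewrite /update => /negbTE ->. Qed.

Lemma exec_agree c s T s' : exec c s T s' -> agree (nwrites c) (rwrites c) s s'.
Proof.
have catl (p q : seq nat) : {subset p <= p ++ q} by move=> a; rewrite mem_cat => ->.
have catr (p q : seq nat) : {subset q <= p ++ q} by move=> a; rewrite mem_cat orbC => ->.
elim=> {c s T s'} //=.
- by move=> s a e1 e2; split=> b; rewrite ?inE //= => ba; rewrite update_neq.
- by move=> s a e1 e2; split=> b; rewrite ?inE //= => ba; rewrite update_neq.
- move=> s s1 s2 c1 c2 T1 T2 _ h1 _ h2.
  apply: (@agree_trans _ _ _ s1); first by apply: agree_sub h1.
  by apply: agree_sub h2.
- by move=> s s1 b c1 c2 T _ _ h; apply: agree_sub h.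
- by move=> s s1 b c1 c2 T _ _ h; apply: agree_sub h.
- by move=> s s1 s2 b c T1 T2 _ _ h1 _ h2; apply: agree_trans h1 h2.
Qed.

(** Total correctness with a time bound. As [T] is only an upper bound, costs may be rounded up at
    every stage. *)
Definition runs (c : cmd) s (T : nat) Q : Prop :=
  exists T' s', [/\ exec c s T' s', (T' <= T)%N & Q s'].

Lemma runs_conseq c s T T' Q Q' :
  runs c s T Q -> (T <= T')%N -> (forall s', Q s' -> Q' s') -> runs c s T' Q'.
Proof.
move=> [T1 [s1 [e1 l1 q1]]] TT' QQ'; exists T1, s1.
by split=> //; [exact: leq_trans TT' | exact: QQ'].
Qed.

Lemma runs_le c s T T' Q : runs c s T Q -> (T <= T')%N -> runs c s T' Q.
Proof. by move=> h l; apply: runs_conseq h l _. Qed.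

Lemma runs_agree c s T Q : runs c s T Q ->
  runs c s T (fun s' => agree (nwrites c) (rwrites c) s s' /\ Q s').
Proof.
move=> [T1 [s1 [e1 l1 q1]]]; exists T1, s1; split=> //.
by split=> //; exact: exec_agree e1.
Qed.

Lemma runs_seq c1 c2 s T1 T2 Q :
  runs c1 s T1 (fun s1 => agree (nwrites c1) (rwrites c1) s s1 -> runs c2 s1 T2 Q) ->
  runs (CSeq c1 c2) s (T1 + T2) Q.
Proof.
move=> [T [s1 [e1 l1 h]]]; have [T' [s2 [e2 l2 q]]] := h (exec_agree e1).
by exists (T + T')%N, s2; split=> //; [exact: ExecSeq e1 e2 | exact: leq_add].
Qed.

Lemma runs_if b c1 c2 s T Q :
  (beval s b -> runs c1 s T Q) -> (~~ beval s b -> runs c2 s T Q) ->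
  runs (CIf b c1 c2) s (bcost b + T) Q.
Proof.
case: (boolP (beval s b)) => hb.
  move=> /(_ isT) [T1 [s1 [e l q]]] _; exists (bcost b + T1)%N, s1.
  by split=> //; [exact: ExecIfTrue | rewrite leq_add2l].
move=> _ /(_ isT) [T1 [s1 [e l q]]]; exists (bcost b + T1)%N, s1.
by split=> //; [exact: ExecIfFalse | rewrite leq_add2l].
Qed.

(** The effect of a loop-free command as a function, so that straight-line code is executed by
    simplification. *)
Fixpoint sl (c : cmd) s : state R :=
  match c with
  | CNStore a e1 e2 => setn s a (neval s e1) (neval s e2)
  | CRStore a e1 e2 => State (nmem s) (update (rmem s) a (neval s e1) (reval s e2))
  | CSeq c1 c2 => sl c2 (sl c1 s)
  | CIf b c1 c2 => if beval s b then sl c1 s else sl c2 s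
  | _ => s
  end.

Lemma runs_sl c s Q : loopfree c -> Q (sl c s) -> runs c s (cost c) Q.
Proof.
elim: c s Q => //=.
- by move=> s Q _ q; exists 1, s; split=> //; constructor.
- by move=> a e1 e2 s Q _ q; eexists; eexists; split; [constructor| |exact: q].
- by move=> a e1 e2 s Q _ q; eexists; eexists; split; [constructor| |exact: q].
- move=> c1 h1 c2 h2 s Q /andP[l1 l2] q.
  by apply: runs_seq; apply: h1 => // _; apply: h2.
- move=> b c1 h1 c2 h2 s Q /andP[l1 l2] q.
  apply: runs_if => hb; move: q; rewrite ?hb ?(negbTE hb) => q.
    by apply: runs_le (leq_addr _ _); apply: h1.
  by apply: runs_le (leq_addl _ _); apply: h2.
Qed.

Lemma runs_sl_le c s T Q : loopfree c -> (cost c <= T)%N -> Q (sl c s) -> runs c s T Q.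
Proof. by move=> lf lT q; apply: runs_le lT; apply: runs_sl. Qed.

(** The index of the invariant bounds the iterations still to come, so [I] is invariant and variant
    at once. *)
Lemma runs_while b c (I : nat -> state R -> Prop) d s T :
  (forall k s', (k <= d)%N -> agree (nwrites c) (rwrites c) s s' ->
     I k s' -> beval s' b -> (0 < k)%N /\ runs c s' T (I k.-1)) ->
  I d s ->
  runs (CWhile b c) s (d * (bcost b + T) + bcost b)
    (fun s' => ~~ beval s' b /\ exists k, I k s').
Proof.
move=> hI Is.
suff gen k s1 : (k <= d)%N -> agree (nwrites c) (rwrites c) s s1 -> I k s1 ->
    runs (CWhile b c) s1 (k * (bcost b + T) + bcost b)
      (fun s' => ~~ beval s' b /\ exists k, I k s').
  exact: gen (leqnn d) (agree_refl _ _ s) Is.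
elim: k s1 {Is} => [|k IHk] s1 kd ag Is.
  case: (boolP (beval s1 b)) => hb; first by have [] := hI _ _ kd ag Is hb.
  exists (bcost b), s1; split=> //; first exact: ExecWhileFalse.
  by split=> //; exists 0.
case: (boolP (beval s1 b)) => hb; last first.
  exists (bcost b), s1; split=> //; [exact: ExecWhileFalse | exact: leq_addl |].
  by split=> //; exists k.+1.
have [_ [T1 [s2 [e1 l1 I2]]]] := hI _ _ kd ag Is hb.
have [T2 [s3 [e2 l2 q]]] := IHk _ (ltnW kd) (agree_trans ag (exec_agree e1)) I2.
exists (bcost b + T1 + T2)%N, s3; split=> //; first exact: ExecWhileTrue e1 e2.
by move: l1 l2; rewrite mulSn; set S := (k * _)%N; lia.
Qed.

(** The bound [e] is evaluated again at each turn, hence the hypothesis that its value is stable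
    under the frame. The cost [f] depends on the turn because [visit] is expensive at shallow pairs
    only. Of the 11, 5 belong to the test and 6 to the increment; the final 11 covers the
    initialization and the last test. *)
Lemma runs_for v e c N (I : nat -> state R -> Prop) (f : nat -> nat) s :
  (forall s', agree (nwrites (For v e c)) (rwrites c) s s' -> neval s' e = N) ->
  v \notin nwrites c ->
  I 0%N (setn s v 0 0) ->
  (forall i s', (i < N)%N -> agree (nwrites (For v e c)) (rwrites c) s s' ->
     nmem s' v 0%N = i -> I i s' -> runs c s' (f i) (fun s'' =>
       agree (nwrites c) (rwrites c) s' s'' -> I i.+1 (setn s'' v 0 i.+1))) ->
  runs (For v e c) s (\sum_(i < N) (f i + (ncost e + 11)) + (ncost e + 11)) (I N).
Proof.
move=> he vc I0 hI.
have vW : v \in nwrites (For v e c) by rewrite /= inE eqxx.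
have subc : {subset nwrites c <= nwrites (For v e c)}.
  by move=> a ac; rewrite /= inE mem_cat ac orbT.
have set_ag s1 k : agree (nwrites (For v e c)) (rwrites c) s1 (setn s1 v 0 k).
  split=> //= a; rewrite !(inE, mem_cat) negb_or => /andP[av _].
  by rewrite update_neq.
have loop : forall m s1, (m <= N)%N -> agree (nwrites (For v e c)) (rwrites c) s s1 ->
    nmem s1 v 0%N = (N - m)%N -> I (N - m)%N s1 ->
    runs (CWhile (BNLe (NAdd (NLoad v (NConst 0)) (NConst 1)) e)
      (CSeq c (CNStore v (NConst 0) (NAdd (NLoad v (NConst 0)) (NConst 1))))) s1
      (\sum_(N - m <= i < N) (f i + (ncost e + 11)) + (ncost e + 5)) (I N).
  elim=> [|m IHm] s1 mN ag sv Is.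
    exists (ncost e + 5)%N, s1; split=> //; last by rewrite subn0 in Is.
      have -> : (ncost e + 5)%N = bcost (BNLe (NAdd (NLoad v (NConst 0)) (NConst 1)) e).
        by rewrite /=; lia.
      by apply: ExecWhileFalse; rewrite /= (he _ ag) sv subn0 addn1 ltnn.
    by rewrite leq_addl.
  have lt : (N - m.+1 < N)%N by lia.
  have [T1 [s2 [e1 l1 h2]]] := hI _ _ lt ag sv Is.
  have ag2 := exec_agree e1.
  have sv2 : nmem s2 v 0%N = (N - m.+1)%N by rewrite ag2.1.
  have E : (N - m.+1).+1 = (N - m)%N by lia.
  have := IHm (setn s2 v 0 (N - m.+1).+1) (ltnW mN).
  case.
  - apply: agree_trans (set_ag _ _); apply: agree_trans ag _.
    by apply: agree_sub ag2.
  - by rewrite /= /update !eqxx E.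
  - by rewrite -E; exact: h2 ag2.
  move=> T2 [s3 [e3 l3 q]].
  exists (bcost (BNLe (NAdd (NLoad v (NConst 0)) (NConst 1)) e) + (T1 + 6) + T2)%N, s3.
  split=> //.
    apply: ExecWhileTrue e3; first by rewrite /= (he _ ag) sv; lia.
    apply: ExecSeq e1 _.
    have -> : setn s2 v 0 (N - m.+1).+1 = State (update (nmem s2) v (neval s2 (NConst 0))
       (neval s2 (NAdd (NLoad v (NConst 0)) (NConst 1)))) (rmem s2).
      by rewrite /setn /= sv2 addn1.
    exact: ExecNStore.
  rewrite big_ltn // E /=; move: l1 l3; set S1 := (\sum_(_ <= i < _) _)%N.
  lia.
have sv0 : nmem (setn s v 0 0) v 0%N = 0%N by rewrite /= /update !eqxx.
have [||||T [s1 [e1 l1 q]]] := loop N (setn s v 0 0) => //.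
- by rewrite sv0 subnn.
- by rewrite subnn.
exists (3 + T)%N, s1; split=> //.
  by apply: ExecSeq e1; exact: (@ExecNStore R s v (NConst 0) (NConst 0)).
rewrite subnn big_mkord in l1; move: l1; set S1 := (\sum_(_ < _) _)%N; lia.
Qed.

Lemma runs_for_cst v e c N (I : nat -> state R -> Prop) f s :
  (forall s', agree (nwrites (For v e c)) (rwrites c) s s' -> neval s' e = N) ->
  v \notin nwrites c ->
  I 0%N (setn s v 0 0) ->
  (forall i s', (i < N)%N -> agree (nwrites (For v e c)) (rwrites c) s s' ->
     nmem s' v 0%N = i -> I i s' -> runs c s' f (fun s'' =>
       agree (nwrites c) (rwrites c) s' s'' -> I i.+1 (setn s'' v 0 i.+1))) ->
  runs (For v e c) s (N * (f + (ncost e + 11)) + (ncost e + 11)) (I N).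
Proof.
move=> he vc I0 hI; have := @runs_for v e c N I (fun=> f) s he vc I0 hI.
by rewrite big_const_ord iter_addn_0 mulnC.
Qed.

Lemma runs_loop v e c N (I : nat -> state R -> Prop) f T s Q :
  (forall s', agree (nwrites (For v e c)) (rwrites c) s s' -> neval s' e = N) ->
  v \notin nwrites c ->
  I 0%N (setn s v 0 0) ->
  (forall i s', (i < N)%N -> agree (nwrites (For v e c)) (rwrites c) s s' ->
     nmem s' v 0%N = i -> I i s' -> runs c s' f (fun s'' =>
       agree (nwrites c) (rwrites c) s' s'' -> I i.+1 (setn s'' v 0 i.+1))) ->
  (N * (f + (ncost e + 11)) + (ncost e + 11) <= T)%N ->
  (forall s', agree (nwrites (For v e c)) (rwrites c) s s' -> I N s' -> Q s') ->
  runs (For v e c) s T Q.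
Proof.
move=> he vc I0 hI lT IQ.
apply: runs_conseq (runs_agree (runs_for_cst he vc I0 hI)) lT _ => s' [ag Is].
by apply: IQ => //; apply: agree_sub ag => a; rewrite //= cats0.
Qed.
End Logic.

(** * Extraction of the smallest keys by a tournament tree *)

(* The leaf of j is n + j and the children of v are 2 v and 2 v + 1; n need not
   be a power of 2.  Extracted indices are DEAD and lose every match. *)
Definition winner : cmd :=
  vA ::= NLoad TREE (NAdd (nvar vV) (nvar vV)) ;;
  vB ::= NLoad TREE (NAdd (NAdd (nvar vV) (nvar vV)) (NConst 1)) ;;
  CIf (BNot (BAnd (BNLe (NLoad DEAD (nvar vB)) (NConst 0))
        (BNot (BAnd (BNLe (NLoad DEAD (nvar vA)) (NConst 0))
                    (BRLe (RLoad KEY (nvar vA)) (RLoad KEY (nvar vB)))))))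
    (CNStore TREE (nvar vV) (nvar vA)) (CNStore TREE (nvar vV) (nvar vB)).

Definition climb : cmd := vV ::= NLoad PAR (nvar vV) ;; winner.

Definition build_node : cmd :=
  vV ::= NSub (NSub nN (NConst 1)) (nvar vQ) ;;
  winner ;;
  CNStore PAR (NAdd (nvar vV) (nvar vV)) (nvar vV) ;;
  CNStore PAR (NAdd (NAdd (nvar vV) (nvar vV)) (NConst 1)) (nvar vV).

Definition pop (out : nat) : cmd :=
  vA ::= NLoad TREE (NConst 1) ;;
  CNStore out (nvar vM) (nvar vA) ;;
  CNStore DEAD (nvar vA) (NConst 1) ;;
  vV ::= NAdd nN (nvar vA).

Definition select (out : nat) (cnt : nexp) : cmd :=
  For vQ nN (CNStore TREE (NAdd nN (nvar vQ)) (nvar vQ) ;;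
             CNStore DEAD (nvar vQ) (NConst 0)) ;;
  For vQ (NSub nN (NConst 1)) build_node ;;
  For vM cnt (pop out ;; CWhile (BNLe (NConst 2) (nvar vV)) climb).

Definition upd (T : Type) (f : nat -> T) (i : nat) (x : T) : nat -> T :=
  fun j => if j == i then x else f j.

(** Ancestors in the heap numbering, each node being its own ancestor. *)
Definition anc (v u : nat) : Prop := exists e, iter e half u = v.

Lemma anc_refl v : anc v v.
Proof. by exists 0%N. Qed.

Lemma anc_half v u w : w./2 = v -> anc w u -> anc v u.
Proof. by move=> <- [e he]; exists e.+1; rewrite iterS he. Qed.

Lemma anc_le v u : anc v u -> (v <= u)%N.
Proof.
case=> e <-; elim: e => //= e IH; apply: leq_trans IH.
by lia.
Qed.

Lemma anc_proper v u : anc v u -> v = u \/ anc v u./2.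
Proof. by case=> -[|e] /= he; [left | right; exists e; rewrite -iterSr]. Qed.

Section Tournament.
Variable R : realType.
Implicit Types (s : state R) (key : nat -> R) (D tr out : nat -> nat).

(** A total preorder in which the dead indices are all equivalent and come last. *)
Definition beats D key a b : bool := (0 < D b)%N || (D a == 0%N) && (key a <= key b).

Lemma beats_refl D key a : beats D key a a.
Proof. by rewrite /beats lexx andbT lt0n; case: eqP. Qed.

Lemma beats_total D key a b : ~~ beats D key a b -> beats D key b a.
Proof.
rewrite /beats; case: (posnP (D b)) => //= Db; case: (posnP (D a)) => //= Da.
by rewrite -ltNge => /ltW.
Qed.

Lemma beats_trans D key b a c : beats D key a b -> beats D key b c -> beats D key a c.
Proof.
rewrite /beats; case: (posnP (D c)) => //= Dc; case: (posnP (D b)) => //= Db.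
by case: eqP => //= _ h1 h2; apply: le_trans h1 h2.
Qed.

Definition sub_at n tr v : Prop := (tr v < n)%N /\ anc v (n + tr v).
Definition ok_at D key tr v : bool :=
  beats D key (tr v) (tr (v + v)%N) && beats D key (tr v) (tr (v + v + 1)%N).
Definition tree_sub n tr : Prop := forall v, (0 < v < n + n)%N -> sub_at n tr v.
Definition tree_ok n D key tr : Prop := forall v, (0 < v < n)%N -> ok_at D key tr v.

(** A proper descendant of node n + j is at least 2 (n + j), beyond every leaf number. *)
Lemma tree_leaf n tr j : tree_sub n tr -> (j < n)%N -> tr (n + j)%N = j.
Proof.
move=> sub jn; have [|hn [e he]] := sub (n + j)%N; first by lia.
case: e he => [|e] /= he; first by lia.
have : ((iter e half (n + tr (n + j)))./2 <= (n + tr (n + j))./2)%N.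
  by apply: half_leq; apply: anc_le; exists e.
by rewrite he; lia.
Qed.

Lemma tree_root n D key tr j : tree_sub n tr -> tree_ok n D key tr -> (j < n)%N ->
  beats D key (tr 1%N) j.
Proof.
move=> sub ok jn; rewrite -(tree_leaf sub jn).
have : (0 < n + j < n + n)%N by lia.
move: (n + j)%N => v; elim/ltn_ind: v => v IH /andP[v0 vn].
have [->|v1] := eqVneq v 1%N; first exact: beats_refl.
have h1 : (v./2 < v)%N by lia.
apply: beats_trans (IH _ h1 _) _; first by lia.
have /andP[] : ok_at D key tr v./2 by apply: ok; lia.
have := odd_double_half v; case: (odd v) => /= E.
  by move=> _; congr beats; congr tr; lia.
by move=> + _; congr beats; congr tr; lia.
Qed.

Definition selected n key m out : Prop :=
  forall p, (p < m)%N ->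
    [/\ (out p < n)%N, out p \notin mkseq out p
      & forall j, (j < n)%N -> j \notin mkseq out p -> key (out p) <= key j].

Definition win D key tr v : nat :=
  if beats D key (tr (v + v)%N) (tr (v + v + 1)%N) then tr (v + v)%N else tr (v + v + 1)%N.

Lemma runs_winner s : let v := nmem s vV 0%N in let tr := nmem s TREE in
  runs winner s (cost winner) (fun s' => nmem s' TREE = upd tr v
    (win (nmem s DEAD) (rmem s KEY) tr v)).
Proof.
move=> v tr; apply: runs_sl => //; rewrite /= /update /= -/v -/tr.
rewrite -/v -/tr negb_and negbK -ltnNge /win /beats leqn0.
by case: ifP => _ /=.
Qed.

Lemma upd_eq (T : Type) (f : nat -> T) i x : upd f i x i = x.
Proof. by rewrite /upd eqxx. Qed.

Lemma upd_neq (T : Type) (f : nat -> T) i x j : j != i -> upd f i x j = f j.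
Proof. by rewrite /upd => /negbTE ->. Qed.

Lemma sub_at_win n D key tr v : sub_at n tr (v + v) -> sub_at n tr (v + v + 1) ->
  sub_at n (upd tr v (win D key tr v)) v.
Proof.
rewrite /sub_at upd_eq /win => -[n1 a1] [n2 a2].
by case: ifP => _; split=> //; [apply: anc_half a1 | apply: anc_half a2]; lia.
Qed.

Lemma sub_at_upd n tr v w u : u != v -> sub_at n tr u -> sub_at n (upd tr v w) u.
Proof. by rewrite /sub_at => uv; rewrite upd_neq. Qed.

Lemma ok_at_win D key tr v : (0 < v)%N -> ok_at D key (upd tr v (win D key tr v)) v.
Proof.
move=> v0; have h1 : (v + v != v)%N by lia.
have h2 : (v + v + 1 != v)%N by lia.
rewrite /ok_at upd_eq !upd_neq // /win; case: ifP => h; first by rewrite beats_refl.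
by rewrite beats_refl beats_total ?h.
Qed.

Lemma ok_at_upd D key tr v w u : u != v -> (u + u != v)%N -> (u + u + 1 != v)%N ->
  ok_at D key (upd tr v w) u = ok_at D key tr u.
Proof. by move=> *; rewrite /ok_at !upd_neq. Qed.

(* While the path of a modified leaf is being repaired, only the proper ancestors
   of the current node v may be wrong. *)
Definition climb_inv n D key tr v : Prop :=
  [/\ (0 < v < n + n)%N, tree_sub n tr
    & forall u, (0 < u < n)%N -> ~ anc u v./2 -> ok_at D key tr u].

Lemma climb_step n D key tr v : (1 < v)%N -> climb_inv n D key tr v ->
  climb_inv n D key (upd tr v./2 (win D key tr v./2)) v./2.
Proof.
move=> v1 [/andP[v0 vn] sub ok]; set v' := v./2.
have v'0 : (0 < v')%N by rewrite /v'; lia.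
have v'n : (v' < n)%N by rewrite /v'; lia.
split; first lia.
  move=> u un; have [->|uv] := eqVneq u v'; last by apply: sub_at_upd => //; exact: sub.
  by apply: sub_at_win; apply: sub; lia.
move=> u un nanc; have [->|uv] := eqVneq u v'; first exact: ok_at_win.
rewrite ok_at_upd //.
- apply: ok => // /anc_proper[]//; exact/eqP.
- by apply/eqP => E; apply: nanc; rewrite -E addnn doubleK; exact: anc_refl.
- by apply/eqP => E; apply: nanc; rewrite -E (_ : (_)./2 = u); [exact: anc_refl | lia].
Qed.

(** Killing [w] can only spoil matches in which [w] takes part, and [w] occurs only at ancestors of
    its leaf n + w. *)
Lemma climb_start n D key tr w : (w < n)%N -> tree_sub n tr -> tree_ok n D key tr ->
  climb_inv n (upd D w 1%N) key tr (n + w)%N.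
Proof.
move=> wn sub ok; split=> //; first lia.
move=> u un nanc.
have trw x : (0 < x < n + n)%N -> (x = u \/ x./2 = u) -> tr x != w.
  move=> xn xu; apply/eqP => xw; have [_] := sub x xn; rewrite xw => /anc_proper[E|ax].
    case: xu => xu; first by lia.
    by apply: nanc; rewrite -E xu; exact: anc_refl.
  by apply: nanc; case: xu => [<-//|xu]; apply: anc_half ax.
have h0 : tr u != w by apply: trw; [lia | left].
have h1 : tr (u + u)%N != w by apply: trw; [lia | right; lia].
have h2 : tr (u + u + 1)%N != w by apply: trw; [lia | right; lia].
by have := ok u un; rewrite /ok_at /beats !upd_neq.
Qed.

Definition par_ok n (par : nat -> nat) : Prop :=
  forall u, (1 < u < n + n)%N -> par u = u./2.

Lemma runs_climb s n d : par_ok n (nmem s PAR) ->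
  climb_inv n (nmem s DEAD) (rmem s KEY) (nmem s TREE) (nmem s vV 0%N) ->
  (nmem s vV 0%N < 2 ^ d)%N ->
  runs (CWhile (BNLe (NConst 2) (nvar vV)) climb) s (d * (4 + cost climb) + 4)
    (fun s' => tree_sub n (nmem s' TREE) /\ tree_ok n (nmem s' DEAD) (rmem s' KEY) (nmem s' TREE)).
Proof.
move=> hpar inv0 lt0.
pose I k (s' : state R) := (nmem s' vV 0%N < 2 ^ k)%N /\
  climb_inv n (nmem s' DEAD) (rmem s' KEY) (nmem s' TREE) (nmem s' vV 0%N).
apply: (@runs_conseq _ _ _ _ _ _ _ (@runs_while _ _ _ I d s (cost climb) _ _)); last first.
- move=> s' [/= hv [k [_ [v0 sub ok]]]]; split=> // u un.
  have v1 : nmem s' vV 0%N = 1%N by lia.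
  (* At the root the exempt nodes are the ancestors of [1./2 = 0], and no positive node is one. *)
  apply: ok => // -[e]; rewrite v1.
  by elim: e => /= [E|e IH]; [lia | rewrite -iterS iterSr; exact: IH].
- by rewrite /=; lia.
- by [].
move=> k s1 kd ag [hk inv] /= v2; split; first by case: k hk {kd} => //=; lia.
apply: runs_seq; apply: runs_sl => //= ag1.
set s2 := setn _ _ _ _ in ag1 *.
have hv2 : nmem s2 vV 0%N = (nmem s1 vV 0%N)./2.
  rewrite /s2 /= /update /= (ag.1 PAR) // hpar //.
  by case: inv => /andP[_ ->] _ _; rewrite v2.
apply: runs_conseq (runs_agree (runs_winner s2)) _ _ => // s3 [ag3 h3].
rewrite /I h3 !(ag3.1, ag3.2) // hv2; split.
  by case: k hk {kd} => [|k] /=; rewrite ?expnS; lia.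
have -> : nmem s2 DEAD = nmem s1 DEAD by [].
exact: climb_step.
Qed.

End Tournament.
Section Select.
Variable R : realType.
Implicit Types (s : state R).

Lemma runs_leaves s n : nmem s 0%N 0%N = n ->
  runs (For vQ nN (CNStore TREE (NAdd nN (nvar vQ)) (nvar vQ) ;;
             CNStore DEAD (nvar vQ) (NConst 0))) s (n * 30 + 30)
    (fun s' => forall j, (j < n)%N -> nmem s' TREE (n + j)%N = j /\ nmem s' DEAD j = 0%N).
Proof.
move=> hn; pose I i (s' : state R) :=
  forall j, (j < i)%N -> nmem s' TREE (n + j)%N = j /\ nmem s' DEAD j = 0%N.
apply: (@runs_loop _ _ _ _ n I 12) => //.
- by move=> s' ag; rewrite /= (ag.1 0) ?hn.
move=> i s1 lin ag hi Ii; apply: runs_le (runs_sl _ _) _ => //= _ j; rewrite /setn /=.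
rewrite /setn /update /= hi (ag.1 0) // hn ltnS leq_eqVlt => /orP[/eqP->|ji].
  by rewrite !eqxx.
have [h1 h2] := Ii j ji; rewrite eqn_add2l (_ : j == i = false); last by lia.
by split.
by rewrite /=; lia.
Qed.

Lemma runs_build s n : nmem s 0%N 0%N = n -> (0 < n)%N ->
  (forall j, (j < n)%N -> nmem s TREE (n + j)%N = j /\ nmem s DEAD j = 0%N) ->
  runs (For vQ (NSub nN (NConst 1)) build_node) s ((n - 1) * (cost build_node + 15) + 15)
    (fun s' => [/\ tree_sub n (nmem s' TREE),
       tree_ok n (nmem s' DEAD) (rmem s' KEY) (nmem s' TREE) & par_ok n (nmem s' PAR)]).
Proof.
move=> hn n0 leaf; pose I i (s' : state R) :=
  [/\ forall v, (0 < v)%N -> (n - i <= v < n + n)%N -> sub_at n (nmem s' TREE) v,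
      forall v, (0 < v)%N -> (n - i <= v < n)%N ->
        ok_at (nmem s' DEAD) (rmem s' KEY) (nmem s' TREE) v
    & forall u, (1 < u)%N -> (n - i + (n - i) <= u < n + n)%N -> nmem s' PAR u = u./2].
apply: (@runs_loop _ _ _ _ (n - 1) I (cost build_node)) => //.
- by move=> s' ag; rewrite /= (ag.1 0%N) ?hn.
- split; rewrite /setn /update /=.
  + move=> v v0 vn; have [//|h1 h2] := leaf (v - n)%N; first by lia.
    rewrite /sub_at; have E : (n + (v - n) = v)%N by lia.
    by move: h1; rewrite E => ->; rewrite E; split; [lia | exact: anc_refl].
  + lia.
  + lia.
move=> i s1 lin ag hi [I1 I2 I3].
apply: runs_le; first apply: runs_seq.
  apply: runs_sl => //= ag2.
  set s2 := setn _ _ _ _ in ag2 *.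
  apply: runs_seq; apply: runs_conseq (runs_winner s2) (leqnn _) _.
  move=> s3 h3 ag3; apply: runs_sl => //= ag4.
  have hV : nmem s2 vV 0%N = (n - i.+1)%N.
    by rewrite /s2 /setn /update /= hi (ag.1 0%N) // hn; lia.
  have hV3 : nmem s3 vV 0%N = (n - i.+1)%N by rewrite (ag3.1 vV).
  set V := (n - i.+1)%N in hV hV3.
  have V0 : (0 < V)%N by rewrite /V; lia.
  have VV : (n - i = V.+1)%N by rewrite /V; lia.
  have Vn : (V < n)%N by rewrite /V; lia.
  rewrite VV in I1 I2 I3.
  rewrite /I -/V; split.
  + move=> v v0 vn; rewrite /setn /update /= h3 hV.
    have [->|vV] := eqVneq v V; first by apply: sub_at_win; apply: I1; lia.
    by apply: sub_at_upd => //; apply: I1; lia.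
  + move=> v v0 vn; rewrite /setn /update /= h3 hV !(ag3.1, ag3.2) //.
    have -> : rmem s2 KEY = rmem s1 KEY by [].
    have [->|vV] := eqVneq v V; first exact: ok_at_win.
    by rewrite ok_at_upd //; [apply: I2 | ..]; lia.
  + move=> u u1 un; rewrite /setn /update /= hV3.
    case: ifP => [/eqP|] E1; first by lia.
    case: ifP => [/eqP|] E2; first by lia.
    by rewrite (ag3.1 PAR) //; apply: I3 => //; lia.
by rewrite /=; lia.
by move=> s' _ [h1 h2 h3]; split=> v vn; [apply: h1 | apply: h2 | apply: h3]; lia.
Qed.

(** The excluded names are the arrays that [select] itself uses. [K] depends only on the cost of
    [cnt]. *)
Lemma runs_select (out : nat) cnt : out \notin [:: 0; 7; 11; 12; 13; 14; 15; 16; 17]%N ->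
  exists K : nat, forall s n m, nmem s 0%N 0%N = n -> (0 < n)%N -> (m <= n)%N ->
  (forall s', nmem s' 0%N = nmem s 0%N -> neval s' cnt = m) ->
  runs (select out cnt) s (K * (n + m * (trunc_log 2 n).+1))
    (fun s' => selected n (rmem s KEY) m (nmem s' out)).
Proof.
rewrite !inE !negb_or => /and5P[o0 o7 o11 o12 /and5P[o13 o14 o15 o16 o17]].
exists (1000 + 2 * ncost cnt)%N => s n m hn n0 mn hcnt.
(* A climb starts at a leaf n + w < 2 n and halves the node at each turn, so [L] turns suffice. *)
pose L := (trunc_log 2 n).+2.
have n2L : (n + n < 2 ^ L)%N.
  have := trunc_log_ltn n (isT : (1 < 2)%N); rewrite /L [X in _ -> (_ < X)%N]expnS; lia.
apply: (@runs_le _ _ _ ((n * 30 + 30) + (((n - 1) * (cost build_node + 15) + 15) +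
   (m * (cost (pop out) + (L * (4 + cost climb) + 4) + (ncost cnt + 11)) +
  (ncost cnt + 11))))); last first.
  have h4 : (ncost cnt <= n * ncost cnt)%N by rewrite leq_pmull.
  have h5 : (0 <= ncost cnt * m * trunc_log 2 n)%N by [].
  rewrite /L /=; move: (ncost cnt) (trunc_log 2 n) h4 h5 => c tl h4 h5.
  have h6 : (0 <= m * tl)%N by [].
  lia.
apply: runs_seq.
apply: runs_conseq (runs_leaves hn) (leqnn _) _ => s1 h1 ag1.
have hn1 : nmem s1 0%N 0%N = n by rewrite (ag1.1 0%N).
apply: runs_seq; apply: runs_conseq (runs_build hn1 n0 h1) (leqnn _) _.
move=> s2 [sub2 ok2 par2] ag2.
pose I p (s' : state R) :=
  [/\ tree_sub n (nmem s' TREE), tree_ok n (nmem s' DEAD) (rmem s' KEY) (nmem s' TREE),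
      par_ok n (nmem s' PAR),
      forall j, (j < n)%N -> (0 < nmem s' DEAD j)%N = (j \in mkseq (nmem s' out) p)
    & selected n (rmem s KEY) p (nmem s' out)].
apply: (@runs_loop _ _ _ _ m I (cost (pop out) + (L * (4 + cost climb) + 4))) => //.
- by move=> s3 ag3; apply: hcnt; rewrite ag3.1 ?ag2.1 ?ag1.1 //= !inE; lia.
- by rewrite /= !inE; lia.
- by split=> //= j jn; rewrite /update /= (ag2.1 DEAD) // (h1 j jn).2.
- move=> i s3 im ag3 hi [sub3 ok3 par3 dead3 sel3].
  have hn3 : nmem s3 0%N 0%N = n by rewrite ag3.1 ?ag2.1 //= !inE; lia.
  have key3 : rmem s3 KEY = rmem s KEY by rewrite ag3.2 ?ag2.2 ?ag1.2.
  have E k : out != k -> (k == out) = false by rewrite eq_sym => /negbTE.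
  pose w := nmem s3 TREE 1%N.
  have root j : (j < n)%N -> beats (nmem s3 DEAD) (rmem s3 KEY) w j.
    by move=> jn; apply: tree_root jn.
  have wn : (w < n)%N by have [|] := sub3 1%N; first by lia.
  (* If the winner were dead, all [n] indices would be, but only [i < m <= n] of them have been
     popped. *)
  have w_alive : nmem s3 DEAD w = 0%N.
    apply/eqP; rewrite -leqn0 leqNgt; apply/negP => dw.
    have : (n <= i)%N; last by lia.
    rewrite -{1}(size_iota 0 n) -(size_mkseq (nmem s3 out) i).
    apply: uniq_leq_size; first exact: iota_uniq.
    move=> j; rewrite mem_iota /= add0n => jn; rewrite -dead3 //.
    by have := root j jn; rewrite /beats (gtn_eqF dw) /= orbF.
  pose s4 := sl (pop out) s3.
  have s4D : nmem s4 DEAD = upd (nmem s3 DEAD) w 1%N.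
    by rewrite /s4 /= /setn /update /= !E.
  have s4o : nmem s4 out = upd (nmem s3 out) i w.
    rewrite /s4 /= /setn /update /= hi (negbTE o11) (negbTE o14) (negbTE o16) /=.
    by rewrite eqxx.
  have s4T : nmem s4 TREE = nmem s3 TREE.
    by rewrite /s4 /= /setn /update /= !E.
  have s4P : nmem s4 PAR = nmem s3 PAR.
    by rewrite /s4 /= /setn /update /= !E.
  have s4V : nmem s4 vV 0%N = (n + w)%N.
    by rewrite /s4 /= /setn /update /= !E //= hn3.
  have s4K : rmem s4 KEY = rmem s3 KEY by [].
  apply: runs_seq; apply: runs_sl => // ag4.
  have := @runs_climb R s4 n L; rewrite s4P s4D s4T s4V s4K => rc.
  apply: runs_conseq (runs_agree (rc par3 _ _)) _ _; first exact: climb_start.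
  + by apply: leq_trans n2L; lia.
  + by rewrite addnC mulnC.
  move=> s5 [ag5 [sub5 ok5]] _.
  have s5o : nmem s5 out = upd (nmem s3 out) i w.
    by rewrite ag5.1 ?s4o //= !inE; lia.
  have mk p (u : nat) : (p <= i)%N -> mkseq (upd (nmem s3 out) i u) p = mkseq (nmem s3 out) p.
    move=> pi; apply/eq_in_map => x; rewrite mem_iota /= add0n => xp.
    by rewrite upd_neq //; lia.
  have o15' : out != 15%N by [].
  have s6o : nmem (setn s5 15 0 i.+1) out = nmem s5 out by rewrite /= update_neq.
  rewrite /I s6o /setn /update /= s5o; split=> //.
  + by rewrite (ag5.1 PAR) // s4P.
  + move=> j jn; rewrite (ag5.1 DEAD) // s4D mkseqS mem_rcons inE mk // upd_eq.
    by rewrite /upd; case: eqP => //= _; exact: dead3.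
  + move=> p; rewrite ltnS leq_eqVlt => /orP[/eqP->|pi]; last first.
      by rewrite mk ?(ltnW pi) // upd_neq; [exact: sel3 | lia].
    rewrite mk // upd_eq; split=> //; first by rewrite -dead3 // w_alive.
    move=> j jn jm; have := root j jn; rewrite /beats dead3 // (negbTE jm) /= key3.
    by case/andP.
- by move=> s3 _ [].
Qed.
End Select.

(** * The staircase search for a fixed direction *)

(** A counter instead of a flag: a point may be in several discard lists, and [unmark] must release
    it only when it leaves the last one. *)
Definition mark (lst pos : nat) : cmd :=
  vIDX ::= NLoad lst (nvar pos) ;;
  CIf (BNLe (NLoad CNT (nvar vIDX)) (NConst 0)) (vE ::= NAdd (nvar vE) (NConst 1)) CSkip ;;
  CNStore CNT (nvar vIDX) (NAdd (NLoad CNT (nvar vIDX)) (NConst 1)).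

Definition unmark (lst pos : nat) : cmd :=
  vIDX ::= NLoad lst (nvar pos) ;;
  CNStore CNT (nvar vIDX) (NSub (NLoad CNT (nvar vIDX)) (NConst 1)) ;;
  CIf (BNLe (NLoad CNT (nvar vIDX)) (NConst 0)) (vE ::= NSub (nvar vE) (NConst 1)) CSkip.

(** Back to the original axes: the point at p along u and q across it is (p ux - q uy, p uy + q ux)
    / |u|^2. *)
Definition store_out : cmd :=
  CRStore OUT (NConst 0) (RDiv (RSub (RMul (RLoad PX (NLoad LL (nvar iA))) (rvar rUX))
                               (RMul (RLoad PY (nvar vI)) (rvar rUY))) (rvar rDEN)) ;;
  CRStore OUT (NConst 1) (RDiv (RAdd (RMul (RLoad PX (NLoad LL (nvar iA))) (rvar rUY))
                               (RMul (RLoad PY (nvar vI)) (rvar rUX))) (rvar rDEN)) ;;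
  CRStore OUT (NConst 2) (RDiv (RMul (rvar rW) (rvar rUX)) (rvar rDEN)) ;;
  CRStore OUT (NConst 3) (RDiv (RMul (rvar rW) (rvar rUY)) (rvar rDEN)) ;;
  CRStore OUT (NConst 4) (RSub (RConst 0) (RDiv (RMul (rvar rH) (rvar rUY)) (rvar rDEN))) ;;
  CRStore OUT (NConst 5) (RDiv (RMul (rvar rH) (rvar rUX)) (rvar rDEN)) ;;
  BEST :=r: rvar rAR ;;
  HAVE ::= NConst 1.

Definition evaluate : cmd :=
  rW :=r: RSub (RLoad PX (NLoad RL (nvar iB))) (RLoad PX (NLoad LL (nvar iA))) ;;
  rH :=r: RSub (RLoad PY (NLoad TL (nvar iP))) (RLoad PY (nvar vI)) ;;
  rAR :=r: RDiv (RMul (rvar rW) (rvar rH)) (rvar rDEN) ;;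
  CIf (BNot (BAnd (BNLe (NConst 1) (nvar HAVE)) (BRLe (rvar BEST) (rvar rAR))))
    store_out CSkip.

(** If the position (b, p) is feasible, its area is least among those with the same b and a smaller
    p, so b may advance. If it is not, then neither is (b', p) for any b' >= b, so p may
    decrease. *)
Definition step : cmd :=
  CIf (BNLe (nvar vE) nT)
    (CIf (BNLe (nvar iB) nT)
      (evaluate ;; mark RL iB ;; iB ::= NAdd (nvar iB) (NConst 1)) CSkip)
    (CIf (BNLe (NConst 1) (nvar iP))
      (iP ::= NSub (nvar iP) (NConst 1) ;; unmark TL iP) CSkip).

Definition undo (lst pos : nat) : cmd :=
  CWhile (BNLe (NConst 1) (nvar pos))
    (pos ::= NSub (nvar pos) (NConst 1) ;; unmark lst pos).

(** From (0, t), b can advance t + 1 times and p can decrease t times, whence 2t + 1 steps. Undoing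
    the marks at the end is cheaper than clearing [CNT], which would cost n for each value of
    [iA]. *)
Definition sweep_left : cmd :=
  For iP nT (mark TL iP) ;;
  iB ::= NConst 0 ;;
  For vIT (NAdd (NAdd nT nT) (NConst 1)) step ;;
  undo RL iB ;;
  undo TL iP.

Definition staircase : cmd :=
  For iA (NAdd nT (NConst 1)) (sweep_left ;; mark LL iA).

Section Staircase.
Variable R : realType.
Implicit Types (s : state R) (f : nat -> nat).

Definition out_rect (o : nat -> R) : rectangle R :=
  let vec i := \row_(j < 2) o (i + j)%N in Rectangle (vec 0%N) (vec 2%N) (vec 4%N).

Definition row2 (a b : R) : 'rV[R]_2 := \row_(j < 2) (if j == 0 then a else b).

Lemma out_rectE (o : nat -> R) : out_rect o =
  Rectangle (row2 (o 0%N) (o 1%N)) (row2 (o 2%N) (o 3%N)) (row2 (o 4%N) (o 5%N)).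
Proof.
by congr Rectangle; apply/rowP => j; rewrite !mxE; case: j => -[|[|]].
Qed.

Variable n : nat.

Definition marked s f : Prop :=
  (forall k, (k < n)%N -> nmem s CNT k = f k) /\
  nmem s vE 0%N = count (fun k => 0 < f k)%N (iota 0 n).

Lemma marked_ext s f g : (forall k, (k < n)%N -> f k = g k) -> marked s f -> marked s g.
Proof.
move=> fg [h1 h2]; split=> [k kn|]; first by rewrite h1 // fg.
by rewrite h2; apply: eq_in_count => k; rewrite mem_iota /= add0n => kn; rewrite fg.
Qed.

Lemma count_incr f i : (i < n)%N ->
  count (fun k => 0 < f k + (k == i))%N (iota 0 n) =
  (count (fun k => 0 < f k)%N (iota 0 n) + (f i == 0))%N.
Proof.
move=> iN; have -> : iota 0 n = iota 0 i ++ i :: iota i.+1 (n - i.+1).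
  rewrite -[in LHS](subnKC (ltnW iN)) iotaD add0n; congr cat.
  by rewrite -[(n - i)%N]prednK; [rewrite /= subnS | lia].
rewrite !count_cat /= eqxx addn1 /= .
have h (r : seq nat) : i \notin r ->
    count (fun k => 0 < f k + (k == i))%N r = count (fun k => 0 < f k)%N r.
  move=> ir; apply: eq_in_count => k kr; case: eqP => [E|_]; last by rewrite addn0.
  by rewrite -E kr in ir.
rewrite !h ?mem_iota; try lia.
Qed.

Lemma runs_mark lst pos s f : let i := nmem s lst (nmem s pos 0%N) in
  (i < n)%N -> marked s f ->
  runs (mark lst pos) s (cost (mark lst pos)) (fun s' => marked s' (fun k => f k + (k == i))%N).
Proof.
move=> i iN [h1 h2]; apply: runs_sl => //=; rewrite -/i /marked /setn /update /= leqn0 h1 //.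
rewrite count_incr //; case: ifP => [/eqP fi|fi] /=; split=> [k kn|] /=;
  rewrite ?fi ?h2 ?addn0 ?addn1 ?h1 //; case: eqP => [->|_]; rewrite ?addn0 ?addn1 ?h1 ?fi //.
Qed.

Lemma runs_unmark lst pos s f : let i := nmem s lst (nmem s pos 0%N) in
  (i < n)%N -> marked s (fun k => f k + (k == i))%N ->
  runs (unmark lst pos) s (cost (unmark lst pos)) (fun s' => marked s' f).
Proof.
move=> i iN [h1 h2]; rewrite count_incr // in h2.
apply: runs_sl => //=; rewrite -/i /marked /setn /update /= eqxx /= h1 // eqxx addnK leqn0.
case: ifP => [/eqP fi|fi] /=; split=> [k kn|] /=.
- by case: eqP => [->|/eqP ki] //; rewrite ?h1 // (negbTE ki) addn0.
- by rewrite h2 fi addnK.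
- by case: eqP => [->|/eqP ki] //; rewrite ?h1 // (negbTE ki) addn0.
- by rewrite h2 fi addn0.
Qed.

Section Env.
Variables (Valid : rectangle R -> R -> Prop) (t i : nat) (Ll Rl Tl bel : nat -> nat).
Variables (px py : nat -> R) (ux uy den : R).

Definition env s : Prop :=
  [/\ nmem s 0%N 0%N = n, nmem s 0%N 1%N = t & nmem s vI 0%N = i] /\
  [/\ nmem s LL = Ll, nmem s RL = Rl & nmem s TL = Tl] /\
  [/\ rmem s PX = px, rmem s PY = py, rmem s rUX 0%N = ux, rmem s rUY 0%N = uy
    & rmem s rDEN 0%N = den].

Lemma env_agree nW rW s s' : agree nW rW s s' -> env s ->
  all (fun a => a \notin nW) [:: 0; 1; 18; 19; 20]%N ->
  all (fun a => a \notin rW) [:: 4; 5; 7; 8; 9]%N -> env s'.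
Proof.
move=> [an ar] en /and5P[n0 n1 n18 n19 /andP[n20 _]] /and5P[r4 r5 r7 r8 /andP[r9 _]].
move: en.
by rewrite /env !an // !ar.
Qed.

(** [Valid] stays abstract here, which separates the search from geometry; it is instantiated by
    [valid_rect]. *)
Definition out_inv s : Prop :=
  (0 < nmem s HAVE 0)%N -> Valid (out_rect (rmem s OUT)) (rmem s BEST 0%N).
Definition good s (v : R) : Prop := (0 < nmem s HAVE 0)%N /\ rmem s BEST 0%N <= v.
(** The stored rectangle may be overwritten later, but any bound it has reached is kept. *)
Definition improves s s' : Prop := forall v, good s v -> good s' v.

Lemma good_le s v v' : v <= v' -> good s v -> good s v'.
Proof. by move=> vv [h1 h2]; split=> //; apply: le_trans vv. Qed.

Definition width a b : R := px (Rl b) - px (Ll a).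
Definition height p : R := py (Tl p) - py i.
Definition rect_area a b p : R := width a b * height p / den.
Definition rect a b p : rectangle R := Rectangle
  (row2 ((px (Ll a) * ux - py i * uy) / den) ((px (Ll a) * uy + py i * ux) / den))
  (row2 (width a b * ux / den) (width a b * uy / den))
  (row2 (0 - height p * uy / den) (height p * ux / den)).

Hypothesis den0 : den != 0.

Lemma runs_store a k e c s T Q :
  (forall s', nmem s' = nmem s -> rmem s' = update (rmem s) a k (reval s e) -> runs c s' T Q) ->
  runs (CSeq (CRStore a (NConst k) e) c) s ((rcost e).+2 + T) Q.
Proof.
move=> h; apply: runs_seq; apply: runs_sl => // _; exact: h.
Qed.

Lemma runs_store_out s a b p : env s -> nmem s iA 0%N = a ->
  rmem s rW 0%N = width a b -> rmem s rH 0%N = height p -> rmem s rAR 0%N = rect_area a b p ->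
  runs store_out s (cost store_out)
    (fun s' => [/\ nmem s' HAVE 0%N = 1%N, rmem s' BEST 0%N = rect_area a b p
                 & out_rect (rmem s' OUT) = rect a b p]).
Proof.
move=> [[en et ei] [[eL eR eT] [eX eY eux euy eden]]] ha hw hh har.
apply: runs_store => s1 n1 r1; apply: runs_store => s2 n2 r2.
apply: runs_store => s3 n3 r3; apply: runs_store => s4 n4 r4.
apply: runs_store => s5 n5 r5; apply: runs_store => s6 n6 r6.
have q k : k != OUT -> [/\ rmem s1 k = rmem s k, rmem s2 k = rmem s k, rmem s3 k = rmem s k,
    rmem s4 k = rmem s k & rmem s5 k = rmem s k] /\ rmem s6 k = rmem s k.
  by move=> k2; rewrite r6 r5 r4 r3 r2 r1 !update_neq.
have [[eX1 eX2 eX3 eX4 eX5] eX6] := q PX isT.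
have [[eY1 eY2 eY3 eY4 eY5] eY6] := q PY isT.
have [[ex1 ex2 ex3 ex4 ex5] ex6] := q rUX isT.
have [[ey1 ey2 ey3 ey4 ey5] ey6] := q rUY isT.
have [[ed1 ed2 ed3 ed4 ed5] ed6] := q rDEN isT.
have [[ew1 ew2 ew3 ew4 ew5] ew6] := q rW isT.
have [[eh1 eh2 eh3 eh4 eh5] eh6] := q rH isT.
have [_ ea6] := q rAR isT.
have nL k : neval k (NLoad LL (nvar iA)) = nmem k LL (nmem k iA 0%N) by [].
have e1 : rmem s1 OUT 0%N = (px (Ll a) * ux - py i * uy) / den.
  by rewrite r1 /update /= ha ei eL eX eY eux euy eden (negbTE den0).
have e2 : rmem s2 OUT 1%N = (px (Ll a) * uy + py i * ux) / den.
  by rewrite r2 /update /= n1 ha ei eL eX1 eY1 ex1 ey1 ed1 eX eY eux euy eden (negbTE den0).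
have e3 : rmem s3 OUT 2%N = width a b * ux / den.
  by rewrite r3 /update /= ew2 ex2 ed2 hw eux eden (negbTE den0).
have e4 : rmem s4 OUT 3%N = width a b * uy / den.
  by rewrite r4 /update /= ew3 ey3 ed3 hw euy eden (negbTE den0).
have e5 : rmem s5 OUT 4%N = 0 - height p * uy / den.
  by rewrite r5 /update /= eh4 ey4 ed4 hh euy eden (negbTE den0).
have e6 : rmem s6 OUT 5%N = height p * ux / den.
  by rewrite r6 /update /= eh5 ex5 ed5 hh eux eden (negbTE den0).
have f5 j : j != 5%N -> rmem s6 OUT j = rmem s5 OUT j.
  by move=> j5; rewrite r6 /update (negbTE j5) andbF.
have f4 j : j != 4%N -> rmem s5 OUT j = rmem s4 OUT j.
  by move=> j5; rewrite r5 /update (negbTE j5) andbF.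
have f3 j : j != 3%N -> rmem s4 OUT j = rmem s3 OUT j.
  by move=> j5; rewrite r4 /update (negbTE j5) andbF.
have f2 j : j != 2%N -> rmem s3 OUT j = rmem s2 OUT j.
  by move=> j5; rewrite r3 /update (negbTE j5) andbF.
have f1 j : j != 1%N -> rmem s2 OUT j = rmem s1 OUT j.
  by move=> j5; rewrite r2 /update (negbTE j5) andbF.
have E : out_rect (rmem s6 OUT) = rect a b p.
  rewrite out_rectE /rect -e6 f5 // f5 // f5 // f5 // f5 // e5.
  rewrite f4 // f4 // f4 // f4 // e4 f3 // f3 // f3 // e3 f2 // f2 // e2 f1 //.
  by rewrite e1.
apply: (runs_le (T := cost (BEST :=r: rvar rAR ;; HAVE ::= NConst 1))).
  by apply: runs_sl => //=; rewrite /update /= ea6 har; split.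
by [].
Qed.

Lemma runs_evaluate s a b p : env s -> nmem s iA 0%N = a -> nmem s iB 0%N = b ->
  nmem s iP 0%N = p -> out_inv s -> Valid (rect a b p) (rect_area a b p) ->
  runs evaluate s (cost evaluate)
    (fun s' => [/\ out_inv s', improves s s' & good s' (rect_area a b p)]).
Proof.
move=> [[en et ei] [[eL eR eT] [eX eY eux euy eden]]] ha hb hp inv val.
apply: runs_store => s1 n1 r1; apply: runs_store => s2 n2 r2.
apply: runs_store => s3 n3 r3.
have q k : k \notin [:: rW; rH; rAR] -> [/\ rmem s1 k = rmem s k, rmem s2 k = rmem s k
    & rmem s3 k = rmem s k].
  by rewrite !inE !negb_or => /and3P[k1 k2 k3]; rewrite r3 r2 r1 !update_neq.
have [eX1 eX2 eX3] := q PX isT; have [eY1 eY2 eY3] := q PY isT.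
have [_ _ ex3] := q rUX isT; have [_ _ ey3] := q rUY isT.
have [_ ed2 ed3] := q rDEN isT.
have [_ _ eo3] := q OUT isT; have [_ _ eb3] := q BEST isT.
have n3s : nmem s3 = nmem s by rewrite n3 n2 n1.
have w1 : rmem s1 rW 0%N = width a b by rewrite r1 /update /= ha hb eL eR eX.
have w2 : rmem s2 rW 0%N = width a b by rewrite r2 update_neq.
have w3 : rmem s3 rW 0%N = width a b by rewrite r3 update_neq.
have h2 : rmem s2 rH 0%N = height p by rewrite r2 /update /= n1 hp ei eT eY1 eY.
have h3 : rmem s3 rH 0%N = height p by rewrite r3 update_neq.
have a3 : rmem s3 rAR 0%N = rect_area a b p.
  by rewrite r3 /update /= w2 h2 ed2 eden (negbTE den0).
have good3 v : good s v -> good s3 v by rewrite /good n3s eb3.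
have inv3 : out_inv s3 by rewrite /out_inv n3s eb3 eo3.
apply: runs_if; last first.
  move=> /negbNE /= /andP[have3 le3]; apply: (runs_le (T := 1%N)) => //.
  by apply: runs_sl => //=; split=> //; split=> //; rewrite -a3.
move=> better; apply: (runs_le (T := cost store_out)); last by [].
apply: runs_conseq (@runs_store_out s3 a b p _ _ w3 h3 a3) (leqnn _) _.
- by rewrite /env n3s eX3 eY3 ex3 ey3 ed3.
- by rewrite n3s.
move=> s4 [hv4 be4 ou4]; split; first by rewrite /out_inv be4 ou4.
  move=> v /good3[hv lv]; split; first by rewrite hv4.
  by move: better; rewrite /= hv /= be4 -ltNge a3 => /ltW bv; apply: le_trans lv.
by split; rewrite ?hv4 ?be4.
Qed.

Definition excl a b p k : nat :=
  (bel k + count_mem k (mkseq Ll a) + count_mem k (mkseq Rl b) + count_mem k (mkseq Tl p))%N.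
Definition num_excl a b p : nat := count (fun k => 0 < excl a b p k)%N (iota 0 n).

Lemma count_mem_mkseqS (f : nat -> nat) m k :
  count_mem k (mkseq f m.+1) = (count_mem k (mkseq f m) + (k == f m))%N.
Proof. by rewrite mkseqS -cats1 count_cat /= addn0 eq_sym. Qed.

Lemma count_mem_mkseq_le (f : nat -> nat) m m' k : (m <= m')%N ->
  (count_mem k (mkseq f m) <= count_mem k (mkseq f m'))%N.
Proof.
move=> /subnKC <-; elim: (m' - m)%N => [|d IH]; first by rewrite addn0.
by rewrite addnS count_mem_mkseqS; apply: leq_trans IH (leq_addr _ _).
Qed.

Lemma excl_b a b p k : excl a b.+1 p k = (excl a b p k + (k == Rl b))%N.
Proof. by rewrite /excl count_mem_mkseqS; lia. Qed.
Lemma excl_p a b p k : excl a b p.+1 k = (excl a b p k + (k == Tl p))%N.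
Proof. by rewrite /excl count_mem_mkseqS; lia. Qed.
Lemma excl_a a b p k : excl a.+1 b p k = (excl a b p k + (k == Ll a))%N.
Proof. by rewrite /excl count_mem_mkseqS; lia. Qed.

Lemma num_excl_le a b p b' p' : (b <= b')%N -> (p <= p')%N ->
  (num_excl a b p <= num_excl a b' p')%N.
Proof.
move=> bb pp; apply: sub_count => k /= h; apply: leq_trans h _.
by rewrite /excl !leq_add // count_mem_mkseq_le.
Qed.

Hypotheses (hL : forall q, (q <= t)%N -> (Ll q < n)%N)
           (hR : forall q, (q <= t)%N -> (Rl q < n)%N)
           (hT : forall q, (q <= t)%N -> (Tl q < n)%N).
Hypothesis hvalid : forall a b p, (a <= t)%N -> (b <= t)%N -> (p <= t)%N ->
  (num_excl a b p <= t)%N -> Valid (rect a b p) (rect_area a b p).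
Hypothesis harea : forall a b p p', (a <= t)%N -> (b <= t)%N -> (p <= t)%N ->
  (num_excl a b p <= t)%N -> (p' <= p)%N -> rect_area a b p <= rect_area a b p'.

(* Every feasible (b', p') is either already beaten, or dominates the current
   position, which then has moved at each of the it steps. *)
Definition step_inv a s0 it s : Prop :=
  [/\ out_inv s, improves s0 s & exists b p,
   [/\ nmem s iB 0%N = b, nmem s iP 0%N = p, (b <= t.+1)%N, (p <= t)%N & marked s (excl a b p)]
   /\ forall b' p', (b' <= t)%N -> (p' <= t)%N -> (num_excl a b' p' <= t)%N ->
     good s (rect_area a b' p') \/ [/\ (b <= b')%N, (p' <= p)%N & (b + t = p + it)%N]].

Lemma runs_step a s0 it s : (a <= t)%N -> env s -> nmem s iA 0%N = a -> step_inv a s0 it s ->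
  runs step s (cost step) (step_inv a s0 it.+1).
Proof.
move=> at_ en ha [inv imp [b [p [[hb hp bt pt mk] cand]]]].
have [[enn ent eni] [[eL eR eT] _]] := en.
have hE : nmem s vE 0%N = num_excl a b p by case: mk.
rewrite /step; apply: (runs_le (T := (5 + ((5 + (cost evaluate + (cost (mark RL iB) + 6))) +
   (4 + (6 + cost (unmark TL iP)))))%N)); last by [].
apply: (runs_if (s := s) (b := BNLe (nvar vE) nT)) => /=; rewrite hE ent; last first.
  rewrite -ltnNge => infeas; apply: runs_le; last exact: leq_addl.
  apply: (runs_if (s := s) (b := BNLe (NConst 1) (nvar iP))) => /=; rewrite hp.
    case: p pt hp mk cand hE infeas => // p pt hp mk cand hE infeas _.
    apply: runs_seq; apply: (runs_le (T := 6)) => //; apply: runs_sl => //= ag1.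
    set s1 := setn _ _ _ _ in ag1 *.
    have hp1 : nmem s1 iP 0%N = p by rewrite /s1 /= /update /= hp subn1.
    have h1 : nmem s1 TL (nmem s1 iP 0%N) = Tl p by rewrite hp1 (ag1.1 TL) // eT.
    have mk1 : marked s1 (fun k => excl a b p k + (k == nmem s1 TL (nmem s1 iP 0%N)))%N.
      rewrite h1; apply: (@marked_ext s1 (excl a b p.+1)) => [k _|]; first exact: excl_p.
      exact: mk.
    have iN : (nmem s1 TL (nmem s1 iP 0) < n)%N by rewrite h1 hT // ltnW.
    apply: runs_conseq (runs_agree (runs_unmark iN mk1)) (leqnn _) _ => s2 [ag2 mk2].
    have ag : agree [:: iP; vIDX; CNT; vE]  [::] s s2.
      by apply: agree_trans; [apply: agree_sub ag1 | apply: agree_sub ag2] => // k;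
        rewrite !inE => ->; rewrite ?orbT.
    split.
    - by rewrite /out_inv (ag.1 HAVE) // !ag.2.
    - by move=> v /imp; rewrite /good (ag.1 HAVE) // !ag.2.
    exists b, p; split.
      split=> //; [by rewrite (ag.1 iB) | by rewrite (ag2.1 iP) | exact: ltnW].
    move=> b' p' b't p't fe; case: (cand b' p' b't p't fe) => [gd|[bb pp E]].
      by left; rewrite /good (ag.1 HAVE) // !ag.2.
    right; split=> //; last by lia.
    (* [p' = p.+1] is excluded: with [b <= b'] it would discard at least as many points as the
       current infeasible position. *)
    rewrite -ltnS ltn_neqAle pp andbT; apply/eqP => E'.
    by have := num_excl_le a bb (leqnn p.+1); rewrite -E' in infeas *; lia.
  rewrite -ltnNge ltnS leqn0 => /eqP p0.
  apply: (runs_le (T := 1)); last by rewrite /=.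
  apply: runs_sl => //=; split=> //; exists b, p; split=> // b' p' b't p't fe.
  case: (cand b' p' b't p't fe) => [gd|[bb pp E]]; first by left.
  have : (num_excl a b p <= num_excl a b' p')%N by apply: num_excl_le; lia.
  lia.
move=> feas; apply: runs_le; last exact: leq_addr.
apply: (runs_if (s := s) (b := BNLe (nvar iB) nT)) => /=; rewrite hb ent; last first.
  rewrite -ltnNge => tb.
  apply: (runs_le (T := 1)); last by rewrite /=.
  apply: runs_sl => //=; split=> //; exists b, p; split=> // b' p' b't p't fe.
  by case: (cand b' p' b't p't fe) => [gd|[bb pp E]]; [left | lia].
move=> bt'; apply: runs_seq.
apply: runs_conseq (runs_evaluate en ha hb hp inv _) (leqnn _) _; first exact: hvalid.
move=> s1 [inv1 imp1 good1] ag1; apply: runs_seq.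
have h1 : nmem s1 RL (nmem s1 iB 0%N) = Rl b by rewrite (ag1.1 iB) // hb (ag1.1 RL) // eR.
have iN : (nmem s1 RL (nmem s1 iB 0) < n)%N by rewrite h1 hR.
have mk1 : marked s1 (excl a b p) by move: mk; rewrite /marked !ag1.1.
apply: runs_conseq (runs_mark iN mk1) (leqnn _) _ => s2 mk2 ag2.
apply: (runs_le (T := 6)) => //; apply: runs_sl => //=.
set s3 := setn _ _ _ _.
have ag3 : agree [:: iB; vIDX; CNT; vE] [::] s1 s3.
  split=> k; last by move=> _; rewrite /= ag2.2.
  rewrite !inE !negb_or => /and4P[k1 k2 k3 k4].
  by rewrite /s3 /= update_neq // ag2.1 // !inE !negb_or k2 k3 k4.
have inv3 : out_inv s3 by rewrite /out_inv (ag3.1 HAVE) // !ag3.2.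
have g3 v : good s1 v -> good s3 v by rewrite /good (ag3.1 HAVE) // !ag3.2.
split=> //; first by move=> v /imp /imp1 /g3.
exists b.+1, p; split.
  split=> //.
  - by rewrite /s3 /= /update /= (ag2.1 iB) // (ag1.1 iB) // hb addn1.
  - by rewrite (ag3.1 iP) // (ag1.1 iP).
  - apply: (@marked_ext s3 (fun k => excl a b p k + (k == Rl b))%N) => [k _|].
      by rewrite excl_b.
    by move: mk2; rewrite h1.
move=> b' p' b't p't fe; case: (cand b' p' b't p't fe) => [gd|[bb pp E]].
  by left; apply: g3; apply: imp1.
have [bb'|bb'] := eqVneq b b'; last by right; split=> //; lia.
left; apply: g3; apply: good_le good1; rewrite -bb'.
exact: harea.
Qed.

Lemma runs_undo lst pos m g s : pos \notin [:: vIDX; CNT; vE] ->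
  lst \notin [:: pos; vIDX; CNT; vE] -> nmem s pos 0%N = m ->
  (forall q, (q < m)%N -> (nmem s lst q < n)%N) ->
  marked s (fun k => g k + count_mem k (mkseq (nmem s lst) m))%N ->
  runs (undo lst pos) s (m * (4 + (6 + cost (unmark lst pos))) + 4) (fun s' => marked s' g).
Proof.
move=> pW lW hm hn mk.
pose I q (s' : state R) := [/\ nmem s' pos 0%N = q, (q <= m)%N &
  marked s' (fun k => g k + count_mem k (mkseq (nmem s lst) q))%N].
apply: runs_conseq; first apply: (@runs_while _ _ _ I m s (6 + cost (unmark lst pos))).
- move=> q s1 qm ag1 [h1 h2 h3]; rewrite [beval _ _]/= h1 => q0; split=> //.
  case: q q0 qm h1 h2 h3 => // q _ qm h1 h2 h3.
  have hl : nmem s1 lst = nmem s lst.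
    by rewrite ag1.1 //=; move: lW; rewrite !inE; lia.
  apply: runs_seq; apply: (runs_le (T := 6)) => //; apply: runs_sl => //= ag2.
  set s2 := setn _ _ _ _ in ag2 *.
  have hp2 : nmem s2 pos 0%N = q by rewrite /s2 /= /update !eqxx /= h1 subn1.
  have hl2 : nmem s2 lst = nmem s lst.
    rewrite /s2 /= update_neq ?hl //; apply: contra lW; rewrite !inE => ->.
    by rewrite ?orbT.
  have E : nmem s2 lst (nmem s2 pos 0) = nmem s lst q by rewrite hp2 hl2.
  apply: runs_conseq (runs_agree (@runs_unmark lst pos s2
    (fun k => g k + count_mem k (mkseq (nmem s lst) q))%N _ _)) (leqnn _) _.
  + by rewrite E hn.
  + rewrite E; apply: (@marked_ext _ (fun k => g k + count_mem k (mkseq (nmem s lst) q.+1))%N).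
      by move=> k _; rewrite count_mem_mkseqS addnA.
    by move: h3; rewrite /marked /s2 /= !update_neq //;
      apply: contra pW; rewrite !inE eq_sym => ->; rewrite ?orbT.
  move=> s3 [ag3 mk3]; split=> //=; last exact: ltnW.
  by rewrite ag3.1 //=; move: pW; rewrite !inE; lia.
- by split.
- by [].
move=> s1 [/= hb [q [h1 h2 h3]]].
have q0 : q = 0%N by lia.
by rewrite q0 in h3; apply: marked_ext h3 => k _; rewrite addn0.
Qed.

Lemma runs_sweep_left a s : (a <= t)%N -> env s -> nmem s iA 0%N = a -> out_inv s ->
  marked s (excl a 0 0) ->
  runs sweep_left s (1000 * t.+1) (fun s' =>
    [/\ out_inv s', improves s s', marked s' (excl a 0 0)
      & forall b p, (b <= t)%N -> (p <= t)%N -> (num_excl a b p <= t)%N ->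
          good s' (rect_area a b p)]).
Proof.
move=> at_ en ha inv mk.
apply: runs_le; first apply: runs_seq.
  pose I p (s' : state R) := nmem s' iP 0%N = p /\ marked s' (excl a 0 p).
  apply: (@runs_loop _ _ _ _ t I (cost (mark TL iP))) => //.
  - by move=> s' ag; rewrite /= (ag.1 0%N) //; case: en => -[].
  - move=> p s1 pt ag1 hp [_ mk1].
    have [_ [[_ _ eT] _]] := env_agree ag1 en isT isT.
    apply: runs_conseq (@runs_mark TL iP s1 (excl a 0 p) _ mk1) (leqnn _) _.
      by rewrite hp eT hT // ltnW.
    move=> s2 mk2 ag2; split=> //.
    by move: mk2; rewrite hp eT; apply: marked_ext => k _; rewrite excl_p.
  move=> s1 ag1 [hp mk1] _.
  apply: runs_seq; apply: runs_sl => //= ag2.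
  set s2 := setn _ _ _ _ in ag2 *.
  have en1 : env s1 by apply: env_agree ag1 en _ _.
  have en2 : env s2 by apply: env_agree ag2 en1 _ _.
  have good2 v : good s v -> good s2 v by rewrite /good (ag2.1 HAVE) // (ag1.1 HAVE) // !ag2.2 // !ag1.2.
  have inv2 : out_inv s2 by rewrite /out_inv (ag2.1 HAVE) // (ag1.1 HAVE) // !ag2.2 // !ag1.2.
  apply: runs_seq; apply: (@runs_loop _ _ _ _ (t + t + 1)
    (fun it s' => step_inv a s2 it s') (cost step)) => //.
  - by move=> s3 ag3; rewrite /= (ag3.1 0%N) //; case: en2 => -[_ -> _] _.
  - split=> //; exists 0%N, t; split=> //.
    by move=> b' p' b't p't fe; right; rewrite addn0.
  - move=> it s3 itt ag3 _ I3.
    apply: runs_conseq (@runs_step a s2 it s3 at_ _ _ I3) (leqnn _) _.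
    + by apply: env_agree ag3 en2 _ _.
    + by rewrite (ag3.1 iA) // (ag2.1 iA) // (ag1.1 iA).
    + by [].
  move=> s3 ag3 [inv3 imp3 [b [p [[hb hp3 bt pt mk3] cand]]]] _.
  have en3 : env s3 by apply: env_agree ag3 en2 _ _.
  have [_ [[eL eR eT] _]] := en3.
  apply: runs_seq; apply: runs_conseq (runs_agree (@runs_undo RL iB b (excl a 0 p) s3
     isT isT hb _ _)) _ _.
  + move=> q qb; rewrite eR; apply: hR; lia.
  + rewrite eR; apply: marked_ext mk3 => k _; rewrite /excl /=; lia.
  + by apply: leq_add (leqnn _); apply: leq_mul bt (leqnn _).
  move=> s4 [ag4 mk4] _.
  apply: runs_conseq (runs_agree (@runs_undo TL iP p (excl a 0 0) s4
     isT isT _ _ _)) _ _.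
  + by rewrite (ag4.1 iP).
  + by move=> q qb; rewrite (ag4.1 TL) // eT; apply: hT; lia.
  + rewrite (ag4.1 TL) // eT; apply: marked_ext mk4 => k _; rewrite /excl /=; lia.
  + by apply: leq_add (leqnn _); apply: leq_mul pt (leqnn _).
  move=> s5 [ag5 mk5].
  have good5 v : good s3 v -> good s5 v.
    by rewrite /good (ag5.1 HAVE) // (ag4.1 HAVE) // !ag5.2 // !ag4.2.
  split=> //.
  - by rewrite /out_inv (ag5.1 HAVE) // (ag4.1 HAVE) // !ag5.2 // !ag4.2.
  - by move=> v /good2 /imp3 /good5.
  move=> b' p' b't p't fe; apply: good5.
  by case: (cand b' p' b't p't fe) => // -[]; lia.
rewrite /=; lia.
Qed.

Lemma runs_staircase s : env s -> out_inv s -> marked s bel ->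
  runs staircase s (2000 * t.+1 * t.+1) (fun s' =>
    [/\ out_inv s', improves s s'
      & forall a b p, (a <= t)%N -> (b <= t)%N -> (p <= t)%N -> (num_excl a b p <= t)%N ->
          good s' (rect_area a b p)]).
Proof.
move=> en inv mk.
pose I a (s' : state R) := [/\ out_inv s', improves s s', marked s' (excl a 0 0)
      & forall a' b p, (a' < a)%N -> (b <= t)%N -> (p <= t)%N -> (num_excl a' b p <= t)%N ->
          good s' (rect_area a' b p)].
apply: (@runs_loop _ _ _ _ t.+1 I (1000 * t.+1 + cost (mark LL iA))) => //.
- by move=> s' ag; rewrite /= (ag.1 0%N) //; case: en => -[_ -> _] _; rewrite addn1.
- by split=> //; apply: marked_ext mk => k _; rewrite /excl /= !addn0.
- move=> a s1 at_ ag1 ha [inv1 imp1 mk1 cand1].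
  have en1 : env s1 by apply: env_agree ag1 en _ _.
  apply: runs_seq; apply: runs_conseq (@runs_sweep_left a s1 _ _ _ _ _) (leqnn _) _ => //.
  move=> s2 [inv2 imp2 mk2 cand2] ag2.
  have en2 : env s2 by apply: env_agree ag2 en1 _ _.
  have [_ [[eL _ _] _]] := en2.
  have ha2 : nmem s2 iA 0%N = a by rewrite (ag2.1 iA).
  apply: runs_conseq (runs_agree (@runs_mark LL iA s2 (excl a 0 0) _ mk2)) (leqnn _) _.
    by rewrite ha2 eL hL.
  move=> s3 [ag3 mk3] _.
  have good3 v : good s2 v -> good s3 v by rewrite /good (ag3.1 HAVE) // !ag3.2.
  have inv3 : out_inv s3 by rewrite /out_inv (ag3.1 HAVE) // !ag3.2.
  split=> //.
  + by move=> v /imp1 /imp2 /good3.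
  + by move: mk3; rewrite ha2 eL; apply: marked_ext => k _; rewrite excl_a.
  move=> a' b p; rewrite ltnS leq_eqVlt => /orP[/eqP->|aa] bt pt fe; apply: good3.
    exact: cand2.
  by apply: imp2; apply: cand1.
- rewrite /=; lia.
- by move=> s' _ [].
Qed.

End Env.
End Staircase.

(** * Rectangles flush with the line through two points *)

Lemma count_sub_in (T : eqType) (p q : pred T) (s : seq T) :
  (forall k, k \in s -> p k -> q k) -> (count p s <= count q s)%N.
Proof.
move=> h; rewrite (@eq_in_count _ _ (predI p q)) => [|k ks /=].
  by apply: sub_count => k /andP[].
by case pk: (p k) => //=; rewrite h.
Qed.

Section ListGeometry.
Variable R : realType.
Variables (n t : nat) (x y : nat -> R).

Definition valid_rect (r : rectangle R) (v : R) : Prop :=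
  [/\ is_rectangle r, area r = v
    & (n - t <= count (fun k => `[< region r (row2 (x k) (y k)) >]) (iota 0 n))%N].

Definition along i j k : R := (x j - x i) * x k + (y j - y i) * y k.
Definition across i j k : R := (x j - x i) * y k - (y j - y i) * x k.
Definition sqdist i j : R := (x j - x i) ^+ 2 + (y j - y i) ^+ 2.

(** The areas that processing (i, j) has to match. [lo], [hi] and [top] are arbitrary bounds, so
    that no extreme points of [S] have to be named. *)
Definition target i j (v : R) : Prop :=
  exists (S : pred nat) (lo hi top : R),
  [/\ (n - t <= count S (iota 0 n))%N,
      forall k, (k < n)%N -> S k -> across i j i <= across i j k <= top /\ lo <= along i j k <= hi
    & v = (hi - lo) * (top - across i j i) / sqdist i j].

Lemma dot_row2 (a b c d : R) : dot (row2 a b) (row2 c d) = a * c + b * d.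
Proof. by rewrite /dot !big_ord_recl big_ord0 !mxE /= addr0. Qed.

(** Stated without a quotient in order to include a null side, [a = b]. *)
Lemma between_ratio (a b c : R) : a <= c <= b -> exists2 r, 0 <= r <= 1 & r * (b - a) = c - a.
Proof.
case/andP=> ac cb; have [ab|ab] := eqVneq a b.
  by exists 0; [rewrite lexx ler01 | lra].
have ba : 0 < b - a by rewrite subr_gt0 lt_neqAle ab (le_trans ac).
exists ((c - a) / (b - a)); last by field; lra.
apply/andP; split; first by apply: divr_ge0; lra.
by rewrite ler_pdivrMr //; lra.
Qed.

Variables (i j : nat) (Ll Rl Tl bel : nat -> nat) (px py : nat -> R).
Let ux := x j - x i.
Let uy := y j - y i.
Let den := sqdist i j.
Hypotheses (tn : (t < n)%N) (iN : (i < n)%N) (den0 : den != 0).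
Hypotheses (hpx : forall k, (k < n)%N -> px k = along i j k)
           (hpy : forall k, (k < n)%N -> py k = across i j k).
Hypotheses (hL : selected n px t.+1 Ll) (hR : selected n (fun k => - px k) t.+1 Rl)
           (hT : selected n (fun k => - py k) t.+1 Tl).
Hypothesis (hbel : forall k, (k < n)%N -> bel k = (py k < py i)).

Local Notation num_excl := (num_excl n Ll Rl Tl bel).
Local Notation excl := (excl Ll Rl Tl bel).
Local Notation rect := (rect i Ll Rl Tl px py ux uy den).
Local Notation rect_area := (rect_area i Ll Rl Tl px py den).

Lemma den_gt0 : 0 < den.
Proof. by rewrite lt0r den0 /den /sqdist addr_ge0 // sqr_ge0. Qed.

Lemma not_excl a b p k : (a <= t)%N -> (b <= t)%N -> (p <= t)%N -> (k < n)%N ->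
  excl a b p k = 0%N ->
  px (Ll a) <= px k <= px (Rl b) /\ py i <= py k <= py (Tl p).
Proof.
move=> at_ bt pt kn /eqP; rewrite /excl !addn_eq0 => /andP[/andP[/andP[e1 e2] e3] e4].
have notin (f : nat -> nat) m : count_mem k (mkseq f m) == 0%N -> k \notin mkseq f m.
  by move/eqP/count_memPn.
split; apply/andP; split.
- by have [_ _ h] := hL at_; apply: h (notin _ _ e2).
- by rewrite -lerN2; have [_ _ h] := hR bt; apply: h (notin _ _ e3).
- by move: e1; rewrite hbel // eqb0 -leNgt.
- by rewrite -lerN2; have [_ _ h] := hT pt; apply: h (notin _ _ e4).
Qed.

Lemma exists_not_excl a b p : (num_excl a b p <= t)%N ->
  exists2 k, (k < n)%N & excl a b p k = 0%N.
Proof.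
move=> le_t; have : ~~ all (fun k => 0 < excl a b p k)%N (iota 0 n).
  by rewrite all_count size_iota -/(num_excl a b p); lia.
case/allPn => k; rewrite mem_iota /= add0n => kn; rewrite -leqNgt leqn0 => /eqP e.
by exists k.
Qed.

(** As [t < n], a feasible choice leaves some point, and it lies between the opposite sides. Only
    thus is W H / |u|^2 an area and not a possibly negative number. *)
Lemma width_height_ge0 a b p : (a <= t)%N -> (b <= t)%N -> (p <= t)%N ->
  (num_excl a b p <= t)%N -> 0 <= width Ll Rl px a b /\ 0 <= height i Tl py p.
Proof.
move=> at_ bt pt /exists_not_excl[k kn /(not_excl at_ bt pt kn)[/andP[h1 h2] /andP[h3 h4]]].
by rewrite /width /height !subr_ge0 (le_trans h1 h2) (le_trans h3 h4).
Qed.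

Lemma rect_valid a b p : (a <= t)%N -> (b <= t)%N -> (p <= t)%N ->
  (num_excl a b p <= t)%N -> valid_rect (rect a b p) (rect_area a b p).
Proof.
move=> at_ bt pt ex; have den_pos := den_gt0.
have [w0 h0] := width_height_ge0 at_ bt pt ex.
have denE : den = ux ^+ 2 + uy ^+ 2 by [].
split.
- by rewrite /is_rectangle /= dot_row2; field.
(* The side lengths are W / |u| and H / |u|, so under one root the product is the square of W H /
   |u|^2. *)
- rewrite /area /enorm /= !dot_row2 -sqrtrM; last by rewrite addr_ge0 // -expr2 sqr_ge0.
  rewrite [X in Num.sqrt X](_ : _ = (rect_area a b p) ^+ 2); last first.
    by rewrite /rect_area denE; field; rewrite -denE.
  by rewrite sqrtr_sqr ger0_norm // /rect_area divr_ge0 ?mulr_ge0 // ltW.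
have -> : (n - t <= count (fun k => `[< region (rect a b p) (row2 (x k) (y k)) >]) (iota 0 n))%N.
  apply: (@leq_trans (count (fun k => excl a b p k == 0%N) (iota 0 n))).
    have := count_predC (fun k => 0 < excl a b p k)%N (iota 0 n).
    rewrite size_iota -/(num_excl a b p) => E.
    rewrite (@eq_count _ _ (predC (fun k => 0 < excl a b p k)%N)); first by lia.
    by move=> k; rewrite /= -leqNgt leqn0.
  apply: count_sub_in => k; rewrite mem_iota /= add0n => kn /eqP /(not_excl at_ bt pt kn) [hx hy].
  apply/asboolP; have [al al01 alE] := between_ratio hx; have [be be01 beE] := between_ratio hy.
  exists al, be; split=> //=; rewrite -/(width Ll Rl px a b) in alE; rewrite -/(height i Tl py p) in beE.
  have := hpx kn; have := hpy kn; rewrite /along /across -/ux -/uy => hy' hx'.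
  have xE : x k = (px k * ux - py k * uy) / den by rewrite hx' hy' denE; field; rewrite -denE.
  have yE : y k = (px k * uy + py k * ux) / den by rewrite hx' hy' denE; field; rewrite -denE.
  have pxE : px k = px (Ll a) + al * width Ll Rl px a b by rewrite alE; ring.
  have pyE : py k = py i + be * height i Tl py p by rewrite beE; ring.
  apply/rowP => c; rewrite !mxE; case: ifP => _.
    by rewrite xE pxE pyE; field.
  by rewrite yE pxE pyE; field.
by [].
Qed.

Lemma rect_area_le a b p p' : (a <= t)%N -> (b <= t)%N -> (p <= t)%N ->
  (num_excl a b p <= t)%N -> (p' <= p)%N -> rect_area a b p <= rect_area a b p'.
Proof.
move=> at_ bt pt ex pp; have [w0 _] := width_height_ge0 at_ bt pt ex.
rewrite /rect_area ler_pM2r ?invr_gt0 ?den_gt0 // ler_wpM2l // /height lerD2r.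
have [_ _ h] : [/\ (Tl p' < n)%N, Tl p' \notin mkseq Tl p'
   & forall j, (j < n)%N -> j \notin mkseq Tl p' -> - py (Tl p') <= - py j].
  by apply: hT; lia.
have [tp np _] := hT pt.
rewrite -lerN2; apply: h => //; apply: contra np => /mapP[q]; rewrite mem_iota /= add0n => qp ->.
by apply/mapP; exists q; rewrite // mem_iota /= add0n; lia.
Qed.

(** Points with key below [c] are outside [S], and fewer than [m] points are. So the first listed
    point with key at least [c] has an index [q < m], and only points outside [S] precede it. *)
Lemma selected_find (key : nat -> R) m f (S : pred nat) c : selected n key m f ->
  (n - count S (iota 0 n) < m)%N -> (forall k, (k < n)%N -> S k -> c <= key k) ->
  exists2 q, (q < m)%N & c <= key (f q) /\ forall k, k \in mkseq f q -> ~~ S k.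
Proof.
move=> sel lt hS; pose q := find (fun k => c <= key k) (mkseq f m).
have uniq_f : forall p, (p <= m)%N -> uniq (mkseq f p).
  elim=> // p IH pm; rewrite mkseqS rcons_uniq IH ?(ltnW pm) // andbT.
  by have [] := sel p pm.
have below r : (r <= m)%N -> (forall k, k \in mkseq f r -> key k < c) ->
    (forall k, k \in mkseq f r -> ~~ S k).
  move=> rm h k km; apply/negP => Sk; have kn : (k < n)%N.
    by case/mapP: km => z; rewrite mem_iota /= add0n => zr ->; have [] := sel z (leq_trans zr rm).
  by have := h k km; rewrite ltNge (hS k kn Sk).
have hq : (q < m)%N.
  rewrite /q -[X in (_ < X)%N](size_mkseq f m) -has_find; apply/negPn/negP => /hasPn h.
  have nS : forall k, k \in mkseq f m -> ~~ S k.
    by apply: below => // k /h; rewrite ltNge.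
  have : (m <= count (predC S) (iota 0 n))%N.
    rewrite -size_filter -(size_mkseq f m); apply: uniq_leq_size; first exact: uniq_f.
    move=> k km; rewrite mem_filter /= nS // mem_iota /= add0n.
    by case/mapP: km => z; rewrite mem_iota /= add0n => zr ->; have [] := sel z zr.
  by have := count_predC S (iota 0 n); rewrite size_iota; lia.
exists q => //; split.
  have := nth_find 0%N (_ : has (fun k => c <= key k) (mkseq f m)).
  by rewrite has_find size_mkseq -/q nth_mkseq //; apply.
apply: below; first exact: ltnW.
move=> k /mapP[z]; rewrite mem_iota /= add0n => zq ->.
have := @before_find _ 0%N (fun k => c <= key k) (mkseq f m) z zq.
by rewrite nth_mkseq ?(ltn_trans zq) // => /negbT; rewrite -ltNge.
Qed.

(** [a], [b] and [p] count the listed points that come before the first one within [lo], [hi] and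
    [top]. All discarded points, those below the line included, are outside [S], so there are at
    most [t]; and the box found lies within the given bounds. *)
Lemma target_rect v : target i j v -> exists a b p,
  [/\ (a <= t)%N, (b <= t)%N, (p <= t)%N, (num_excl a b p <= t)%N & rect_area a b p <= v].
Proof.
move=> [S [lo [hi [top [cS hS ->]]]]].
have lt : (n - count S (iota 0 n) < t.+1)%N by lia.
have [|a at_ [la Sa]] := @selected_find px t.+1 Ll S lo hL lt.
  by move=> k kn /(hS k kn)[_ /andP[]]; rewrite hpx.
have [|b bt [lb Sb]] := @selected_find _ t.+1 Rl S (- hi) hR lt.
  by move=> k kn /(hS k kn)[_ /andP[_]]; rewrite lerN2 hpx.
have [|p pt [lp Sp]] := @selected_find _ t.+1 Tl S (- top) hT lt.
  by move=> k kn /(hS k kn)[/andP[_ ?] _]; rewrite lerN2 hpy.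
have ex : (num_excl a b p <= t)%N.
  apply: (@leq_trans (count (predC S) (iota 0 n))); last first.
    by have := count_predC S (iota 0 n); rewrite size_iota; lia.
  apply: count_sub_in => k; rewrite mem_iota /= add0n => kn; rewrite /excl => h.
  apply/negP => Sk; move: h; rewrite ltnNge leqn0 !addn_eq0.
  have [/andP[hp _] _] := hS k kn Sk.
  rewrite hbel // eqb0 -leNgt !hpy // hp /=.
  have z (f : nat -> nat) m : (forall k, k \in mkseq f m -> ~~ S k) -> count_mem k (mkseq f m) = 0%N.
    by move=> hm; apply/count_memPn/negP => /hm; rewrite Sk.
  by rewrite !z.
exists a, b, p; split=> //.
have [w0 h0] := width_height_ge0 at_ bt pt ex.
rewrite /rect_area ler_pM2r ?invr_gt0 ?den_gt0 //; apply: ler_pM => //.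
  by rewrite /width; rewrite lerN2 in lb; apply: lerB.
by rewrite /height (hpy iN) lerD2r; rewrite lerN2 in lp.
Qed.
End ListGeometry.

(** * Processing one pair of points *)

Definition set_direction : cmd :=
  rUX :=r: RSub (RLoad 0 (nvar vJ)) (RLoad 0 (nvar vI)) ;;
  rUY :=r: RSub (RLoad 1 (nvar vJ)) (RLoad 1 (nvar vI)) ;;
  rDEN :=r: RAdd (RMul (rvar rUX) (rvar rUX)) (RMul (rvar rUY) (rvar rUY)).

Definition project_points : cmd :=
  For vQ nN
    (CRStore PX (nvar vQ) (RAdd (RMul (rvar rUX) (RLoad 0 (nvar vQ)))
                                (RMul (rvar rUY) (RLoad 1 (nvar vQ)))) ;;
     CRStore PY (nvar vQ) (RSub (RMul (rvar rUX) (RLoad 1 (nvar vQ)))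
                                (RMul (rvar rUY) (RLoad 0 (nvar vQ))))).

Definition mark_below : cmd :=
  vE ::= NConst 0 ;;
  For vQ nN
    (CIf (BRLe (RLoad PY (nvar vI)) (RLoad PY (nvar vQ)))
      (CNStore CNT (nvar vQ) (NConst 0))
      (CNStore CNT (nvar vQ) (NConst 1) ;; vE ::= NAdd (nvar vE) (NConst 1))).

Definition load_keys (e : rexp) : cmd := For vQ nN (CRStore KEY (nvar vQ) e).

Definition process : cmd :=
  set_direction ;; project_points ;; mark_below ;;
  load_keys (RLoad PX (nvar vQ)) ;; select LL (NAdd nT (NConst 1)) ;;
  load_keys (RSub (RConst 0) (RLoad PX (nvar vQ))) ;; select RL (NAdd nT (NConst 1)) ;;
  load_keys (RSub (RConst 0) (RLoad PY (nvar vQ))) ;; select TL (NAdd nT (NConst 1)) ;;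
  staircase.

Definition countn (p : pred nat) m : nat := count p (iota 0 m).
Arguments countn : simpl never.

Lemma countnS p m : countn p m.+1 = (countn p m + p m)%N.
Proof. by rewrite /countn -addn1 iotaD count_cat /= add0n addn0. Qed.

Section Process.
Variable R : realType.
Implicit Types (s : state R).

Lemma runs_set_direction s i j : nmem s vI 0%N = i -> nmem s vJ 0%N = j ->
  runs set_direction s (cost set_direction) (fun s' =>
    [/\ rmem s' rUX 0%N = rmem s 0%N j - rmem s 0%N i,
        rmem s' rUY 0%N = rmem s 1%N j - rmem s 1%N i
      & rmem s' rDEN 0%N = sqdist (rmem s 0%N) (rmem s 1%N) i j]).
Proof.
move=> hi hj; apply: runs_store => s1 n1 r1; apply: runs_store => s2 n2 r2.
have x1 : rmem s1 rUX 0%N = rmem s 0%N j - rmem s 0%N i.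
  by rewrite r1 /update /= hi hj.
have x2 : rmem s2 rUX 0%N = rmem s 0%N j - rmem s 0%N i by rewrite r2 update_neq.
have y2 : rmem s2 rUY 0%N = rmem s 1%N j - rmem s 1%N i.
  by rewrite r2 /update /= n1 hi hj r1.
apply: runs_le; first apply: runs_sl => //=.
  by rewrite /update /= x2 y2 /sqdist -!expr2.
by [].
Qed.

Lemma runs_project_points s n i j : nmem s 0%N 0%N = n ->
  rmem s rUX 0%N = rmem s 0%N j - rmem s 0%N i ->
  rmem s rUY 0%N = rmem s 1%N j - rmem s 1%N i ->
  runs project_points s (100 * n + 100) (fun s' => forall k, (k < n)%N ->
    rmem s' PX k = along (rmem s 0%N) (rmem s 1%N) i j k /\
    rmem s' PY k = across (rmem s 0%N) (rmem s 1%N) i j k).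
Proof.
move=> hn hx hy.
pose I m (s' : state R) := forall k, (k < m)%N ->
    rmem s' PX k = along (rmem s 0%N) (rmem s 1%N) i j k /\
    rmem s' PY k = across (rmem s 0%N) (rmem s 1%N) i j k.
apply: (@runs_loop _ _ _ _ n I 40) => //.
- by move=> s' ag; rewrite /= (ag.1 0%N).
- move=> m s1 mn ag hm I1; apply: (@runs_le _ _ _ (20 + 20)%N) => //.
  apply: runs_seq; apply: runs_sl_le => // ag2; set s2 := sl _ _ in ag2 *.
  have e2 : rmem s2 PX = upd (rmem s1 PX) m (along (rmem s 0%N) (rmem s 1%N) i j m).
    by rewrite /s2 /= /update /= hm (ag.2 7%N) // (ag.2 8%N) // (ag.2 0%N) // (ag.2 1%N) // hx hy.
  clearbody s2; have hm2 : nmem s2 vQ 0%N = m by rewrite (ag2.1 vQ).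
  apply: runs_sl_le => //= ag3 k; rewrite /setn /update /= hm2 e2 (ag2.2 PY) //.
  rewrite (ag2.2 7%N) // (ag2.2 8%N) // (ag2.2 0%N) // (ag2.2 1%N) //.
  rewrite ltnS leq_eqVlt => /orP[/eqP->|km].
    rewrite upd_eq eqxx; split=> //.
    by rewrite (ag.2 7%N) // (ag.2 8%N) // (ag.2 0%N) // (ag.2 1%N) // hx hy.
  rewrite upd_neq ?(ltn_eqF km) //.
  exact: I1.
- by rewrite /=; lia.
Qed.

Lemma runs_mark_below s n i : nmem s 0%N 0%N = n -> nmem s vI 0%N = i ->
  runs mark_below s (100 * n + 100) (fun s' =>
    marked n s' (fun k => rmem s PY k < rmem s PY i)).
Proof.
move=> hn hi; apply: (@runs_le _ _ _ (4 + (100 * n + 90))); last by lia.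
apply: runs_seq; apply: runs_sl_le => //= ag1; set s1 := setn _ _ _ _ in ag1 *.
pose I m (s' : state R) :=
  (forall k, (k < m)%N -> nmem s' CNT k = (rmem s PY k < rmem s PY i)) /\
  nmem s' vE 0%N = countn (fun k => rmem s PY k < rmem s PY i) m.
apply: (@runs_loop _ _ _ _ n I 30) => //.
- by move=> s' ag; rewrite /= (ag.1 0%N) // (ag1.1 0%N).
- move=> m s2 mn ag hm [I1 I2]; have ei : nmem s2 vI 0%N = i by rewrite (ag.1 vI).
  have eP : rmem s2 PY = rmem s PY by rewrite (ag.2 PY).
  apply: (@runs_le _ _ _ (7 + 20)%N) => //; apply: runs_if => /=; rewrite ei hm eP => cmp.
    apply: runs_sl_le => //= _; rewrite /I /setn /update /= hm.
    split=> [k|]; last by rewrite countnS I2 ltNge cmp addn0.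
    rewrite ltnS leq_eqVlt => /orP[/eqP->|km]; first by rewrite eqxx ltNge cmp.
    by rewrite (ltn_eqF km) I1.
  apply: runs_sl_le => //= _; rewrite /I /setn /update /= hm.
  rewrite -ltNge in cmp.
  split=> [k|]; last by rewrite countnS I2 cmp.
  rewrite ltnS leq_eqVlt => /orP[/eqP->|km]; first by rewrite eqxx cmp.
  by rewrite (ltn_eqF km) I1.
- by rewrite /=; lia.
- move=> s' _ [h1 h2]; split=> //; rewrite h2; apply: eq_count => k; by rewrite lt0b.
Qed.

Lemma runs_load_keys e s n (f : nat -> R) : nmem s 0%N 0%N = n ->
  (forall k s', (k < n)%N -> agree [:: vQ] [:: KEY] s s' -> nmem s' vQ 0%N = k -> reval s' e = f k) ->
  runs (load_keys e) s (n * (rcost e + 20) + 20)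
    (fun s' => forall k, (k < n)%N -> rmem s' KEY k = f k).
Proof.
move=> hn he.
pose I m (s' : state R) := forall k, (k < m)%N -> rmem s' KEY k = f k.
apply: (@runs_loop _ _ _ _ n I (rcost e + 3)) => //.
- by move=> s' ag; rewrite /= (ag.1 0%N).
- move=> m s1 mn ag hm I1; apply: runs_le; first apply: runs_sl => //= _ k.
    have ag' : agree [:: vQ] [:: KEY] s s1.
      by apply: agree_sub ag => z; rewrite /= ?inE ?orbb.
    rewrite /setn /update /= hm (he m s1 mn ag' hm).
    by rewrite ltnS leq_eqVlt => /orP[/eqP->|km]; [rewrite eqxx | rewrite (ltn_eqF km) I1].
  by rewrite /=; lia.
- by rewrite /=; lia.
Qed.

Lemma selected_ext n (key key' : nat -> R) m f : (forall k, (k < n)%N -> key k = key' k) ->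
  selected n key m f -> selected n key' m f.
Proof.
move=> E sel p pm; have [h1 h2 h3] := sel p pm; split=> // k kn km.
by rewrite -!E //; apply: h3.
Qed.

Lemma neval_Tplus1 s t : nmem s 0%N 1%N = t ->
  forall s' : state R, nmem s' 0%N = nmem s 0%N -> neval s' (NAdd nT (NConst 1)) = t.+1.
Proof. by move=> ht s' /= ->; rewrite ht addn1. Qed.

Lemma runs_process : exists K : nat, forall s n t i j, let x := rmem s 0%N in let y := rmem s 1%N in
  nmem s 0%N 0%N = n -> nmem s 0%N 1%N = t -> (t < n)%N ->
  nmem s vI 0%N = i -> nmem s vJ 0%N = j -> (i < n)%N -> sqdist x y i j != 0 ->
  out_inv (valid_rect n t x y) s ->
  runs process s (K * (n + t.+1 * (trunc_log 2 n).+1 + t.+1 * t.+1)) (fun s' =>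
    [/\ out_inv (valid_rect n t x y) s', improves s s'
      & forall v, target n t x y i j v -> good s' v]).
Proof.
have [KL selL] := @runs_select R LL (NAdd nT (NConst 1)) isT.
have [KR selR] := @runs_select R RL (NAdd nT (NConst 1)) isT.
have [KT selT] := @runs_select R TL (NAdd nT (NConst 1)) isT.
exists (KL + KR + KT + 5000)%N => s n t i j x y hn ht tn hi hj iN d0 inv.
pose C := (n + t.+1 * (trunc_log 2 n).+1)%N.
apply: (@runs_le _ _ _ (cost set_direction + ((100 * n + 100) + ((100 * n + 100) +
  ((n * (3 + 20) + 20) + (KL * C + ((n * (5 + 20) + 20) + (KR * C + ((n * (5 + 20) + 20) +
   (KT * C + 2000 * t.+1 * t.+1))))))))))%N; last first.
  have := leq_ltn_trans (leq0n t) tn; rewrite -/C.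
  have nC : (n <= C)%N by rewrite leq_addr.
  rewrite !mulnDl !mulnDr /= => n0.
  set a := (KL * C)%N; set b := (KR * C)%N; set c := (KT * C)%N; lia.
apply: runs_seq; apply: runs_conseq (runs_set_direction hi hj) (leqnn _) _.
move=> s1 [ux1 uy1 den1] ag1.
have x1 : rmem s1 0%N = x by rewrite ag1.2.
have y1 : rmem s1 1%N = y by rewrite ag1.2.
apply: runs_seq; apply: runs_conseq (@runs_project_points s1 n i j _ _ _) (leqnn _) _.
- by rewrite (ag1.1 0%N).
- by rewrite x1.
- by rewrite y1.
rewrite x1 y1 => s2 pxy ag2.
apply: runs_seq; apply: runs_conseq (@runs_mark_below s2 n i _ _) (leqnn _) _.
- by rewrite (ag2.1 0%N) // (ag1.1 0%N).
- by rewrite (ag2.1 vI) // (ag1.1 vI).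
move=> s3 mk3 ag3.
pose px := rmem s2 PX; pose py := rmem s2 PY.
have hpx k : (k < n)%N -> px k = along x y i j k by case/pxy.
have hpy k : (k < n)%N -> py k = across x y i j k by case/pxy.
have hn3 : nmem s3 0%N = nmem s 0%N by rewrite ag3.1 // ag2.1 // ag1.1.
apply: runs_seq; apply: runs_conseq (@runs_load_keys _ s3 n px _ _) (leqnn _) _.
- by rewrite hn3.
- by move=> k s' kn ag /= ->; rewrite ag.2 // ag3.2.
move=> s4 k4 ag4; have hn4 : nmem s4 0%N = nmem s 0%N by rewrite ag4.1.
apply: runs_seq; apply: runs_conseq (selL s4 n t.+1 _ _ tn _) (leqnn _) _.
- by rewrite hn4.
- by apply: leq_ltn_trans tn.
- by apply: neval_Tplus1 => //; rewrite hn4.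
move=> s5 l5 ag5; have hn5 : nmem s5 0%N = nmem s 0%N by rewrite ag5.1.
apply: runs_seq; apply: runs_conseq (@runs_load_keys _ s5 n (fun k => - px k) _ _) (leqnn _) _.
- by rewrite hn5.
- by move=> k s' kn ag /= ->; rewrite ag.2 // ag5.2 // ag4.2 // ag3.2 // sub0r.
move=> s6 k6 ag6; have hn6 : nmem s6 0%N = nmem s 0%N by rewrite ag6.1.
apply: runs_seq; apply: runs_conseq (selR s6 n t.+1 _ _ tn _) (leqnn _) _.
- by rewrite hn6.
- by apply: leq_ltn_trans tn.
- by apply: neval_Tplus1 => //; rewrite hn6.
move=> s7 l7 ag7; have hn7 : nmem s7 0%N = nmem s 0%N by rewrite ag7.1.
apply: runs_seq; apply: runs_conseq (@runs_load_keys _ s7 n (fun k => - py k) _ _) (leqnn _) _.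
- by rewrite hn7.
- move=> k s' kn ag /= ->.
  by rewrite ag.2 // ag7.2 // ag6.2 // ag5.2 // ag4.2 // ag3.2 // sub0r.
move=> s8 k8 ag8; have hn8 : nmem s8 0%N = nmem s 0%N by rewrite ag8.1.
apply: runs_seq; apply: runs_conseq (selT s8 n t.+1 _ _ tn _) (leqnn _) _.
- by rewrite hn8.
- by apply: leq_ltn_trans tn.
- by apply: neval_Tplus1 => //; rewrite hn8.
move=> s9 l9 ag9; have hn9 : nmem s9 0%N = nmem s 0%N by rewrite ag9.1.
have sL : selected n px t.+1 (nmem s5 LL) by apply: selected_ext l5.
have sR : selected n (fun k => - px k) t.+1 (nmem s7 RL) by apply: selected_ext l7.
have sT : selected n (fun k => - py k) t.+1 (nmem s9 TL) by apply: selected_ext l9.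
pose bel k : nat := (py k < py i).
have mk9 : marked n s9 bel.
  have c93 : nmem s9 CNT = nmem s3 CNT.
    by rewrite ag9.1 // ag8.1 // ag7.1 // ag6.1 // ag5.1 // ag4.1.
  have e93 : nmem s9 vE = nmem s3 vE.
    by rewrite ag9.1 // ag8.1 // ag7.1 // ag6.1 // ag5.1 // ag4.1.
  by rewrite /marked c93 e93.
have rs a : a \notin [:: 3; 4; 5; 7; 8; 9]%N -> rmem s9 a = rmem s a.
  rewrite !inE !negb_or => /and5P[a3 a4 a5 a7 /andP[a8 a9]].
  rewrite ag9.2 // ag8.2 ?ag7.2 ?ag6.2 ?ag5.2 ?ag4.2 ?ag3.2 ?ag2.2 ?ag1.2 //=;
  by rewrite !inE ?negb_or ?a3 ?a4 ?a5 ?a7 ?a8 ?a9.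
have ns a : a \in [:: 0; 1; 2; 8]%N -> nmem s9 a = nmem s a.
  rewrite !inE => /or4P[]/eqP->;
  by rewrite ag9.1 // ag8.1 // ag7.1 // ag6.1 // ag5.1 // ag4.1 // ag3.1 // ag2.1 // ag1.1.
have r91 a : a \in [:: 7; 8; 9]%N -> rmem s9 a = rmem s1 a.
  rewrite !inE => /or3P[]/eqP->;
  by rewrite ag9.2 // ag8.2 // ag7.2 // ag6.2 // ag5.2 // ag4.2 // ag3.2 // ag2.2.
have r92 a : a \in [:: 4; 5]%N -> rmem s9 a = rmem s2 a.
  rewrite !inE => /orP[]/eqP->;
  by rewrite ag9.2 // ag8.2 // ag7.2 // ag6.2 // ag5.2 // ag4.2 // ag3.2.
have en9 : env n t i (nmem s5 LL) (nmem s7 RL) (nmem s9 TL) px py (x j - x i) (y j - y i)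
    (sqdist x y i j) s9.
  split; first by rewrite (ns 0%N) // (ns 1%N).
  split; last by rewrite (r92 4%N) // (r92 5%N) // (r91 7%N) // (r91 8%N) // (r91 9%N).
  split=> //; last by rewrite ag9.1 // ag8.1.
  by rewrite ag9.1 // ag8.1 // ag7.1 // ag6.1.
have good9 v : good s v -> good s9 v by rewrite /good (ns HAVE) // !rs.
have inv9 : out_inv (valid_rect n t x y) s9 by rewrite /out_inv (ns HAVE) // !rs.
have sel_lt (key : nat -> R) f : selected n key t.+1 f -> forall q, (q <= t)%N -> (f q < n)%N.
  by move=> sel q qt; have [] := sel q qt.
have rc := @runs_staircase R n (valid_rect n t x y) t i (nmem s5 LL) (nmem s7 RL)
  (nmem s9 TL) bel px py (x j - x i) (y j - y i) (sqdist x y i j) d0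
  (sel_lt _ _ sL) (sel_lt _ _ sR) (sel_lt _ _ sT) _ _ s9 en9 inv9 mk9.
apply: runs_conseq (rc _ _) (leqnn _) _.
- by move=> a b p at_ bt pt ex; apply: rect_valid ex.
- by move=> a b p p' at_ bt pt ex pp; apply: rect_area_le ex pp.
move=> s10 [inv10 imp10 cand]; split=> //.
  by move=> v /good9 /imp10.
move=> v tv; have [a [b [p [at_ bt pt ex le_v]]]] :=
  @target_rect R n t x y i j _ _ _ bel px py tn iN d0 hpx hpy sL sR sT (fun=> fun=> erefl) v tv.
by apply: good_le le_v _; apply: cand.
Qed.

End Process.

(** * Counting the points to the right of a line *)

Section Angular.
Variable R : realType.
Variables (x y : nat -> R).

Definition flip i k : bool := (y k - y i < 0) || (y k - y i == 0) && (x k - x i < 0).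
Definition ndx i k : R := if flip i k then - (x k - x i) else x k - x i.
Definition ndy i k : R := if flip i k then - (y k - y i) else y k - y i.
(* Increasing with the angle of (ndx, ndy), which lies in [0, pi). *)
Definition angular_key i k : R :=
  - ndx i k / ((if 0 <= ndx i k then ndx i k else - ndx i k) + ndy i k).
Definition cross i j k : R := (x j - x i) * (y k - y i) - (y j - y i) * (x k - x i).
Definition right_of i j k : bool := across x y i j k < across x y i j i.

Lemma right_ofE i j k : right_of i j k = (cross i j k < 0).
Proof. by rewrite /right_of -subr_lt0; congr (_ < 0); rewrite /across /cross; ring. Qed.

Lemma upper_half i k : (x k - x i != 0) || (y k - y i != 0) ->
  0 < ndy i k \/ (ndy i k = 0 /\ 0 < ndx i k).
Proof.
rewrite /ndy /ndx /flip; move: (x k - x i) (y k - y i) => a b.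
case: (ltgtP b 0) => /= hb; [by left; lra | by left; lra |].
by rewrite orbF; case: (ltgtP a 0) => //= ha _; right; lra.
Qed.

(** [angular_key] is minus the first coordinate of the direction scaled to l1 norm 1, which
    increases along the upper half circle. Clearing the positive denominators leaves a polynomial
    inequality for each choice of signs. *)
Lemma angular_key_le i j k : (x j - x i != 0) || (y j - y i != 0) ->
  (x k - x i != 0) || (y k - y i != 0) -> angular_key i k <= angular_key i j ->
  0 <= ndx i k * ndy i j - ndy i k * ndx i j.
Proof.
move=> /upper_half hj /upper_half hk; rewrite /angular_key.
move: (ndx i k) (ndy i k) (ndx i j) (ndy i j) hj hk => a b c d hj hk.
have dk : 0 < (if 0 <= a then a else - a) + b by case: ifP => /= h; case: hk => [|[]]; lra.
have dj : 0 < (if 0 <= c then c else - c) + d by case: ifP => /= h; case: hj => [|[]]; lra.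
rewrite ler_pdivrMr // mulrAC ler_pdivlMr //.
case: ifP dk => /= ha dk; case: ifP dj => /= hc dj.
- by move=> h; nra.
- by move=> h; case: hj => [d0|[d0 c0]]; case: hk => [b0|[b0 a0]]; nra.
- move=> h; case: hj => [d0|[d0 c0]]; case: hk => [b0|[b0 a0]]; try lra; nra.
- by move=> h; nra.
Qed.

Variable n : nat.
Hypothesis gp : forall i j k, (i < n)%N -> (j < n)%N -> (k < n)%N ->
  i != j -> j != k -> i != k -> cross i j k != 0.
Hypothesis inj : forall i j, (i < n)%N -> (j < n)%N -> i != j ->
  (x j - x i != 0) || (y j - y i != 0).

Lemma ncross_cross i j k : cross i j k =
  (if flip i j (+) flip i k then -1 else 1) * (ndx i j * ndy i k - ndy i j * ndx i k).
Proof.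
by rewrite /cross /ndx /ndy; case: (flip i j); case: (flip i k) => /=; ring.
Qed.

(* The points to the right of the line through i along the p-th direction: the
   flipped ones not yet passed, and the unflipped ones already passed. *)
Definition ahead i (ord : nat -> nat) p : pred nat :=
  fun k => (k != i) && (flip i k (+) (k \in mkseq ord p)).

Lemma selected_notin (key : nat -> R) m f p q : selected n key m f -> (p < m)%N -> (q <= p)%N ->
  f p \notin mkseq f q.
Proof.
move=> sel pm qp; have [_ np _] := sel p pm.
apply: contra np => /mapP[z]; rewrite mem_iota /= add0n => zq ->.
by apply/mapP; exists z; rewrite // mem_iota /= add0n; lia.
Qed.

(** Among normalized directions an earlier one is clockwise from a later one, that is, to its right;
    each of the two flips exchanges the sides. *)
Lemma right_of_ahead i ord p k : selected n (angular_key i) n ord -> (p < n)%N -> (i < n)%N ->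
  (k < n)%N -> ord p != i -> k != i -> k != ord p ->
  right_of i (ord p) k = flip i (ord p) (+) flip i k (+) (k \in mkseq ord p).
Proof.
move=> sel pn iN kn pi ki kp; have [jn jp le_j] := sel p pn.
set j := ord p in pi kp jn jp le_j *.
have ji : (x j - x i != 0) || (y j - y i != 0) by apply: inj; rewrite // eq_sym.
have hk : (x k - x i != 0) || (y k - y i != 0) by apply: inj; rewrite // eq_sym.
(* General position makes the weak inequalities of [angular_key_le] strict. *)
have c0 : cross i j k != 0 by apply: gp; rewrite // eq_sym.
rewrite right_ofE; move: c0; rewrite ncross_cross.
case: (boolP (k \in mkseq ord p)) => kord.
  case/mapP: kord => q; rewrite mem_iota /= add0n => qp kq.
  have [_ _ le_k] := sel q (ltn_trans qp pn); rewrite -kq in le_k.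
  have := angular_key_le ji hk (le_k j jn (selected_notin sel pn (ltnW qp))).
  by case: (flip i j); case: (flip i k) => /= ? /eqP ?; apply/idP/idP => //; lra.
have := angular_key_le hk ji (le_j k kn kord).
by case: (flip i j); case: (flip i k) => /= ? /eqP ?; apply/idP/idP => //; lra.
Qed.

Lemma right_of_self i j : right_of i j i = false /\ right_of i j j = false.
Proof. by rewrite !right_ofE /cross; split; apply/negbTE; rewrite -leNgt; lra. Qed.

Lemma countn_split (P : pred nat) j : (j < n)%N ->
  countn P n = (countn (fun k => (k != j) && P k) n + P j)%N.
Proof.
move=> jn; have := count_predUI (fun k => (k != j) && P k) (fun k => (k == j) && P k) (iota 0 n).
have -> : count (predI (fun k => (k != j) && P k) (fun k => (k == j) && P k)) (iota 0 n) = 0%N.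
  by rewrite (@eq_count _ _ pred0) ?count_pred0 // => k /=; case: eqP => _; rewrite ?andbF.
have -> : count (fun k => (k == j) && P k) (iota 0 n) = P j.
  case: (boolP (P j)) => Pj.
    rewrite (@eq_count _ _ (pred1 j)); last by move=> k /=; case: eqP => // ->.
    by rewrite count_uniq_mem ?iota_uniq // mem_iota /= add0n jn.
  by rewrite (@eq_count _ _ pred0) ?count_pred0 // => k /=; case: eqP => // ->; rewrite (negbTE Pj).
rewrite /countn addn0 => <-; apply: eq_count => k /=; by case: eqP => _; rewrite ?orbF.
Qed.

Lemma countn_eq (P Q : pred nat) : (forall k, (k < n)%N -> P k = Q k) -> countn P n = countn Q n.
Proof. by move=> h; apply: eq_in_count => k; rewrite mem_iota /= add0n; exact: h. Qed.

(** Passing [ord p] changes the status of that point alone. The additive form avoids truncated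
    subtraction. *)
Lemma ahead_step i ord p : selected n (angular_key i) n ord -> (p < n)%N -> ord p != i ->
  (countn (ahead i ord p.+1) n + flip i (ord p) = countn (ahead i ord p) n + ~~ flip i (ord p))%N.
Proof.
move=> sel pn pi; have [jn jp _] := sel p pn.
rewrite (countn_split (ahead i ord p.+1) jn) (countn_split (ahead i ord p) jn).
rewrite /ahead pi (negbTE jp) mkseqS mem_rcons inE eqxx /= addbT addbF.
rewrite addnAC; congr (_ + _ + _)%N; apply: countn_eq => k _.
by case: (eqVneq k (ord p)) => //= kp; rewrite mem_rcons inE (negbTE kp).
Qed.

Lemma ahead_step_self i ord p : ord p = i ->
  countn (ahead i ord p.+1) n = countn (ahead i ord p) n.
Proof.
move=> pi; apply: countn_eq => k _; rewrite /ahead mkseqS mem_rcons inE pi.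
by case: eqP.
Qed.

(** For a flipped j the points not right of i -> j are those in [ahead], which includes j itself,
    together with i; hence n - 1 minus the count. *)
Lemma count_right_of i ord p : selected n (angular_key i) n ord -> (p < n)%N -> (i < n)%N ->
  ord p != i ->
  countn (right_of i (ord p)) n =
    if flip i (ord p) then (n - 1 - countn (ahead i ord p) n)%N else countn (ahead i ord p) n.
Proof.
move=> sel pn iN pi; have [jn jp _] := sel p pn.
have [ri rj] := right_of_self i (ord p).
case: ifP => fl; last first.
  apply: countn_eq => k kn; rewrite /ahead.
  have [->|ki] := eqVneq k i; first by rewrite ri.
  have [->|kp] := eqVneq k (ord p); first by rewrite rj fl (negbTE jp).
  by rewrite (right_of_ahead sel) // fl.
have E : countn (predC (right_of i (ord p))) n = (countn (ahead i ord p) n).+1.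
  rewrite (countn_split _ iN) /= ri addn1; congr _.+1; apply: countn_eq => k kn.
  rewrite /ahead; have [//|ki /=] := eqVneq k i.
  have [->|kp] := eqVneq k (ord p); first by rewrite rj fl (negbTE jp).
  by rewrite (right_of_ahead sel) // fl /= addNb negbK.
have := count_predC (right_of i (ord p)) (iota 0 n); rewrite size_iota => E2.
by rewrite /countn in E *; lia.
Qed.
End Angular.

(** * The whole program *)

Definition normalize : cmd :=
  CIf (BAnd (BRLe (RConst 0) (rvar rDY))
         (BNot (BAnd (BRLe (rvar rDY) (RConst 0)) (BNot (BRLe (RConst 0) (rvar rDX))))))
    (CNStore SGN (nvar vQ) (NConst 0))
    (CNStore SGN (nvar vQ) (NConst 1) ;;
     vC ::= NAdd (nvar vC) (NConst 1) ;;
     rDX :=r: RSub (RConst 0) (rvar rDX) ;;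
     rDY :=r: RSub (RConst 0) (rvar rDY)).

Definition set_key : cmd :=
  CIf (BRLe (RConst 0) (rvar rDX))
    (CRStore KEY (nvar vQ) (RDiv (RSub (RConst 0) (rvar rDX)) (RAdd (rvar rDX) (rvar rDY))))
    (CRStore KEY (nvar vQ) (RDiv (RSub (RConst 0) (rvar rDX))
                                 (RAdd (RSub (RConst 0) (rvar rDX)) (rvar rDY)))).

Definition angular_keys : cmd :=
  vC ::= NConst 0 ;;
  For vQ nN
    (rDX :=r: RSub (RLoad 0 (nvar vQ)) (RLoad 0 (nvar vI)) ;;
     rDY :=r: RSub (RLoad 1 (nvar vQ)) (RLoad 1 (nvar vI)) ;;
     normalize ;; set_key).

Definition classify : cmd :=
  CIf (BNLe (NLoad SGN (nvar vJ)) (NConst 0))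
    (vRR ::= nvar vC ;; vC ::= NAdd (nvar vC) (NConst 1))
    (vRR ::= NSub (NSub nN (NConst 1)) (nvar vC) ;; vC ::= NSub (nvar vC) (NConst 1)).

Definition visit : cmd :=
  vJ ::= NLoad ORD (nvar vPP) ;;
  CIf (BAnd (BNLe (nvar vJ) (nvar vI)) (BNLe (nvar vI) (nvar vJ))) CSkip
    (classify ;; CIf (BNLe (nvar vRR) nT) process CSkip).

Definition sweep : cmd :=
  angular_keys ;; select ORD nN ;; For vPP nN visit.

(** The first stores turn point 0 into a rectangle with null sides. It is declared valid only when
    [n <= 1], with [BEST] still 0. *)
Definition main : cmd :=
  CRStore OUT (NConst 0) (RLoad 0 (NConst 0)) ;;
  CRStore OUT (NConst 1) (RLoad 1 (NConst 0)) ;;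
  CIf (BNLe nN (NConst 1)) (HAVE ::= NConst 1) CSkip ;;
  For vI nN sweep.

Section Sweep.
Variable R : realType.
Implicit Types (s : state R).

Lemma flipE (x y : nat -> R) i k : flip x y i k =
  ~~ ((0 <= y k - y i) && ~~ ((y k - y i <= 0) && ~~ (0 <= x k - x i))).
Proof. by rewrite /flip !ltNge eq_le; case: (0 <= y k - y i); case: (_ <= 0); case: (0 <= _). Qed.

Lemma runs_normalize s k i (x y : nat -> R) : nmem s vQ 0%N = k ->
  rmem s rDX 0%N = x k - x i -> rmem s rDY 0%N = y k - y i ->
  runs normalize s (cost normalize) (fun s' =>
    [/\ rmem s' rDX 0%N = ndx x y i k, rmem s' rDY 0%N = ndy x y i k,
        nmem s' SGN = upd (nmem s SGN) k (flip x y i k : nat)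
      & nmem s' vC 0%N = (nmem s vC 0%N + flip x y i k)%N]).
Proof.
move=> hk hx hy; rewrite /normalize; apply: runs_if => /=; rewrite hx hy => hc.
  have fl : flip x y i k = false by rewrite flipE hc.
  apply: runs_sl_le => //=; rewrite /update /= hk /ndx /ndy fl hx hy addn0; split=> //.
have fl : flip x y i k by rewrite flipE.
apply: runs_sl_le => //=; rewrite /update /= hk /ndx /ndy fl hx hy !sub0r addn1; split=> //.
Qed.

Lemma runs_set_key s k i (x y : nat -> R) : nmem s vQ 0%N = k ->
  rmem s rDX 0%N = ndx x y i k -> rmem s rDY 0%N = ndy x y i k ->
  runs set_key s (cost set_key) (fun s' =>
    rmem s' KEY = upd (rmem s KEY) k (angular_key x y i k)).
Proof.
move=> hk hx hy.
(* Division by zero gives 0 in the machine and in the library alike; it does occur, for k = i. *)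
have E (a b : R) : (if b == 0 then 0 else a / b) = a / b.
  by case: eqP => // ->; rewrite invr0 mulr0.
by apply: runs_if => /=; rewrite hx => hc; apply: runs_sl_le => //=;
  rewrite /update /= hk hx hy E !sub0r /angular_key ?hc ?(negbTE hc).
Qed.

Lemma runs_angular_keys s n i : let x := rmem s 0%N in let y := rmem s 1%N in
  nmem s 0%N 0%N = n -> nmem s vI 0%N = i ->
  runs angular_keys s (1000 * n + 1000) (fun s' =>
    [/\ forall k, (k < n)%N -> rmem s' KEY k = angular_key x y i k,
        forall k, (k < n)%N -> nmem s' SGN k = flip x y i k
      & nmem s' vC 0%N = countn (flip x y i) n]).
Proof.
move=> x y hn hi; apply: (@runs_le _ _ _ (3 + (1000 * n + 500))%N); last by lia.
apply: runs_seq; apply: runs_sl_le => //= ag0; set s0 := setn _ _ _ _ in ag0 *.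
pose I m (s' : state R) :=
  [/\ forall k, (k < m)%N -> rmem s' KEY k = angular_key x y i k,
        forall k, (k < m)%N -> nmem s' SGN k = flip x y i k
      & nmem s' vC 0%N = countn (flip x y i) m].
apply: (@runs_loop _ _ _ _ n I (20 + (20 + (cost normalize + cost set_key)))) => //.
- by move=> s' ag; rewrite /= (ag.1 0%N) // (ag0.1 0%N).
- move=> m s1 mn ag1 hm [I1 I2 I3].
  apply: runs_seq; apply: runs_sl_le => // ag2; set s2 := sl _ _ in ag2 *.
  have dx2 : rmem s2 rDX 0%N = x m - x i.
    by rewrite /s2 /= /update /= hm (ag1.1 vI) // (ag0.1 vI) // hi (ag1.2 0%N).
  clearbody s2; apply: runs_seq; apply: runs_sl_le => // ag3; set s3 := sl _ _ in ag3 *.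
  have dy3 : rmem s3 rDY 0%N = y m - y i.
    rewrite /s3 /= /update /= (ag2.1 vI) // (ag2.1 vQ) // hm (ag1.1 vI) // (ag0.1 vI) // hi.
    by rewrite (ag2.2 1%N) // (ag1.2 1%N).
  have dx3 : rmem s3 rDX 0%N = x m - x i by rewrite (ag3.2 rDX).
  have hm3 : nmem s3 vQ 0%N = m by rewrite (ag3.1 vQ) // (ag2.1 vQ).
  clearbody s3; apply: runs_seq.
  apply: runs_conseq (@runs_normalize s3 m i x y hm3 dx3 dy3) (leqnn _) _.
  move=> s4 [dx4 dy4 sg4 c4] ag4; have hm4 : nmem s4 vQ 0%N = m by rewrite (ag4.1 vQ).
  apply: runs_conseq (runs_agree (@runs_set_key s4 m i x y hm4 dx4 dy4)) (leqnn _) _.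
  move=> s5 [ag5 k5] _; rewrite /I /setn /update /=; split.
  + move=> k; rewrite k5 ltnS leq_eqVlt => /orP[/eqP->|km]; first by rewrite upd_eq.
    by rewrite upd_neq ?(ltn_eqF km) // (ag4.2 KEY) // (ag3.2 KEY) // (ag2.2 KEY) // I1.
  + move=> k; rewrite (ag5.1 SGN) // sg4 ltnS leq_eqVlt => /orP[/eqP->|km].
      by rewrite upd_eq.
    by rewrite upd_neq ?(ltn_eqF km) // (ag3.1 SGN) // (ag2.1 SGN) // I2.
  + by rewrite (ag5.1 vC) // c4 (ag3.1 vC) // (ag2.1 vC) // I3 countnS.
- by rewrite /=; lia.
Qed.

Lemma runs_classify s n j b c : nmem s 0%N 0%N = n -> nmem s vJ 0%N = j ->
  nmem s SGN j = (b : bool) -> nmem s vC 0%N = c ->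
  runs classify s (cost classify) (fun s' =>
    nmem s' vRR 0%N = (if b then n - 1 - c else c)%N /\
    nmem s' vC 0%N = (c + ~~ b - b)%N).
Proof.
move=> hn hj hb hc; apply: runs_if => /=; rewrite hj hb => hle.
  have -> : b = false by case: b hle {hb}.
  by apply: runs_sl_le => //=; rewrite /update /= hc subn0.
have -> : b = true by case: b hle {hb}.
by apply: runs_sl_le => //=; rewrite /update /= hc hn addn0.
Qed.

Section Points.
Variables (n t : nat) (x y : nat -> R).
Hypothesis gp : forall i j k, (i < n)%N -> (j < n)%N -> (k < n)%N ->
  i != j -> j != k -> i != k -> cross x y i j k != 0.
Hypothesis inj : forall i j, (i < n)%N -> (j < n)%N -> i != j ->
  (x j - x i != 0) || (y j - y i != 0).
Hypothesis tn : (t < n)%N.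

Definition shallow i j : bool := (j != i) && (countn (right_of x y i j) n <= t)%N.

Definition unit_cost : nat := (n + t.+1 * (trunc_log 2 n).+1 + t.+1 * t.+1)%N.

Definition inputs s : Prop :=
  [/\ nmem s 0%N 0%N = n, nmem s 0%N 1%N = t, rmem s 0%N = x & rmem s 1%N = y].

Lemma inputs_agree nW rW s s' : agree nW rW s s' -> inputs s ->
  0%N \notin nW -> 0%N \notin rW -> 1%N \notin rW -> inputs s'.
Proof. by move=> [an ar] en n0 r0 r1; rewrite /inputs !an // !ar. Qed.

Lemma sqdist_neq0 i j : (i < n)%N -> (j < n)%N -> j != i -> sqdist x y i j != 0.
Proof.
move=> iN jN ji; have := inj iN jN; rewrite eq_sym ji => /(_ isT).
rewrite /sqdist; move: (x j - x i) (y j - y i) => a b.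
by rewrite paddr_eq0 ?sqr_ge0 // !expf_eq0 /= negb_and.
Qed.

Variables KP KO : nat.
Local Notation V := (valid_rect n t x y).
Hypothesis hproc : forall s i j, inputs s -> nmem s vI 0%N = i -> nmem s vJ 0%N = j ->
  (i < n)%N -> sqdist x y i j != 0 -> out_inv V s ->
  runs process s (KP * unit_cost) (fun s' =>
    [/\ out_inv V s', improves s s' & forall v, target n t x y i j v -> good s' v]).
Hypothesis hsel : forall s, inputs s ->
  runs (select ORD nN) s (KO * (n + n * (trunc_log 2 n).+1)) (fun s' =>
    selected n (rmem s KEY) n (nmem s' ORD)).

Definition sweep_inv i ord s0 p s : Prop :=
  [/\ out_inv V s, improves s0 s, nmem s vC 0%N = countn (ahead x y i ord p) n
    & forall q, (q < p)%N -> shallow i (ord q) ->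
        forall v, target n t x y i (ord q) v -> good s v].

(** The bound distinguishes shallow pairs, so that summing over [p] charges [process] exactly
    [degree i] times. *)
Lemma runs_visit i ord s0 p s : inputs s -> nmem s vI 0%N = i -> (i < n)%N ->
  nmem s ORD = ord -> (forall k, (k < n)%N -> nmem s SGN k = flip x y i k) ->
  selected n (angular_key x y i) n ord -> nmem s vPP 0%N = p -> (p < n)%N ->
  sweep_inv i ord s0 p s ->
  runs visit s (100 + (if shallow i (ord p) then KP * unit_cost else 0)) (sweep_inv i ord s0 p.+1).
Proof.
move=> inp hi iN ho hs sel hp pn [inv imp hc cand]; have [jn jp _] := sel p pn.
apply: (@runs_le _ _ _ (6 + (11 + (cost classify + (5 +
  (1 + (if shallow i (ord p) then KP * unit_cost else 0))))))%N); last first.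
  by rewrite /=; case: ifP; lia.
apply: runs_seq; apply: runs_sl_le => // ag1; set s1 := sl _ _ in ag1 *.
have hj1 : nmem s1 vJ 0%N = ord p by rewrite /s1 /= /update /= hp ho.
clearbody s1; have hi1 : nmem s1 vI 0%N = i by rewrite (ag1.1 vI).
have good1 v : good s v -> good s1 v by rewrite /good (ag1.1 HAVE) // !ag1.2.
have inv1 : out_inv V s1 by rewrite /out_inv (ag1.1 HAVE) // !ag1.2.
have inp1 : inputs s1 by apply: inputs_agree ag1 inp _ _ _.
apply: runs_if => /=; rewrite hi1 hj1 -eqn_leq => ji.
  have pi := eqP ji; apply: (@runs_sl_le _ CSkip) => //.
  split=> //=; first by move=> v /imp /good1.
    by rewrite (ag1.1 vC) // hc ahead_step_self.
  move=> q; rewrite ltnS leq_eqVlt => /orP[/eqP->|qp]; first by rewrite /shallow pi eqxx.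
  by move=> sh v tv; apply: good1; apply: cand tv.
have hc1 : nmem s1 vC 0%N = countn (ahead x y i ord p) n by rewrite (ag1.1 vC).
have sg1 : nmem s1 SGN (ord p) = flip x y i (ord p) by rewrite (ag1.1 SGN) // hs.
have hn1 : nmem s1 0%N 0%N = n by case: inp1.
apply: runs_seq; apply: runs_conseq (runs_classify hn1 hj1 sg1 hc1) (leqnn _) _.
move=> s2 [rr2 c2] ag2.
rewrite -(count_right_of gp inj sel pn iN ji) in rr2.
have c2' : nmem s2 vC 0%N = countn (ahead x y i ord p.+1) n.
  by rewrite c2; have := ahead_step sel pn ji; lia.
have good2 v : good s1 v -> good s2 v by rewrite /good (ag2.1 HAVE) // !ag2.2.
have inv2 : out_inv V s2 by rewrite /out_inv (ag2.1 HAVE) // !ag2.2.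
have inp2 : inputs s2 by apply: inputs_agree ag2 inp1 _ _ _.
have [hn2 ht2 _ _] := inp2.
apply: runs_if => /=; rewrite rr2 ht2 => hr; last first.
  apply: runs_sl_le => //=; split=> //=.
  - by move=> v /imp /good1 /good2.
  - move=> q; rewrite ltnS leq_eqVlt => /orP[/eqP->|qp].
      by rewrite /shallow (negbTE hr) andbF.
    by move=> sh v tv; apply: good2; apply: good1; apply: cand tv.
have sh : shallow i (ord p) by rewrite /shallow ji hr.
rewrite sh; apply: runs_le; last exact: leq_addl.
apply: runs_conseq (runs_agree (@hproc s2 i (ord p) inp2 _ _ iN _ inv2)) (leqnn _) _.
- by rewrite (ag2.1 vI).
- by rewrite (ag2.1 vJ).
- exact: sqdist_neq0.
move=> s3 [ag3 [inv3 imp3 cand3]]; split=> //.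
- by move=> v /imp /good1 /good2 /imp3.
- by rewrite (ag3.1 vC).
move=> q; rewrite ltnS leq_eqVlt => /orP[/eqP->|qp]; first by move=> _; exact: cand3.
by move=> shq v tv; apply: imp3; apply: good2; apply: good1; apply: cand tv.
Qed.

Definition degree i : nat := countn (shallow i) n.

Lemma runs_sweep i s : inputs s -> nmem s vI 0%N = i -> (i < n)%N -> out_inv V s ->
  runs sweep s ((3000 + KO) * (n + n * (trunc_log 2 n).+1) + degree i * (KP * unit_cost))
    (fun s' => [/\ out_inv V s', improves s s' & forall j, (j < n)%N -> shallow i j ->
        forall v, target n t x y i j v -> good s' v]).
Proof.
move=> inp hi iN inv; have [hn ht hx hy] := inp; have n0 := leq_ltn_trans (leq0n t) tn.
pose L := (n + n * (trunc_log 2 n).+1)%N.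
have := @runs_angular_keys s n i hn hi; rewrite hx hy => rak.
apply: (@runs_le _ _ _ ((1000 * n + 1000) + (KO * L +
   ((113 * n + degree i * (KP * unit_cost)) + 13)))%N); last first.
  have nL : (n <= L)%N by rewrite leq_addr.
  by rewrite -/L mulnDl; move: (KO * L)%N (degree i * _)%N => a b; lia.
apply: runs_seq; apply: runs_conseq rak (leqnn _) _ => s1 [k1 sg1 c1] ag1.
have inp1 : inputs s1 by apply: inputs_agree ag1 inp _ _ _.
apply: runs_seq; apply: runs_conseq (hsel inp1) (leqnn _) _ => s2 sel' ag2.
have sel : selected n (angular_key x y i) n (nmem s2 ORD) by apply: selected_ext sel'.
have inp2 : inputs s2 by apply: inputs_agree ag2 inp1 _ _ _.
set ord := nmem s2 ORD in sel.
(* Selecting all [n] indices is sorting them; a sum over positions is therefore a sum over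
   points. *)
have perm : perm_eq (mkseq ord n) (iota 0 n).
  have u p : (p <= n)%N -> uniq (mkseq ord p).
    elim: p => // p IH pn; rewrite mkseqS rcons_uniq IH ?(ltnW pn) // andbT.
    by have [] := sel p pn.
  apply: uniq_perm; [exact: u | exact: iota_uniq |].
  have [] := @uniq_min_size _ (mkseq ord n) (iota 0 n) (u _ (leqnn _)) => //.
  - by move=> k /mapP[z]; rewrite !mem_iota /= !add0n => zn ->; have [] := sel z zn.
  - by rewrite size_iota size_mkseq.
have hi2 : nmem s2 vI 0%N = i by rewrite (ag2.1 vI) // (ag1.1 vI).
have sg2 k : (k < n)%N -> nmem s2 SGN k = flip x y i k by rewrite (ag2.1 SGN) // => /sg1.
have inv2 : out_inv V s2.
  by rewrite /out_inv (ag2.1 HAVE) // (ag1.1 HAVE) // !ag2.2 // !ag1.2.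
have good2 v : good s v -> good s2 v.
  by rewrite /good (ag2.1 HAVE) // (ag1.1 HAVE) // !ag2.2 // !ag1.2.
apply: runs_le; last first.
  have E : (\sum_(p < n) ((100 + (if shallow i (ord p) then KP * unit_cost else 0)) +
     (ncost nN + 11)) + (ncost nN + 11) <= (113 * n + degree i * (KP * unit_cost)) + 13)%N.
    rewrite leq_add2r; under eq_bigr do rewrite addnAC.
    rewrite big_split /= sum_nat_const card_ord mulnC leq_add2l.
    rewrite -(big_mkord xpredT (fun p => if shallow i (ord p) then KP * unit_cost else 0)%N).
    rewrite /index_iota subn0 -big_mkcond /= big_const_seq iter_addn_0 mulnC.
    rewrite leq_mul2r; apply/orP; right; rewrite /degree /countn -(permP perm (shallow i)).
    by rewrite count_map.
  exact: E.
pose I p (s' : state R) := sweep_inv i ord s p s'.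
apply: runs_conseq (runs_agree (@runs_for _ vPP nN visit n I
   (fun p => 100 + (if shallow i (ord p) then KP * unit_cost else 0))%N s2 _ _ _ _)) (leqnn _) _ => //.
- by move=> s' ag; rewrite /= (ag.1 0%N) //; case: inp2.
- split=> //=.
  + rewrite [LHS](_ : _ = nmem s2 vC 0%N) // (ag2.1 vC) // c1.
    apply: countn_eq => k kn; rewrite /ahead /= addbF.
    case: eqP => // ->; rewrite /flip !subrr ltxx eqxx //.
- move=> p s3 pn ag3 hp3 I3.
  apply: runs_conseq (@runs_visit i ord s p s3 _ _ iN _ _ sel hp3 pn I3) (leqnn _) _.
  + by apply: inputs_agree ag3 inp2 _ _ _.
  + by rewrite (ag3.1 vI).
  + by rewrite (ag3.1 ORD).
  + by move=> k kn; rewrite (ag3.1 SGN) // sg2.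
  + by [].
move=> s3 [ag3 [inv3 imp3 _ cand3]]; split=> // j jn.
have : j \in mkseq ord n by rewrite (perm_mem perm) mem_iota.
by case/mapP=> q; rewrite mem_iota /= add0n => qn ->; exact: cand3.
Qed.

(* The answer for a single point, which has no pair to process. *)
Lemma point_rect_valid (o : nat -> R) : (n <= 1)%N -> o 0%N = x 0%N -> o 1%N = y 0%N ->
  (forall k, (1 < k)%N -> o k = 0) -> V (out_rect o) 0.
Proof.
move=> n1 o0 o1 ok; have nE : n = 1%N by lia.
rewrite out_rectE o0 o1 !ok //; split.
- by rewrite /is_rectangle /= dot_row2; ring.
- by rewrite /area /enorm /= !dot_row2 mulr0 addr0 sqrtr0 mulr0.
rewrite nE /= /= addn0; have -> : (t = 0)%N by lia.
rewrite lt0b; apply/asboolP; exists 0, 0; rewrite /= !lexx !ler01; split=> //.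
by rewrite !scale0r !addr0.
Qed.

Lemma runs_main s : inputs s -> nmem s HAVE 0%N = 0%N -> rmem s OUT = (fun=> 0) ->
  rmem s BEST 0%N = 0 ->
  runs main s (100 + n * (100 + (3000 + KO) * (n + n * (trunc_log 2 n).+1)) +
      (\sum_(i < n) degree i) * (KP * unit_cost))
    (fun s' => [/\ out_inv V s', (n <= 1)%N -> good s' 0
      & forall i j, (i < n)%N -> (j < n)%N -> shallow i j ->
        forall v, target n t x y i j v -> good s' v]).
Proof.
move=> inp have0 out0 best0.
set L := (n + n * (trunc_log 2 n).+1)%N.
apply: (@runs_le _ _ _ (4 + (4 + ((10 + \sum_(i < n) ((3000 + KO) * L + degree i * (KP * unit_cost) +
  (ncost nN + 11))) + (ncost nN + 11))))%N); last first.
  rewrite big_split /= big_split /= !sum_nat_const !card_ord -big_distrl /=.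
  by move: ((3000 + KO) * L)%N ((\sum_(i < n) degree i) * _)%N => a b; lia.
apply: runs_store => s1 n1 r1; apply: runs_store => s2 n2 r2.
have o2 : [/\ rmem s2 OUT 0%N = x 0%N, rmem s2 OUT 1%N = y 0%N &
    forall k, (1 < k)%N -> rmem s2 OUT k = 0].
  case: inp => _ _ hx hy; rewrite r2 /update /= r1 /update /= hx hy.
  by rewrite out0; split=> // -[|[|k]].
have inp2 : inputs s2.
  by case: inp => hn ht hx hy; rewrite /inputs n2 n1 r2 !update_neq // r1 !update_neq.
have best2 : rmem s2 BEST 0%N = 0 by rewrite r2 update_neq // r1 update_neq.
rewrite -(addnA 10); apply: runs_seq.
apply: (@runs_conseq _ _ _ 10 _ (fun s3 => [/\ inputs s3, out_inv V s3 & (n <= 1)%N -> good s3 0])).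
- apply: (@runs_le _ _ _ (6 + 4)%N) => //; apply: runs_if => /=; case: (inp2) => -> _ _ _ hn1.
    apply: runs_sl_le => //=; split=> //.
      by move=> _ /=; rewrite best2; case: o2 => *; apply: point_rect_valid.
    move=> _; split=> //=; by rewrite best2.
  apply: runs_sl_le => //=; split=> //; last by rewrite (negbTE hn1).
  by rewrite /out_inv n2 n1 have0.
- exact: leqnn.
move=> s3 [inp3 inv3 good3] _.
pose I m (s' : state R) := [/\ out_inv V s', improves s3 s' &
   forall i j, (i < m)%N -> (j < n)%N -> shallow i j ->
        forall v, target n t x y i j v -> good s' v].
apply: runs_conseq (@runs_for _ vI nN sweep n I
  (fun i => (3000 + KO) * L + degree i * (KP * unit_cost))%N s3 _ _ _ _) (leqnn _) _ => //.
- by move=> s' ag; rewrite /= (ag.1 0%N) //; case: inp3.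
- by split.
- move=> i s4 iN ag4 hi [inv4 imp4 cand4].
  have inp4 : inputs s4 by apply: inputs_agree ag4 inp3 _ _ _.
  apply: runs_conseq (runs_sweep inp4 hi iN inv4) (leqnn _) _.
  move=> s5 [inv5 imp5 cand5] ag5; split=> //.
    by move=> v /imp4 /imp5.
  move=> i' j; rewrite ltnS leq_eqVlt => /orP[/eqP->|ii] jn sh v tv; first exact: cand5 tv.
  by apply: imp5; apply: cand4 tv.
- by move=> s5 [inv5 imp5 cand5]; split=> // /good3 /imp5.
Qed.

End Points.
End Sweep.

(** * The number of shallow pairs *)

Lemma exists_argmin (R : realDomainType) (T : eqType) (F : T -> R) (s : seq T) a : a \in s ->
  exists2 b, b \in s & forall c, c \in s -> F b <= F c.
Proof.
elim: s a => // h s IH a _; case: s IH => [|h' s] IH.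
  by exists h; rewrite ?mem_head // => c; rewrite inE => /eqP->.
have [b bs hb] := IH h' (mem_head _ _).
have [le_hb|lt_bh] := lerP (F h) (F b).
  exists h; rewrite ?mem_head // => c; rewrite inE => /orP[/eqP->//|/hb].
  exact: le_trans.
exists b; first by rewrite inE bs orbT.
by move=> c; rewrite inE => /orP[/eqP->|/hb //]; apply: ltW.
Qed.

Lemma count_or_le (T : Type) (a b : pred T) s p q : (count a s <= p)%N -> (count b s <= q)%N ->
  (count (fun k => a k || b k) s <= p + q)%N.
Proof.
move=> ap bq; apply: leq_trans (leq_add ap bq); have := count_predUI a b s.
rewrite (@eq_count _ (predU a b) (fun k => a k || b k)) //.
by move: (count (predI a b) s) => d <-; rewrite leq_addr.
Qed.

Lemma count_eq_iota j n : (count (fun k => k == j) (iota 0 n) <= 1)%N.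
Proof. by rewrite -/(count (pred1 j) _) count_uniq_mem ?iota_uniq // leq_b1. Qed.

Section Degree.
Variable R : realType.
Variables (n t : nat) (x y : nat -> R).
Hypothesis gp : forall i j k, (i < n)%N -> (j < n)%N -> (k < n)%N ->
  i != j -> j != k -> i != k -> cross x y i j k != 0.
Hypothesis inj : forall i j, (i < n)%N -> (j < n)%N -> i != j ->
  (x j - x i != 0) || (y j - y i != 0).

(* Fix a shallow i -> j0.  At most t points lie to its right; among the shallow j
   to its left, the one of largest angle has all the others to its right. *)
Lemma degree_le i : (i < n)%N -> (degree n t x y i <= t + t + 2)%N.
Proof.
move=> iN; rewrite /degree /countn.
have [/hasP[j0]|nh] := boolP (has (shallow n t x y i) (iota 0 n)); last first.
  by move: nh; rewrite has_count -leqNgt leqn0 => /eqP->.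
rewrite mem_iota /= add0n => j0n /andP[j0i r0].
pose B k := (0 < cross x y i j0 k) && shallow n t x y i k.
have cB : (count B (iota 0 n) <= t.+1)%N.
  have [/hasP[j2 j2n Bj2]|nh] := boolP (has B (iota 0 n)); last first.
    by move: nh; rewrite has_count -leqNgt leqn0 => /eqP->.
  (* The cotangent of the angle from i -> j0 to i -> k, so the largest angle minimizes [F]. *)
  pose F k := ((x j0 - x i) * (x k - x i) + (y j0 - y i) * (y k - y i)) / cross x y i j0 k.
  have : j2 \in [seq k <- iota 0 n | B k] by rewrite mem_filter Bj2.
  case/(exists_argmin F) => j1; rewrite mem_filter mem_iota /= add0n => /andP[Bj1 j1n] min.
  have /andP[c1 /andP[j1i r1]] := Bj1.
  apply: (@leq_trans (count (fun k => (k == j1) || right_of x y i j1 k) (iota 0 n))).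
    apply: count_sub_in => k kn /= Bk; have [//|kj1 /=] := eqVneq k j1.
    have kn' : (k < n)%N by move: kn; rewrite mem_iota.
    have := min k; rewrite mem_filter Bk kn => /(_ isT).
    have /andP[ck /andP[ki _]] := Bk.
    rewrite /F ler_pdivrMr // mulrAC ler_pdivlMr // => le_F.
    have c0 : cross x y i j1 k != 0 by apply: gp; rewrite // eq_sym.
    have a0 : 0 < sqdist x y i j0.
      by rewrite lt0r (sqdist_neq0 inj) //= /sqdist addr_ge0 // sqr_ge0.
    (* For the vectors a, b, c from i to j0, j1, k: |a|^2 (b x c) = (a . b)(a x c) - (a . c)(a x b),
       which is nonpositive by the minimality of [F j1]. *)
    rewrite right_ofE lt_neqAle c0 /= -(pmulr_rle0 _ a0).
    by move: le_F; rewrite /cross /sqdist; nra.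
  by rewrite -add1n; apply: count_or_le; [exact: count_eq_iota | exact: r1].
apply: (@leq_trans (count (fun k => (k == j0) || (right_of x y i j0 k || B k)) (iota 0 n))).
  apply: count_sub_in => k; rewrite mem_iota /= add0n => kn sh.
  have [//|kj0 /=] := eqVneq k j0; rewrite right_ofE /B sh andbT.
  have /andP[ki _] := sh.
  have : cross x y i j0 k != 0 by apply: gp; rewrite // eq_sym.
  by case: ltgtP.
rewrite (_ : t + t + 2 = 1 + (t + t.+1))%N; last by lia.
apply: count_or_le; first exact: count_eq_iota.
by apply: count_or_le; [exact: r0 | exact: cB].
Qed.
End Degree.

(** * Minimum rectangles are flush with an edge *)

Section Flush.
Variable R : realType.
Implicit Types (x y : nat -> R) (u v : R * R).

Definition turn (sg : R) u : R * R := (- (sg * u.2), sg * u.1).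
Definition dotp x y u k : R := u.1 * x k + u.2 * y k.
Definition sqnorm u : R := u.1 ^+ 2 + u.2 ^+ 2.
Definition supports x y (S : seq nat) u p : Prop :=
  p \in S /\ forall k, k \in S -> dotp x y u k <= dotp x y u p.

Lemma exists_support x y S u a : a \in S -> exists p, supports x y S u p.
Proof.
move=> aS; have [p pS hp] := exists_argmin (fun k => - dotp x y u k) aS.
by exists p; split=> // k /hp; rewrite lerN2.
Qed.

Definition opp u : R * R := (- u.1, - u.2).

Variables (x y : nat -> R) (S : seq nat).
Local Notation d := (dotp x y).
Local Notation supp := (supports x y S).

(** The edge from p to k is c times the quarter turn of the outer normal v; if c < 0 its ends are
    exchanged, which puts S on its left. Then [along] and [across] are c and - c times the linear
    forms of [turn 1 v] and v, while the squared length of the edge is c^2 |v|^2, so c cancels in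
    the area. *)
Lemma flush_edge v p k q r s : 0 < sqnorm v -> p != k -> k \in S ->
  (x k - x p != 0) || (y k - y p != 0) ->
  supp v p -> d v k = d v p -> supp (opp v) q -> supp (turn 1 v) r -> supp (opp (turn 1 v)) s ->
  exists i j lo hi top, [/\ i \in S, j \in S, i != j,
    forall l, l \in S -> across x y i j i <= across x y i j l <= top /\ lo <= along x y i j l <= hi
    & (hi - lo) * (top - across x y i j i) / sqdist x y i j =
      (d v p - d v q) * (d (turn 1 v) r - d (turn 1 v) s) / sqnorm v].
Proof.
move=> v0 pk kS nz [pS hp] kp [qS hq] [rS hr] [sS hs].
have : exists i j c, [/\ i \in S /\ j \in S, i != j, d v i = d v p, 0 < c &
   x j - x i = - (c * v.2) /\ y j - y i = c * v.1].
  pose c := ((x k - x p) * - v.2 + (y k - y p) * v.1) / sqnorm v.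
  have cE : c * sqnorm v = (x k - x p) * - v.2 + (y k - y p) * v.1.
    by rewrite /c divfK // gt_eqF.
  have kp0 : v.1 * (x k - x p) + v.2 * (y k - y p) = 0 by move: kp; rewrite /dotp; lra.
  have ex : x k - x p = - (c * v.2).
    apply: (mulIf (lt0r_neq0 v0)); rewrite mulNr mulrAC cE; apply/eqP.
    rewrite -subr_eq0 (_ : _ - _ = v.1 * (v.1 * (x k - x p) + v.2 * (y k - y p))).
      by rewrite kp0 mulr0.
    by rewrite /sqnorm; ring.
  have ey : y k - y p = c * v.1.
    apply: (mulIf (lt0r_neq0 v0)); rewrite mulrAC cE; apply/eqP.
    rewrite -subr_eq0 (_ : _ - _ = v.2 * (v.1 * (x k - x p) + v.2 * (y k - y p))).
      by rewrite kp0 mulr0.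
    by rewrite /sqnorm; ring.
  have c0 : c != 0.
    apply/eqP => c0; move: nz; rewrite ex ey c0 !mul0r oppr0 eqxx //.
  have [cn|cp] := ltrP c 0.
    exists k, p, (- c); split=> //; [by rewrite eq_sym | lra | split; lra].
  exists p, k, c; split=> //.
  by rewrite lt_neqAle eq_sym c0.
case=> i [j [c [[iS jS] ij di c0 [ex ey]]]].
have al l : along x y i j l = c * d (turn 1 v) l.
  by rewrite /along ex ey /dotp /turn /=; ring.
have ac l : across x y i j l = - (c * d v l).
  by rewrite /across ex ey /dotp; ring.
exists i, j, (c * d (turn 1 v) s), (c * d (turn 1 v) r), (- (c * d v q)).
split=> //.
  move=> l lS; rewrite al !ac di; have := hp l lS; have := hq l lS.
  have := hr l lS; have := hs l lS.
  have opE w z : d (opp w) z = - d w z by rewrite /dotp /=; ring.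
  rewrite !opE !lerN2 !(ler_pM2l c0) => h1 h2 h3 h4.
  by rewrite h1 h2 h3 h4.
have -> : sqdist x y i j = c ^+ 2 * sqnorm v by rewrite /sqdist ex ey /sqnorm; ring.
rewrite ac di; field; rewrite !gt_eqF //.
Qed.

Definition normal sg u m : R * R := iter m (turn sg) u.
(** The m-th normal turned by the angle arctan c in the sense [sg], up to the factor sqrt (1 + c^2).
    This form is linear in c. *)
Definition rotated sg u c m : R * R :=
  ((normal sg u m).1 + c * (normal sg u m.+1).1, (normal sg u m).2 + c * (normal sg u m.+1).2).

Lemma dotp_rotated sg u c m k :
  d (rotated sg u c m) k = d (normal sg u m) k + c * d (normal sg u m.+1) k.
Proof. by rewrite /dotp /rotated /=; ring. Qed.

(* Turn u until some support is about to change; sg = 1 or -1 is the sense of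
   rotation. *)
Lemma rotate sg u (P : nat -> nat) a b : sg ^+ 2 = 1 -> a \in S -> b \in S -> a != b ->
  (forall m, (m < 4)%N -> supp (normal sg u m) (P m)) ->
  (forall m k, (m < 4)%N -> k \in S -> k != P m -> d (normal sg u m) k < d (normal sg u m) (P m)) ->
  exists c, 0 < c /\ (forall m, (m < 4)%N -> supp (rotated sg u c m) (P m)) /\
    exists m k, [/\ (m < 4)%N, k \in S, k != P m
      & d (rotated sg u c m) k = d (rotated sg u c m) (P m)].
Proof.
move=> sg2 aS bS ab hP strict.
(* After turning by [c], the support [P m] is ahead of [k] by A m k - c B m k, so [k] catches up at
   c = A m k / B m k, provided B m k > 0. The least such quotient is the [c] wanted. *)
pose A m k := d (normal sg u m) (P m) - d (normal sg u m) k.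
pose B m k := d (normal sg u m.+1) k - d (normal sg u m.+1) (P m).
pose cand := [seq mk <- [seq (m, k) | m <- iota 0 4, k <- S] | 0 < B mk.1 mk.2].
have candP m k : ((m, k) \in cand) = [&& (m < 4)%N, k \in S & 0 < B m k].
  rewrite mem_filter andbC [RHS]andbA; congr (_ && _).
  apply/allpairsPdep/andP => [[m' [k' [h1 h2 [-> ->]]]] | [h1 h2]].
    by move: h1; rewrite mem_iota.
  by exists m, k; rewrite mem_iota.
(* If two consecutive supports differ, the next one gains on the present one. Otherwise one point
   would be the strict maximum in both directions u and - u, although [S] has two points. *)
have ne : exists mk, mk \in cand.
  have step m : (m.+1 < 4)%N -> P m != P m.+1 -> exists mk, mk \in cand.
    move=> m4 ne; exists (m, P m.+1); rewrite candP (ltnW m4) /=.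
    have [-> _] := hP _ m4; rewrite /B subr_gt0; apply: strict => //.
    by have [] := hP _ (ltnW m4).
  have [e01|] := eqVneq (P 0%N) (P 1%N); last exact: step.
  have [e12|] := eqVneq (P 1%N) (P 2%N); last exact: step.
  have E k : d (normal sg u 2) k = - d (normal sg u 0) k.
    have e : d (normal sg u 2) k = - (sg ^+ 2 * d u k) by rewrite /dotp /normal /=; ring.
    by rewrite e sg2 mul1r.
  have [c cS cP] : exists2 c, c \in S & c != P 0%N.
    have [ea|na] := eqVneq a (P 0%N); last by exists a.
    by exists b; rewrite // -ea eq_sym.
  have := strict 0%N c isT cS cP; have := strict 2%N c isT cS.
  by rewrite -e12 -e01 cP !E => /(_ isT); lra.
pose F mk := A mk.1 mk.2 / B mk.1 mk.2.
have [mk0 mk0c] := ne.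
have [[m k] mkc min] := exists_argmin F mk0c.
have := mkc; rewrite candP => /and3P[m4 kS Bk].
have kP : k != P m by apply: contraTneq Bk => ->; rewrite /B subrr ltxx.
have Ak : 0 < A m k by rewrite subr_gt0; apply: strict.
exists (F (m, k)); split; first by rewrite divr_gt0.
have c0 : 0 < F (m, k) by rewrite divr_gt0.
split.
  move=> m' m'4; split; first by have [] := hP _ m'4.
  move=> k' k'S; rewrite !dotp_rotated.
  have [Bk'|Bk'] := ltrP 0 (B m' k').
    have := min (m', k'); rewrite candP m'4 k'S Bk' => /(_ isT).
    rewrite {2}/F /= ler_pdivlMr // /A /B; lra.
  have A0 : 0 <= A m' k' by rewrite subr_ge0; have [_] := hP _ m'4; apply.
  have : F (m, k) * B m' k' <= 0 by rewrite pmulr_rle0.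
  by move: A0; rewrite /A /B; lra.
exists m, k; split=> //; rewrite !dotp_rotated.
have : F (m, k) * B m k = A m k by rewrite /F divfK // gt_eqF.
by rewrite /A /B; lra.
Qed.

(* P 0, P 1, P 2, P 3 are extreme in the directions u, Ju, - u, - Ju. *)
Definition four_supports u (P : nat -> nat) : Prop :=
  forall m, (m < 4)%N -> supp (normal 1 u m) (P m).
Definition box_area u (P : nat -> nat) : R :=
  (d u (P 0%N) - d u (P 2%N)) * (d (turn 1 u) (P 1%N) - d (turn 1 u) (P 3%N)) / sqnorm u.

Definition flush_box (a : R) : Prop :=
  exists i j lo hi top, [/\ i \in S, j \in S, i != j,
    forall l, l \in S -> across x y i j i <= across x y i j l <= top /\ lo <= along x y i j l <= hi
    & (hi - lo) * (top - across x y i j i) / sqdist x y i j = a].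

Hypothesis distinct : forall p k, p \in S -> k \in S -> p != k ->
  (x k - x p != 0) || (y k - y p != 0).

Lemma turn_turn u : turn 1 (turn 1 u) = opp u.
Proof. by rewrite /turn /opp /=; congr pair; ring. Qed.
Lemma oppK u : opp (opp u) = u.
Proof. by case: u => a b; rewrite /opp /= !opprK. Qed.
Lemma turn_opp u : turn 1 (opp u) = opp (turn 1 u).
Proof. by rewrite /turn /opp /=; congr pair; ring. Qed.
Lemma dotp_opp u k : d (opp u) k = - d u k.
Proof. by rewrite /dotp /opp /=; ring. Qed.
Lemma sqnorm_turn u : sqnorm (turn 1 u) = sqnorm u.
Proof. by rewrite /sqnorm /turn /=; ring. Qed.
Lemma sqnorm_opp u : sqnorm (opp u) = sqnorm u.
Proof. by rewrite /sqnorm /opp /=; ring. Qed.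

(** [flush_edge] applied to the m-th normal: a cyclic relabelling of the four supports leaves the
    area unchanged. *)
Lemma flush_normal u P m k : 0 < sqnorm u -> four_supports u P -> (m < 4)%N -> k \in S ->
  k != P m -> d (normal 1 u m) k = d (normal 1 u m) (P m) -> flush_box (box_area u P).
Proof.
move=> u0 hP m4 kS; rewrite eq_sym => kP dk.
have := hP 0%N isT; have := hP 1%N isT; have := hP 2%N isT; have := hP 3%N isT.
rewrite /normal /= ?turn_turn ?turn_opp => h3 h2 h1 h0.
have nz := distinct (proj1 (hP m m4)) kS kP.
case: m m4 kP dk nz => [|[|[|[|//]]]] _ kP; rewrite /normal /= ?turn_turn ?turn_opp => dk nz.
- by have [i [j [lo [hi [top H]]]]] := flush_edge u0 kP kS nz h0 dk h2 h1 h3;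
    exists i, j, lo, hi, top.
- rewrite -sqnorm_turn in u0; rewrite -(turn_turn u) in h2.
  have h0' : supp (opp (turn 1 (turn 1 u))) (P 0%N) by rewrite turn_turn oppK.
  have [i [j [lo [hi [top [H1 H2 H3 H4 H5]]]]]] := flush_edge u0 kP kS nz h1 dk h3 h2 h0'.
  exists i, j, lo, hi, top; split=> //; rewrite H5 turn_turn !dotp_opp sqnorm_turn /box_area.
  by congr (_ / _); ring.
- rewrite -sqnorm_opp in u0; rewrite -(oppK u) in h0; rewrite -turn_opp in h3.
  have h1' : supp (opp (turn 1 (opp u))) (P 1%N) by rewrite turn_opp oppK.
  have [i [j [lo [hi [top [H1 H2 H3 H4 H5]]]]]] := flush_edge u0 kP kS nz h2 dk h0 h3 h1'.
  exists i, j, lo, hi, top; split=> //; rewrite H5 turn_opp !dotp_opp sqnorm_opp /box_area.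
  by congr (_ / _); ring.
rewrite -sqnorm_turn -sqnorm_opp in u0.
have h1' : supp (opp (opp (turn 1 u))) (P 1%N) by rewrite oppK.
have h0' : supp (turn 1 (opp (turn 1 u))) (P 0%N) by rewrite turn_opp turn_turn oppK.
have h2' : supp (opp (turn 1 (opp (turn 1 u)))) (P 2%N) by rewrite turn_opp turn_turn oppK.
have [i [j [lo [hi [top [H1 H2 H3 H4 H5]]]]]] := flush_edge u0 kP kS nz h3 dk h1' h0' h2'.
exists i, j, lo, hi, top; split=> //; rewrite H5 turn_opp turn_turn oppK !dotp_opp.
by rewrite sqnorm_opp sqnorm_turn /box_area; congr (_ / _); ring.
Qed.

Lemma product_form_cone (a0 b0 a1 b1 W0 H0 W1 H1 al be lam : R) :
  0 <= W0 -> 0 <= H0 -> 0 <= W1 -> 0 <= H1 -> 0 < al -> 0 < be -> 0 <= lam ->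
  lam * (a0 ^+ 2 + b0 ^+ 2) < W0 * H0 -> lam * (a1 ^+ 2 + b1 ^+ 2) < W1 * H1 ->
  lam * ((al * a0 + be * a1) ^+ 2 + (al * b0 + be * b1) ^+ 2) <
  (al * W0 + be * W1) * (al * H0 + be * H1).
Proof.
move=> w0 h0 w1 h1 al0 be0 lam0 q0 q1.
pose N0 := a0 ^+ 2 + b0 ^+ 2; pose N1 := a1 ^+ 2 + b1 ^+ 2; pose D := a0 * a1 + b0 * b1.
have n0 : 0 <= N0 by rewrite addr_ge0 // sqr_ge0.
have n1 : 0 <= N1 by rewrite addr_ge0 // sqr_ge0.
have cs : D ^+ 2 <= N0 * N1.
  rewrite -subr_ge0 (_ : _ - _ = (a0 * b1 - b0 * a1) ^+ 2) ?sqr_ge0 //.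
  by rewrite /D /N0 /N1; ring.
(* In squares: (2 lam D)^2 <= 4 lam^2 N0 N1 <= 4 W0 H0 W1 H1 <= (W0 H1 + W1 H0)^2. *)
have mixed : 2 * lam * D <= W0 * H1 + W1 * H0.
  apply: le_trans (ler_norm _) _.
  rewrite -[X in _ <= X]ger0_norm; last by rewrite addr_ge0 // mulr_ge0.
  rewrite -ler_sqr ?nnegrE ?normr_ge0 // !real_normK ?num_real //.
  have h2 : (lam * N0) * (lam * N1) <= (W0 * H0) * (W1 * H1).
    by apply: ler_pM; rewrite ?mulr_ge0 // ltW.
  have h3 : lam ^+ 2 * D ^+ 2 <= lam ^+ 2 * (N0 * N1) by rewrite ler_wpM2l ?sqr_ge0.
  have h4 := sqr_ge0 (W0 * H1 - W1 * H0).
  by nra.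
have e : lam * ((al * a0 + be * a1) ^+ 2 + (al * b0 + be * b1) ^+ 2) =
  al ^+ 2 * (lam * N0) + be ^+ 2 * (lam * N1) + al * be * (2 * lam * D).
  by rewrite /N0 /N1 /D; ring.
have e' : (al * W0 + be * W1) * (al * H0 + be * H1) =
  al ^+ 2 * (W0 * H0) + be ^+ 2 * (W1 * H1) + al * be * (W0 * H1 + W1 * H0) by ring.
rewrite e e'.
have hA : al ^+ 2 * (lam * N0) < al ^+ 2 * (W0 * H0) by rewrite ltr_pM2l ?exprn_gt0.
have hB : be ^+ 2 * (lam * N1) < be ^+ 2 * (W1 * H1) by rewrite ltr_pM2l ?exprn_gt0.
have hC : al * be * (2 * lam * D) <= al * be * (W0 * H1 + W1 * H0).
  by rewrite ler_wpM2l // ltW // mulr_gt0.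
by lra.
Qed.

(** Turning in the other sense meets the four normals in the order 0, 3, 2, 1. *)
Definition flip_supports (P : nat -> nat) m : nat := P ((4 - m) %% 4)%N.

Lemma normal_opp u m : (m < 4)%N -> normal (- 1) u m = normal 1 u ((4 - m) %% 4).
Proof.
by case: m => [|[|[|[|//]]]] _; rewrite /normal /turn /=; case: u => a b /=; congr pair; ring.
Qed.

Lemma rotated_normal sg u c m : rotated sg u c m = normal sg (rotated sg u c 0) m.
Proof.
elim: m => // m IH; rewrite [RHS]/= -/(normal _ _ m) -IH /rotated /turn /=.
by congr pair; ring.
Qed.

Lemma four_supports_flip u P :
  (forall m, (m < 4)%N -> supp (normal (- 1) u m) (flip_supports P m)) -> four_supports u P.
Proof.
move=> h m m4; have := h ((4 - m) %% 4)%N (ltn_pmod (4 - m) (isT : (0 < 4)%N)).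
rewrite normal_opp ?ltn_pmod // /flip_supports.
by case: m m4 => [|[|[|[|//]]]].
Qed.

Lemma sqnorm_rotated sg u c : sg ^+ 2 = 1 -> sqnorm (rotated sg u c 0) = (1 + c ^+ 2) * sqnorm u.
Proof.
move=> sg2; rewrite /sqnorm /rotated /=.
have -> : (u.1 + c * - (sg * u.2)) ^+ 2 + (u.2 + c * (sg * u.1)) ^+ 2 =
  u.1 ^+ 2 + u.2 ^+ 2 + c ^+ 2 * sg ^+ 2 * (u.1 ^+ 2 + u.2 ^+ 2) by ring.
by rewrite sg2; ring.
Qed.

Lemma box_sides_ge0 u P : four_supports u P ->
  0 <= d u (P 0%N) - d u (P 2%N) /\ 0 <= d (turn 1 u) (P 1%N) - d (turn 1 u) (P 3%N).
Proof.
move=> hP; have [_ h0] := hP 0%N isT; have [_ h1] := hP 1%N isT.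
have [p2 _] := hP 2%N isT; have [p3 _] := hP 3%N isT.
by rewrite !subr_ge0; split; [exact: h0 | exact: h1].
Qed.

(** If no side is flush, turning u both ways gives flush directions u1 = u + c1 J u and u0 = u - c0
    J u with the same supports, and c1 u0 + c0 u1 = (c0 + c1) u. Were both boxes larger than the one
    at u, [product_form_cone] would make the box at u larger than itself. *)
Lemma exists_flush_box u P a b : 0 < sqnorm u -> four_supports u P ->
  a \in S -> b \in S -> a != b -> exists2 v, v <= box_area u P & flush_box v.
Proof.
move=> u0 hP aS bS ab.
have [/hasP[m]|] := boolP (has (fun m => has (fun k => (k != P m) &&
    (d (normal 1 u m) k == d (normal 1 u m) (P m))) S) (iota 0 4)).
  rewrite mem_iota => m4 /hasP[k kS /andP[kP /eqP dk]].
  by exists (box_area u P); [exact: lexx | apply: flush_normal dk].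
move=> /hasPn nflush.
have strict m k : (m < 4)%N -> k \in S -> k != P m -> d (normal 1 u m) k < d (normal 1 u m) (P m).
  move=> m4 kS kP; have := nflush m; rewrite mem_iota m4 => /(_ isT) /hasPn /(_ k kS).
  by rewrite kP /= lt_neqAle => -> /=; have [_] := hP m m4; apply.
have [c1 [c1p [hP1 [m1 [k1 [m14 k1S k1P dk1]]]]]] := rotate (expr1n _ 2) aS bS ab hP strict.
have sgN : (- 1 : R) ^+ 2 = 1 by rewrite sqrrN expr1n.
have hPN m : (m < 4)%N -> supp (normal (- 1) u m) (flip_supports P m).
  by move=> m4; rewrite normal_opp //; apply: hP; rewrite ltn_pmod.
have strictN m k : (m < 4)%N -> k \in S -> k != flip_supports P m ->
    d (normal (- 1) u m) k < d (normal (- 1) u m) (flip_supports P m).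
  by move=> m4; rewrite normal_opp //; apply: strict; rewrite ltn_pmod.
have [c0 [c0p [hP0 [m0 [k0 [m04 k0S k0P dk0]]]]]] := rotate sgN aS bS ab hPN strictN.
pose u1 := rotated 1 u c1 0; pose u0' := rotated (- 1) u c0 0.
have u1p : 0 < sqnorm u1.
  by rewrite sqnorm_rotated ?expr1n // mulr_gt0 // addr_gt0 // exprn_gt0.
have u0p : 0 < sqnorm u0'.
  by rewrite sqnorm_rotated // mulr_gt0 // addr_gt0 // exprn_gt0.
have s1 : four_supports u1 P by move=> m m4; rewrite -rotated_normal; apply: hP1.
have s0 : four_supports u0' P.
  by apply: four_supports_flip => m m4; rewrite -rotated_normal; apply: hP0.
have f1 : flush_box (box_area u1 P).
  by apply: (flush_normal u1p s1 m14 k1S k1P); rewrite -rotated_normal.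
have f0 : flush_box (box_area u0' P).
  apply: (flush_normal u0p s0 (ltn_pmod (4 - m0) (isT : (0 < 4)%N)) k0S k0P).
  by rewrite -normal_opp // -rotated_normal.
have [le1|lt1] := lerP (box_area u1 P) (box_area u P); first by exists (box_area u1 P).
have [le0|lt0] := lerP (box_area u0' P) (box_area u P); first by exists (box_area u0' P).
exfalso.
have [w1 h1] := box_sides_ge0 s1; have [w0 h0] := box_sides_ge0 s0.
have [w h] := box_sides_ge0 hP.
have lam0 : 0 <= box_area u P by rewrite divr_ge0 ?mulr_ge0 // ltW.
move: lt1 lt0; rewrite {2}/box_area ltr_pdivlMr // => lt1; rewrite {2}/box_area ltr_pdivlMr // => lt0.
have := product_form_cone w0 h0 w1 h1 c1p c0p lam0 lt0 lt1.
have -> : (c1 * u0'.1 + c0 * u1.1) ^+ 2 + (c1 * u0'.2 + c0 * u1.2) ^+ 2 = (c0 + c1) ^+ 2 * sqnorm u.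
  by rewrite /u0' /u1 /rotated /sqnorm /=; ring.
have -> : c1 * (d u0' (P 0%N) - d u0' (P 2%N)) + c0 * (d u1 (P 0%N) - d u1 (P 2%N)) =
   (c0 + c1) * (d u (P 0%N) - d u (P 2%N)).
  by rewrite /u0' /u1 /rotated /dotp /=; ring.
have -> : c1 * (d (turn 1 u0') (P 1%N) - d (turn 1 u0') (P 3%N)) +
    c0 * (d (turn 1 u1) (P 1%N) - d (turn 1 u1) (P 3%N)) =
   (c0 + c1) * (d (turn 1 u) (P 1%N) - d (turn 1 u) (P 3%N)).
  by rewrite /u0' /u1 /rotated /dotp /=; ring.
by rewrite /box_area mulrCA divfK ?gt_eqF // expr2 mulrACA ltxx.
Qed.
End Flush.

(** * Shallow pairs and convex layers *)

Section Layers.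
Variable R : realType.
Variables (n : nat) (X : 'I_n -> 'rV[R]_2).

Definition linform (a b : R) (p : 'rV[R]_2) : R := a * p 0 0 + b * p 0 1.

Lemma linform_sum a b (S : {set 'I_n}) (w : 'I_n -> R) :
  linform a b (\sum_(i in S) w i *: X i) = \sum_(i in S) w i * linform a b (X i).
Proof.
rewrite /linform !summxE !mulr_sumr -big_split /=; apply: eq_bigr => i _.
by rewrite !mxE; ring.
Qed.

Lemma hull_linform_ge (S : {set 'I_n}) a b c p :
  (forall i, i \in S -> c <= linform a b (X i)) -> hull X S p -> c <= linform a b p.
Proof.
move=> hS [w [w0 w1 ->]]; rewrite linform_sum -[c]mul1r -w1 mulr_suml.
by apply: ler_sum => i iS; apply: ler_wpM2l => //; apply: hS.
Qed.

Lemma hull_vertex (S : {set 'I_n}) i : i \in S -> hull X S (X i).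
Proof.
move=> iS; exists (fun k => (k == i)%:R); split=> [k||]; first by rewrite ler0n.
  by rewrite (bigD1 i) //= eqxx big1 ?addr0 // => k /andP[_ /negbTE ->].
rewrite (bigD1 i) //= eqxx scale1r big1 ?addr0 // => k /andP[_ /negbTE ->].
by rewrite scale0r.
Qed.

(** The form keeps its minimum on the hull, and a small move against its gradient goes below it; so
    the minimizer is not an interior point. *)
Lemma on_layer_minimizer (S : {set 'I_n}) i a b : i \in S -> (a != 0) || (b != 0) ->
  (forall k, k \in S -> linform a b (X i) <= linform a b (X k)) -> i \in on_layer X S.
Proof.
move=> iS ab hmin; rewrite inE iS /=; apply/asboolP; split.
  by apply: subset_closure; apply: hull_vertex.
have s0 : 0 < a ^+ 2 + b ^+ 2.
  by rewrite lt0r addr_ge0 ?sqr_ge0 // paddr_eq0 ?sqr_ge0 // !expf_eq0 /= negb_and ab.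
rewrite /interior /= => /nbhs_ballP[e /= e0 he].
pose g : 'rV[R]_2 := row2 a b; pose c := e / 2 / (1 + `|g|).
have g1 : 0 < 1 + `|g| by rewrite ltr_pwDl.
have c0 : 0 < c by rewrite !divr_gt0.
have := he (X i - c *: g); rewrite -ball_normE /= opprB addrC subrK normrZ (gtr0_norm c0).
have lt : c * `|g| < e.
  have : c * (1 + `|g|) = e / 2 by rewrite /c divfK // gt_eqF.
  have : 0 <= c * `|g| by rewrite mulr_ge0 // ltW.
  by rewrite mulrDr mulr1; lra.
move=> /(_ lt) /(hull_linform_ge hmin); apply/negP; rewrite -ltNge.
by rewrite /linform !mxE /= /linform; have := mulr_gt0 c0 s0; lra.
Qed.

(* A layer of a set meeting the open half-plane of rt contains a point of it. *)
Lemma shallow_on_layer (t : nat) i a b : (a != 0) || (b != 0) ->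
  (#|[set k : 'I_n | (linform a b (X k) < linform a b (X i))%R]%SET| <= t)%N ->
  i \in (\bigcup_(m < t.+1) layer X m)%SET.
Proof.
move=> ab; set rt := [set k | _]%SET => rt_t.
apply/negPn/negP => ni.
have notin m : (m <= t)%N -> i \notin layer X m.
  move=> mt; apply: contra ni => im; apply/bigcupP; exists (inord m) => //.
  by rewrite inordK.
have peel m : (m <= t.+1)%N -> i \in remaining X m /\ (#|(rt :&: remaining X m)%SET| + m <= #|rt|)%N.
  elim: m => [_|m IH mt]; first by rewrite /= inE finset.setIT addn0.
  have [im cm] := IH (ltnW mt); split; first by rewrite /= inE im andbT; exact: notin.
  have [k0 k0m kmin] : exists2 k, k \in remaining X m &
      forall l, l \in remaining X m -> linform a b (X k) <= linform a b (X l).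
    have im' : i \in enum (remaining X m) by rewrite mem_enum.
    have [k km hk] := exists_argmin (fun k => linform a b (X k)) im'.
    exists k; first by rewrite mem_enum in km.
    by move=> l lm; apply: hk; rewrite mem_enum.
  have k0l : k0 \in layer X m by apply: on_layer_minimizer ab kmin.
  (* Otherwise [i] would minimize the form as well and so be on layer [m]. *)
  have k0r : k0 \in rt.
    rewrite inE ltNge; apply/negP => le; have := notin m mt.
    rewrite /layer (@on_layer_minimizer _ _ a b) // => l lm.
    by apply: le_trans le (kmin l lm).
  apply: leq_trans cm; rewrite addnS -addSn leq_add2r.
  apply: proper_card; apply/properP; split.
    by apply: finset.setIS; rewrite /=; apply: finset.subsetDl.
  exists k0; first by rewrite inE k0r.
  by rewrite [remaining X m.+1]/= finset.in_setI finset.in_setD -/(layer X m) k0l andbF.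
by have [_] := peel _ (leqnn _); lia.
Qed.
End Layers.

(** * Correctness and running time *)

Section Bridge.
Variable R : realType.
Variables (n t : nat) (X : 'I_n -> 'rV[R]_2).
Local Notation x := (rmem (input t X) 0%N).
Local Notation y := (rmem (input t X) 1%N).

Lemma input_x (k : 'I_n) : x k = X k 0 0.
Proof. by rewrite /= valK. Qed.

Lemma input_y (k : 'I_n) : y k = X k 0 1.
Proof. by rewrite /= valK. Qed.

Lemma input_row (k : 'I_n) : row2 (x k) (y k) = X k.
Proof.
apply/rowP => c; rewrite mxE input_x input_y.
by case: c => -[|[|//]] h; rewrite /=; congr (X k _ _); apply/val_inj.
Qed.

Lemma card_countn (P : pred nat) : #|[set i : 'I_n | P i]%SET| = countn P n.
Proof.
rewrite cardsE cardE size_filter /countn -val_enum_ord count_map.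
by rewrite enumT.
Qed.

Lemma covered_count r : #|covered X r| =
  count (fun k => `[< region r (row2 (x k) (y k)) >]) (iota 0 n).
Proof.
rewrite -/(countn _ n) -card_countn; congr #|pred_of_set _|.
by apply/setP => i; rewrite !inE input_row.
Qed.

Hypotheses (injX : injective X) (gpX : no_three_collinear X).

Lemma input_distinct i j : (i < n)%N -> (j < n)%N -> i != j ->
  (x j - x i != 0) || (y j - y i != 0).
Proof.
move=> iN jN; apply: contraNT; rewrite negb_or !negbK !subr_eq0 => /andP[/eqP ex /eqP ey].
have : X (Ordinal jN) = X (Ordinal iN).
  by rewrite -!input_row /=; rewrite -/(x j) -/(x i) in ex *; congr row2.
by move/injX => [->].
Qed.

Lemma input_cross i j k : (i < n)%N -> (j < n)%N -> (k < n)%N ->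
  i != j -> j != k -> i != k -> cross x y i j k != 0.
Proof.
move=> iN jN kN ij jk ik; apply/eqP => c0.
apply: (gpX (i := Ordinal iN) (j := Ordinal jN) (k := Ordinal kN)) => //.
have nz := input_distinct iN jN ij.
set p := X (Ordinal iN); set q := X (Ordinal jN); set r := X (Ordinal kN).
have xi : x i = p 0 0 by rewrite -(input_x (Ordinal iN)).
have yi : y i = p 0 1 by rewrite -(input_y (Ordinal iN)).
have xj : x j = q 0 0 by rewrite -(input_x (Ordinal jN)).
have yj : y j = q 0 1 by rewrite -(input_y (Ordinal jN)).
have xk : x k = r 0 0 by rewrite -(input_x (Ordinal kN)).
have yk : y k = r 0 1 by rewrite -(input_y (Ordinal kN)).
move: nz c0; rewrite /cross xi yi xj yj xk yk => nz c0.
have row_ext (u v : 'rV[R]_2) : u 0 0 = v 0 0 -> u 0 1 = v 0 1 -> u = v.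
  move=> e0 e1; apply/rowP => c; case: c => -[|[|//]] h.
    by rewrite (_ : Ordinal h = 0) //; apply/val_inj.
  by rewrite (_ : Ordinal h = 1) //; apply/val_inj.
exists p, (q - p); split.
  by apply: contraTneq nz => e; rewrite -[q](subrK p) e add0r !subrr eqxx.
move=> z [->|->|->].
- by exists 0; rewrite scale0r addr0.
- by exists 1; rewrite scale1r addrC subrK.
have [a0|a0] := eqVneq (q 0 0 - p 0 0) 0.
  have b0 : q 0 1 - p 0 1 != 0 by rewrite a0 eqxx in nz.
  exists ((r 0 1 - p 0 1) / (q 0 1 - p 0 1)); apply: row_ext; rewrite !mxE.
    rewrite a0 mulr0 addr0; apply/eqP; rewrite -subr_eq0; apply/eqP.
    by apply: (mulfI b0); move: c0; rewrite a0; lra.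
  by rewrite divfK //; ring.
exists ((r 0 0 - p 0 0) / (q 0 0 - p 0 0)); apply: row_ext; rewrite !mxE.
  by rewrite divfK //; ring.
set c := _ / _; have ce : c * (q 0 0 - p 0 0) = r 0 0 - p 0 0 by rewrite divfK.
apply: (mulfI a0).
have -> : (q 0 0 - p 0 0) * (p 0 1 + c * (q 0 1 - p 0 1)) =
  (q 0 0 - p 0 0) * p 0 1 + (c * (q 0 0 - p 0 0)) * (q 0 1 - p 0 1) by ring.
by rewrite ce; move: c0; lra.
Qed.

(** The points right of i -> j are those of an open half-plane bounded by a line through i. By
    [shallow_on_layer], [degree] vanishes at every i off the first t + 1 layers. *)
Lemma degree_sum_le : (\sum_(i < n) degree n t x y i <= num_layer_points X t * (t + t + 2))%N.
Proof.
have H i j : (i < n)%N -> (j < n)%N -> shallow n t x y i j ->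
    forall iN : (i < n)%N, Ordinal iN \in (\bigcup_(m < t.+1) layer X m)%SET.
  move=> _ jn /andP[ji rt] iN.
  apply: (@shallow_on_layer _ _ _ _ _ (- (y j - y i)) (x j - x i)).
    by rewrite oppr_eq0 orbC; apply: input_distinct; rewrite // eq_sym.
  rewrite (_ : #|_| = countn (right_of x y i j) n) //.
  rewrite -card_countn; apply: eq_card => k; rewrite !inE /right_of /linform /across.
  rewrite -(input_x k) -(input_y k) -(input_x (Ordinal iN)) -(input_y (Ordinal iN)).
  by congr (_ < _); ring.
apply: (@leq_trans (\sum_(i < n | i \in (\bigcup_(m < t.+1) layer X m)%SET) (t + t + 2))%N).
  rewrite [leqRHS]big_mkcond /=; apply: leq_sum => i _.
  case: ifPn => [_|ni]; first exact: (degree_le t input_cross input_distinct).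
  rewrite /degree /countn leqn0 -leqn0 leqNgt -has_count; apply/negP => /hasP[j].
  rewrite mem_iota => jn sh; case/negP: ni.
  have := H i j (ltn_ord i) jn sh (ltn_ord i).
  by rewrite (_ : Ordinal _ = i) //; apply/val_inj.
by rewrite sum_nat_const leqnn.
Qed.
End Bridge.

(** * From an arbitrary rectangle to a flush box on a shallow pair *)

Section Optimality.
Variable R : realType.

Lemma exists_four_supports (x y : nat -> R) (S : seq nat) u a : a \in S ->
  exists P, four_supports x y S u P.
Proof.
move=> aS; have [p0 h0] := exists_support x y (normal 1 u 0) aS.
have [p1 h1] := exists_support x y (normal 1 u 1) aS.
have [p2 h2] := exists_support x y (normal 1 u 2) aS.
have [p3 h3] := exists_support x y (normal 1 u 3) aS.
by exists (nth 0%N [:: p0; p1; p2; p3]) => -[|[|[|[|//]]]] _.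
Qed.

(** In the direction of a nonnull side of [r], the tight box of [S] is no larger than [r]. A null
    first side is exchanged with the second; both cannot be null, as two distinct points are
    covered. *)
Lemma region_box (x y : nat -> R) (S : seq nat) (r : rectangle R) a b :
  is_rectangle r -> (forall k, k \in S -> region r (row2 (x k) (y k))) ->
  a \in S -> b \in S -> (x b - x a != 0) || (y b - y a != 0) ->
  exists u P, [/\ 0 < sqnorm u, four_supports x y S u P & box_area x y u P <= area r].
Proof.
have swap (v s1 s2 : 'rV[R]_2) p : region (Rectangle v s1 s2) p -> region (Rectangle v s2 s1) p.
  by case=> al [be [h1 h2 ->]]; exists be, al; split=> //=; rewrite addrAC.
wlog s10 : r / (side1 r 0 0 != 0) || (side1 r 0 1 != 0) => [wl|].
  move=> hr hS aS bS ab; case: (boolP ((side1 r 0 0 != 0) || (side1 r 0 1 != 0))) => n1.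
    exact: (wl r).
  case: r hr hS n1 => v s1 s2 hr hS n1.
  case: (boolP ((s2 0 0 != 0) || (s2 0 1 != 0))) => n2.
    have [||u [P [u0 hP le]]] := wl (Rectangle v s2 s1) n2 _ _ aS bS ab.
    - by move: hr; rewrite /is_rectangle /= => <-; rewrite /dot; apply: eq_bigr => i _; rewrite mulrC.
    - by move=> k /hS /swap.
    by exists u, P; split=> //; move: le; rewrite /area /= mulrC.
  move: n1 n2 ab => /=; rewrite !negb_or !negbK => /andP[/eqP e1 /eqP e2] /andP[/eqP e3 /eqP e4].
  have pt k : k \in S -> x k = v 0 0 /\ y k = v 0 1.
    move=> /hS[al [be [_ _ /= /rowP h]]]; have := h 0; have := h 1.
    by rewrite !mxE /= e1 e2 e3 e4 !mulr0 !addr0 => -> ->.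
  have [-> ->] := pt a aS; have [-> ->] := pt b bS.
  by rewrite !subrr eqxx.
move=> hr hS aS bS _; case: r s10 hr hS => v s1 s2 /= s10; rewrite /is_rectangle /= => hr hS.
pose u : R * R := (s1 0 0, s1 0 1).
have [P hP] := exists_four_supports x y u aS.
have u0 : 0 < sqnorm u.
  by rewrite lt0r addr_ge0 ?sqr_ge0 // paddr_eq0 ?sqr_ge0 // !expf_eq0 /= negb_and s10.
exists u, P; split=> //.
have orth : s1 0 0 * s2 0 0 + s1 0 1 * s2 0 1 = 0.
  by rewrite -[RHS]hr /dot !big_ord_recl big_ord0 addr0; congr (_ + s1 _ _ * s2 _ _); apply/val_inj.
(* The signed area of [r]: as the sides are orthogonal, Lagrange's identity gives |s1|^2 |s2|^2 =
   ka^2. *)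
pose ka := s1 0 0 * s2 0 1 - s1 0 1 * s2 0 0.
have coord k : k \in S -> exists al be, [/\ 0 <= al <= 1, 0 <= be <= 1,
    dotp x y u k = u.1 * v 0 0 + u.2 * v 0 1 + al * sqnorm u &
    dotp x y (turn 1 u) k = u.1 * v 0 1 - u.2 * v 0 0 + be * ka].
  move=> /hS[al [be [h1 h2 /= /rowP h]]]; have hx := h 0; have hy := h 1.
  rewrite !mxE /= in hx hy; exists al, be; split=> //.
    rewrite /dotp hx hy /sqnorm /u /=; have := congr1 (fun z => be * z) orth; lra.
  by rewrite /dotp hx hy /ka /u /turn /=; ring.
have [p0 _] := hP 0%N isT; have [p1 _] := hP 1%N isT.
have [p2 _] := hP 2%N isT; have [p3 _] := hP 3%N isT.
have [al0 [_ [al01 _ e0 _]]] := coord _ p0; have [al2 [_ [al21 _ e2 _]]] := coord _ p2.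
have [_ [be1 [_ be11 _ e1]]] := coord _ p1; have [_ [be3 [_ be31 _ e3]]] := coord _ p3.
have [w0 h0] := box_sides_ge0 hP.
have wle : dotp x y u (P 0%N) - dotp x y u (P 2%N) <= sqnorm u.
  by rewrite e0 e2; nra.
have hle : dotp x y (turn 1 u) (P 1%N) - dotp x y (turn 1 u) (P 3%N) <= `|ka|.
  rewrite e1 e3; have := ler_norm ka; have := ler_norm (- ka); rewrite normrN; nra.
have -> : area (Rectangle v s1 s2) = `|ka|.
  have dotE (s s' : 'rV[R]_2) : dot s s' = s 0 0 * s' 0 0 + s 0 1 * s' 0 1.
    by rewrite /dot !big_ord_recl big_ord0 addr0; congr (_ + s _ _ * s' _ _); apply/val_inj.
  rewrite /area /enorm /= !dotE -sqrtrM; last by rewrite addr_ge0 // -expr2 sqr_ge0.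
  rewrite -sqrtr_sqr; congr Num.sqrt.
  have -> : (s1 0 0 * s1 0 0 + s1 0 1 * s1 0 1) * (s2 0 0 * s2 0 0 + s2 0 1 * s2 0 1) =
    ka ^+ 2 + (s1 0 0 * s2 0 0 + s1 0 1 * s2 0 1) ^+ 2 by rewrite /ka; ring.
  by rewrite orth expr0n /= addr0.
rewrite /box_area ler_pdivrMr // mulrC; apply: ler_pM => //.
Qed.

Variables (n t : nat) (x y : nat -> R).
Hypothesis distinct : forall i j, (i < n)%N -> (j < n)%N -> i != j ->
  (x j - x i != 0) || (y j - y i != 0).

(** The points satisfying [Q] are never right of the flush edge, so the points right of it are among
    the at most [t] others: the pair is shallow. *)
Lemma exists_target (Q : pred nat) u P a b : 0 < sqnorm u ->
  (n - t <= count Q (iota 0 n))%N -> (t < n)%N ->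
  four_supports x y [seq k <- iota 0 n | Q k] u P ->
  a \in [seq k <- iota 0 n | Q k] -> b \in [seq k <- iota 0 n | Q k] -> a != b ->
  exists v i j, [/\ v <= box_area x y u P, (i < n)%N, (j < n)%N, shallow n t x y i j
    & target n t x y i j v].
Proof.
move=> u0 cQ tn hP aS bS ab; set S := [seq k <- _ | _] in hP aS bS.
have Sn k : k \in S = (k < n)%N && Q k by rewrite mem_filter mem_iota andbC.
have dist p k : p \in S -> k \in S -> p != k -> (x k - x p != 0) || (y k - y p != 0).
  by rewrite !Sn => /andP[pn _] /andP[kn _]; apply: distinct.
have [v le_v [i [j [lo [hi [top [iS jS ij box val]]]]]]] :=
  exists_flush_box dist u0 hP aS bS ab.
have [iN iQ] := andP (etrans (esym (Sn i)) iS); have [jN jQ] := andP (etrans (esym (Sn j)) jS).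
exists v, i, j; split=> //.
  rewrite /shallow eq_sym ij /=.
  have : (countn (right_of x y i j) n <= count (predC Q) (iota 0 n))%N.
    apply: count_sub_in => k; rewrite mem_iota /= add0n => kn rk; apply/negP => Qk.
    have [|/andP[le _] _] := box k; first by rewrite Sn kn.
    by move: rk; rewrite /right_of ltNge le.
  by have := count_predC Q (iota 0 n); rewrite size_iota; lia.
exists Q, lo, hi, top; split=> // k kn Qk.
by apply: box; rewrite Sn kn.
Qed.
End Optimality.

(** * Arithmetic of the running time *)

Lemma trunc_log_sqr n : (0 < n)%N -> (trunc_log 2 n ^ 2 <= 2 * n)%N.
Proof.
move=> n0; apply: (@leq_trans (2 * 2 ^ trunc_log 2 n)); last first.
  by rewrite leq_mul2l /= trunc_logP.
move: (trunc_log 2 n) => l; case: l => [|[|[|l]]] //.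
elim: l => // l; rewrite -!mulnn (expnS 2 l.+3); move: (2 ^ l.+3)%N => p; nia.
Qed.

(** With l the binary logarithm of n, 2 t l <= t^2 + l^2 and l^2 <= 2 n absorb t log n. *)
Lemma unit_cost_le n t : (0 < t)%N -> (0 < n)%N -> (unit_cost n t <= 9 * n + 10 * t ^ 2)%N.
Proof.
move=> t0 n0; have := trunc_log_sqr n0; rewrite /unit_cost; move: (trunc_log 2 n) => l h.
have h2 : (2 * (t * l) <= t ^ 2 + l ^ 2)%N by have [] := nat_Cauchy t l.
have h3 : (l <= l ^ 2)%N by rewrite -mulnn; case: (l) => // m; rewrite leq_pmull.
have h4 : (t <= t ^ 2)%N by rewrite -mulnn leq_pmull.
have h5 : (1 <= t ^ 2)%N by apply: leq_trans h4.
have -> : (t.+1 * l.+1 = t * l + t + l + 1)%N by lia.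
have -> : (t.+1 * t.+1 = t ^ 2 + 2 * t + 1)%N by lia.
lia.
Qed.

Lemma total_cost_le (A B n t k D : nat) : (1 < n)%N -> (k <= n)%N ->
  (D <= k * (t + t + 2))%N ->
  (100 + n * (100 + A * (n + n * (trunc_log 2 n).+1)) + D * (B * unit_cost n t) <=
   (200 + 3 * A + 40 * B) * (k * t ^ 3 + k * t * n + n ^ 2 * trunc_log 2 n))%N.
Proof.
move=> n1 kn Dk; have n0 := ltnW n1; set l := trunc_log 2 n.
have l1 : (0 < l)%N by rewrite trunc_log_gt0.
set M := (n ^ 2 * l)%N.
have n2 : (n <= n ^ 2)%N by rewrite -mulnn leq_pmull.
have n2M : (n ^ 2 <= M)%N by rewrite leq_pmulr.
have E : (n * (n + n * l.+1) <= 3 * M)%N by rewrite /M; lia.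
have DU : (D * unit_cost n t <= 40 * (k * t ^ 3 + k * t * n + M))%N.
  (* For t = 0 the bound has no k term left, and the 2 k pairs at cost 4 n are charged to n^2 l,
     where l >= 1 since n > 1. For t > 0, 2t + 2 <= 4t, and 4 times 9 n + 10 t^2 yields the constant
     40. *)
  case: t Dk => [|t] Dk.
    have lM : (l <= n)%N.
      by apply: leq_trans (ltnW (ltn_expl l (isT : (1 < 2)%N))) (@trunc_logP 2 n isT n0).
    have D2 : (D <= 2 * n)%N by lia.
    have u4 : (unit_cost n 0 <= 4 * n)%N by rewrite /unit_cost -/l; lia.
    by apply: leq_trans (leq_mul D2 u4) _; lia.
  have u := @unit_cost_le n t.+1 isT n0.
  have D2 : (D <= 4 * (k * t.+1))%N by lia.
  apply: leq_trans (leq_mul D2 u) _.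
  by rewrite (expnS _ 2); move: (t.+1 ^ 2)%N => q; lia.
have -> : (D * (B * unit_cost n t) = B * (D * unit_cost n t))%N by lia.
have := leq_mul (leqnn B) DU; have := leq_mul (leqnn A) E.
have -> : (n * (100 + A * (n + n * l.+1)) = 100 * n + A * (n * (n + n * l.+1)))%N by lia.
move: (k * t ^ 3 + k * t * n)%N (n * (n + n * l.+1))%N (D * _)%N => p q r h1 h2.
have h3 : (100 + 100 * n <= 200 * M)%N by lia.
lia.
Qed.

Section Final.
Variable R : realType.

Lemma trunc_log_ln n : (0 < n)%N -> (trunc_log 2 n)%:R * ln 2 <= ln n%:R :> R.
Proof.
move=> n0; have h : ((2 ^ trunc_log 2 n)%:R : R) <= n%:R by rewrite ler_nat trunc_logP.
rewrite mulr_natl -lnXn ?ltr0n // -natrX ler_ln // posrE ltr0n ?expn_gt0 //.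
Qed.

(** The factor (ln 2)^-1 changes the base of the logarithm; the summand 1 preserves the coefficient
    of the other terms. *)
Lemma ln_time_bound (n t k T c : nat) : (1 < n)%N ->
  (T <= c * (k * t ^ 3 + k * t * n + n ^ 2 * trunc_log 2 n))%N ->
  T%:R <= (c%:R * (1 + (ln 2)^-1)) *
    (k%:R * t%:R ^+ 3 + k%:R * t%:R * n%:R + n%:R ^+ 2 * ln n%:R) :> R.
Proof.
move=> n1 hT; have n0 := ltnW n1.
have ln2 : 0 < ln 2 :> R by apply: ln_gt0; rewrite ltr1n.
have hl := trunc_log_ln n0.
have hl' : (trunc_log 2 n)%:R <= (ln 2)^-1 * ln n%:R :> R by rewrite mulrC ler_pdivlMr.
have ln0 : 0 <= ln n%:R :> R by apply: ln_ge0; rewrite ler1n.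
apply: (@le_trans _ _ (c%:R * (k%:R * t%:R ^+ 3 + k%:R * t%:R * n%:R +
    n%:R ^+ 2 * (trunc_log 2 n)%:R))).
  by rewrite -!natrX -!natrM -!natrD -natrM ler_nat.
rewrite -[leRHS]mulrA ler_wpM2l ?ler0n //.
have iv : 0 <= (ln 2)^-1 :> R by rewrite invr_ge0 ltW.
set p := k%:R * _ + _; have p0 : 0 <= p by rewrite addr_ge0 ?mulr_ge0 ?ler0n // exprn_ge0.
have q0 : 0 <= n%:R ^+ 2 :> R by rewrite exprn_ge0.
have h1 : n%:R ^+ 2 * (trunc_log 2 n)%:R <= n%:R ^+ 2 * ((ln 2)^-1 * ln n%:R) :> R.
  by rewrite ler_wpM2l.
have h2 : 0 <= n%:R ^+ 2 * ln n%:R :> R by rewrite mulr_ge0.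
have h3 : 0 <= (ln 2)^-1 * p by rewrite mulr_ge0.
by rewrite mulrDl mul1r mulrDr; lra.
Qed.
End Final.

Theorem theorem1 (R : realType) :
  exists (P : cmd) (C : R),
  forall (n t : nat) (X : 'I_n -> 'rV[R]_2),
    injective X -> no_three_collinear X -> (2 * t < n)%N ->
    exists (T : nat) (s : state R),
      [/\ exec P (input t X) T s,
          is_MER X t (output s) &
          let k := num_layer_points X t in
          (1 < n)%N ->
          T%:R <= C * (k%:R * t%:R ^+ 3 + k%:R * t%:R * n%:R + n%:R ^+ 2 * ln n%:R)].
Proof.
have [KP process_ok] := @runs_process R.
have [KO hO] := @runs_select R ORD nN isT.
exists main, ((200 + 3 * (3000 + KO) + 40 * KP)%N%:R * (1 + (ln 2)^-1)).
move=> n t X injX gpX t2n.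
have tn : (t < n)%N by lia.
have n0 : (0 < n)%N by lia.
set x := rmem (input t X) 0%N; set y := rmem (input t X) 1%N.
have gp := @input_cross R n t X injX gpX.
have dis := @input_distinct R n t X injX.
have hproc s i j : inputs n t x y s -> nmem s vI 0%N = i -> nmem s vJ 0%N = j ->
    (i < n)%N -> sqdist x y i j != 0 -> out_inv (valid_rect n t x y) s ->
    runs process s (KP * unit_cost n t) (fun s' =>
    [/\ out_inv (valid_rect n t x y) s', improves s s'
      & forall v, target n t x y i j v -> good s' v]).
  move=> [hn ht hx hy] hi hj iN d0 inv; rewrite -hx -hy in d0 inv *.
  exact: process_ok.
have hsel s : inputs n t x y s -> runs (select ORD nN) s (KO * (n + n * (trunc_log 2 n).+1))
    (fun s' => selected n (rmem s KEY) n (nmem s' ORD)).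
  move=> [hn ht hx hy]; apply: hO => // s' e; by rewrite /= e.
have inp : inputs n t x y (input t X) by [].
have [||T [s [ex Tle [inv small cand]]]] := runs_main gp dis tn hproc hsel inp erefl.
- by apply/funext => k /=; case: (insub k : option 'I_n).
- by rewrite /=; case: (insub 0%N : option 'I_n).
exists T, s; split=> //; last first.
  move=> k n1; apply: ln_time_bound => //; apply: leq_trans Tle _.
  apply: total_cost_le => //; last exact: degree_sum_le.
  by rewrite -[leqRHS]card_ord max_card.
(* From 2 t < n and n > 1 it follows that n - t >= 2, so an admissible rectangle covers two points
   and some pair is available. *)
have two (Q : pred nat) : (1 < n)%N -> (n - t <= count Q (iota 0 n))%N ->
    exists a b, [/\ a \in [seq k <- iota 0 n | Q k], b \in [seq k <- iota 0 n | Q k] & a != b].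
  move=> n1; rewrite -size_filter; have : uniq [seq k <- iota 0 n | Q k].
    by rewrite filter_uniq // iota_uniq.
  case: [seq k <- iota 0 n | Q k] => [|a [|b S]] /=; [lia | lia |].
  move=> /andP[]; rewrite inE negb_or => /andP[ab _] _ _.
  by exists a, b; split; rewrite // !inE eqxx ?orbT.
have boxes (Q : pred nat) u P : (1 < n)%N -> (n - t <= count Q (iota 0 n))%N -> 0 < sqnorm u ->
    four_supports x y [seq k <- iota 0 n | Q k] u P -> good s (box_area x y u P).
  move=> n1 cQ u0 hP; have [a [b [aS bS ab]]] := two Q n1 cQ.
  have [v [i [j [le_v iN jN sh tv]]]] := exists_target dis u0 cQ tn hP aS bS ab.
  by apply: good_le le_v _; apply: cand sh _ tv.
have best r : is_rectangle r -> (n - t <= #|covered X r|)%N -> good s (area r).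
  move=> hr cov; case: (leqP n 1) => [/small|n1].
    by apply: good_le; rewrite /area mulr_ge0 ?sqrtr_ge0.
  rewrite (covered_count t) -/x -/y in cov; set Q := (Q in count Q _) in cov.
  have [a [b [aS bS ab]]] := two Q n1 cov.
  have nz : (x b - x a != 0) || (y b - y a != 0).
    by move: aS bS; rewrite !mem_filter !mem_iota => /andP[_ aN] /andP[_ bN]; apply: dis.
  have [|u [P [u0 hP le_area]]] := @region_box R x y [seq k <- iota 0 n | Q k] r a b hr _ aS bS nz.
    by move=> k; rewrite mem_filter => /andP[/asboolP].
  by apply: good_le le_area _; apply: boxes hP.
(* Any admissible box shows that something was stored; the axis-parallel box of all points will
   do. *)
have found : (0 < nmem s HAVE 0)%N.
  case: (leqP n 1) => [/small[]//|n1].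
  have cT : (n - t <= count predT (iota 0 n))%N by rewrite count_predT size_iota leq_subr.
  have [a [_ [aS _ _]]] := two predT n1 cT.
  have [P hP] := exists_four_supports x y (1, 0) aS.
  have u0 : 0 < sqnorm (1, 0) :> R by rewrite /sqnorm /=; lra.
  by have [] := boxes predT (1, 0) P n1 cT u0 hP.
have [hr har hcov] := inv found.
split=> //; first by rewrite (covered_count t).
by move=> r' hr' cov'; rewrite har; have [] := best r' hr' cov'.
Qed.
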